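(* Let $n=3$, $t_0=\frac{9+4\sqrt{16-6\sqrt3}}{2(3\sqrt3+16)}\simeq0.43575$ and $t_1=\frac{\sqrt6+1}{10}\simeq0.34495$. For $0\le t\le\frac1{2\sqrt3}$ let $$a^{[t]}=\left(\tfrac12\sqrt{2-8t^2}-t,\ t,\ t,\ -(\tfrac12\sqrt{2-8t^2}+t)\right)\in S^3 .$$ For $t\in[\frac1{2\sqrt3},t_1]$ let $$a^{\{t\}}=(\tilde a_1,\tilde a_1,b_+,b_-)\in S^3,\qquad b_\pm=-\tilde a_1\pm\tfrac12\sqrt{2-8\tilde a_1^2},$$ where $\tilde a_1\in[\frac1{2\sqrt3},\frac12]$ is the unique solution of $\phi(a_1)=t$ with $$\phi(a_1)=\frac{a_1(5-12a_1^2)+(6a_1^2-\frac12)\sqrt{28a_1^2-1}}{1+36a_1^2}.$$ Then the extrema of $A(\cdot,t)$ over all $a\in S^3$ with $\sum_{j=1}^4a_j=0$ are as follows. Maximum: (i) for $0\le t\le\frac1{2\sqrt3}$, the maximum is attained at $a^{[t]}$ and $A(a^{[t]},t)=\frac1{\sqrt{2-8t^2}}$; (ii) for $\frac1{2\sqrt3}<t\le t_1$, the maximum is attained at $a^{\{t\}}$; (iii) for $t_1\le t\le t_0$, the maximum is attained at $a^{(2)}$ and $A(a^{(2)},t)=\frac12-2t^2$; (iv) for $t_0\le t<\frac{\sqrt3}2$, the maximum is attained at $a^{(1)}$ and $A(a^{(1)},t)=\frac{3\sqrt3}{8}\left(\frac{\sqrt3}{2}-t\right)^2$. Minimum: for $0\le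 t\le\frac1{2\sqrt3}$, the minimum is attained at $a^{(1)}$ and $A(a^{(1)},t)=\frac{3\sqrt3}8\left(\frac{\sqrt3}2-t\right)^2$.
   Context: $\Delta^3=\{x\in\mathbb{R}^4: x_j\ge0,\ \sum_{j=1}^4x_j=1\}$ is the regular tetrahedron of side-length $\sqrt2$, $S^3=\{a\in\mathbb{R}^4:\sum_{j=1}^4a_j^2=1\}$. For $a\in S^3$ with $\sum_{j=1}^4a_j=0$ and $t\in\mathbb{R}$, $A(a,t)=\mathrm{vol}_2(\{x\in\Delta^3:\langle a,x\rangle=t\})$ is the area of the section of $\Delta^3$ orthogonal to $a$ at distance $t$ from the centroid. $a^{(1)}=\frac1{2\sqrt3}(3,-1,-1,-1)$ and $a^{(2)}=\frac12(1,1,-1,-1)$. *)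

(* Defs.v *)
From HB Require Import structures.
From mathcomp Require Import all_boot all_order all_algebra.
From mathcomp Require Import all_classical all_reals all_analysis.

Set Implicit Arguments.
Unset Strict Implicit.
Unset Printing Implicit Defensive.

Import Order.TTheory GRing.Theory Num.Theory.

Local Open Scope classical_set_scope.
Local Open Scope ring_scope.

Definition dotp (R : realType) (n : nat) (x y : 'rV[R]_n) : R :=
  \sum_(j < n) x ord0 j * y ord0 j.

Definition vec4 (R : realType) (x1 x2 x3 x4 : R) : 'rV[R]_4 :=
  \row_(j < 4) [:: x1; x2; x3; x4]`_j.

(* A triple (p, u, v) with u, v orthonormal encodes the isometric embedding
   (s, r) |-> p + s u + r v of the Euclidean plane into R^n. *)
Definition chart (R : realType) (n : nat)
    (c : 'rV[R]_n * 'rV[R]_n * 'rV[R]_n) (z : R * R) : 'rV[R]_n :=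
  c.1.1 + z.1 *: c.1.2 + z.2 *: c.2.

Definition orthonormal_chart (R : realType) (n : nat)
    (c : 'rV[R]_n * 'rV[R]_n * 'rV[R]_n) : Prop :=
  [/\ dotp c.1.2 c.1.2 = 1, dotp c.2 c.2 = 1 & dotp c.1.2 c.2 = 0].

Definition lebesgue_measure2 (R : realType) (D : set (R * R)) : \bar R :=
  (@lebesgue_measure R \x @lebesgue_measure R)%E D.

(* Area of a planar subset S of R^n: the planar Lebesgue measure of S read in
   orthonormal coordinates of an affine 2-plane containing S.  Neither the
   plane (not unique when S lies on a line) nor the coordinates matter, as
   planar Lebesgue measure is invariant under isometries; one chart is picked
   by choice.  When S lies in no affine 2-plane, the value is meaningless. *)
Definition vol2 (R : realType) (n : nat) (S : set 'rV[R]_n) : \bar R :=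
  lebesgue_measure2 (chart
    (xget (0, 0, 0)
      [set c | orthonormal_chart c /\ S `<=` range (chart c)]) @^-1` S).

Definition simplex3 (R : realType) : set 'rV[R]_4 :=
  [set x | (forall j, 0 <= x ord0 j) /\ \sum_(j < 4) x ord0 j = 1].

Definition sphere3 (R : realType) : set 'rV[R]_4 :=
  [set a | \sum_(j < 4) a ord0 j ^+ 2 = 1].

Definition directions (R : realType) : set 'rV[R]_4 :=
  [set a | sphere3 a /\ \sum_(j < 4) a ord0 j = 0].

Definition section_area (R : realType) (a : 'rV[R]_4) (t : R) : \bar R :=
  vol2 [set x | simplex3 x /\ dotp a x = t].

Definition max_attained_at (R : realType) (T : Type) (D : set T)
    (f : T -> \bar R) (a : T) : Prop :=
  D a /\ forall b, D b -> (f b <= f a)%E.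

Definition min_attained_at (R : realType) (T : Type) (D : set T)
    (f : T -> \bar R) (a : T) : Prop :=
  D a /\ forall b, D b -> (f a <= f b)%E.

Definition a_one (R : realType) : 'rV[R]_4 :=
  (2 * Num.sqrt 3)^-1 *: vec4 3 (-1) (-1) (-1).

Definition a_two (R : realType) : 'rV[R]_4 :=
  2^-1 *: vec4 1 1 (-1) (-1).

Definition t_zero (R : realType) : R :=
  (9 + 4 * Num.sqrt (16 - 6 * Num.sqrt 3)) / (2 * (3 * Num.sqrt 3 + 16)).

Definition t_one (R : realType) : R := (Num.sqrt 6 + 1) / 10.

(* a^{[t]} *)
Definition a_bracket (R : realType) (t : R) : 'rV[R]_4 :=
  vec4 (2^-1 * Num.sqrt (2 - 8 * t ^+ 2) - t) t t
       (- (2^-1 * Num.sqrt (2 - 8 * t ^+ 2) + t)).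

Definition phi (R : realType) (x : R) : R :=
  (x * (5 - 12 * x ^+ 2) + (6 * x ^+ 2 - 2^-1) * Num.sqrt (28 * x ^+ 2 - 1))
  / (1 + 36 * x ^+ 2).

(* a^{\{t\}}, as a function of the solution x of phi x = t *)
Definition a_brace (R : realType) (x : R) : 'rV[R]_4 :=
  vec4 x x (- x + 2^-1 * Num.sqrt (2 - 8 * x ^+ 2))
           (- x - 2^-1 * Num.sqrt (2 - 8 * x ^+ 2)).

Definition phi_solution (R : realType) (t x : R) : Prop :=
  (2 * Num.sqrt 3)^-1 <= x <= 2^-1 /\ phi x = t.

(* Main.v *)
(* Let x >= y >= z >= w be the sorted entries of a direction a. Projecting the section
   to the two middle coordinates shows that its area is
     (x - t)^2 / ((x - y)(x - z)(x - w))                        for y <= t < x,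
     (t - w)^2 / ((x - w)(y - w)(z - w))                        for w < t <= z,
   and in between, where the section is a quadrilateral, with s = 2 t, p = x + y and
   m = (x + z)(x + w),
     (p (2 p^2 - 1 - s^2) - 2 s m) / (2 (p^2 (2 p^2 - 1) + m^2)),   |m| <= (1 - p^2) / 2.
   For s <= 1 / sqrt 3 all three are at most 1 / sqrt (2 - 2 s^2) by elementary
   inequalities. For larger s the third is largest at m = - (1 - p^2) / 2, i.e. x = y,
   which leaves a function g of p on [s, 1]; its maximum is at p = 1 if s >= 2 t_1 and
   otherwise at the critical point p = 2 a_1 with phi(a_1) = t, where the comparison
   with any other p is an exact factorization with a double root. In the first case,
   for fixed x the product (x - y)(x - z)(x - w) decreases in y, so one may take y = t,
   which gives a value of the third formula as long as a direction with entries x, t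
   exists; the remaining directions are handled by Schur's inequality, which is sharp
   at the vertex direction a^(1). For the minimum, Newton's inequality for x - y, x - z,
   x - w settles the triangles and concavity in t reduces the quadrilaterals to them. *)
From HB Require Import structures.
Require Import Defs.
From mathcomp Require Import all_boot all_order all_algebra.
From mathcomp Require Import all_classical all_reals all_analysis.
From mathcomp Require Import measurable_realfun ring lra.
Import Order.TTheory GRing.Theory Num.Theory.
Local Open Scope classical_set_scope.
Local Open Scope ring_scope.

(** * Planar Lebesgue measure *)

(** [vol2] reads a section in a chart picked by choice, so no convenient coordinates can be assumed:
    areas are computed for whatever orthonormal chart was picked, hence the change of variables for
    planar affine maps. Both thresholds come from comparing candidates. With s = 2 t, 2 t_1 is the
    positive root of 5 s^2 - 2 s - 1, where the gap between the value at p = 1 and g gets a double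
    zero at p = 1; t_0 is the positive solution of the quadratic equation between 1/2 - 2 t^2 and
    the area for a^(1). The method for triangles changes at t = sqrt 3 / 4, slightly below t_0,
    because the comparison with the vertex direction needs 2 t / sqrt 3 >= 1/2. In the estimates for
    triangles and quadrilaterals k stands for 1 / sqrt 3 and enters through 0 < k and 3 k^2 = 1;
    where there is room it is replaced by the rational bounds 15/26 and 26/45. *)

Lemma measurable_affine (R : realType) (k c : R) :
  measurable_fun [set: measurableTypeR R]
    (fun y : measurableTypeR R => (k * y + c : measurableTypeR R)).
Proof. by apply: measurable_funD => //; apply: measurable_funM. Qed.

(** Uniqueness of Lebesgue measure: the push-forward along the affine map, scaled by |k|, agrees
    with it on half-open intervals. *)
Lemma lebesgue_measure_affine (R : realType) (k c : R)
    (D : set (measurableTypeR R)) : k != 0 -> measurable D ->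
  lebesgue_measure [set y : measurableTypeR R | D (k * y + c)] =
  (`|k|^-1%:E * lebesgue_measure D)%E.
Proof.
move=> k0 mD.
pose f := fun y : measurableTypeR R => (k * y + c : measurableTypeR R).
have mf : measurable_fun setT f := @measurable_affine R k c.
have nk : 0 <= `|k| by [].
pose nu := measure_function_pushforward__canonical__measure_function_Measure (@lebesgue_measure R) mf.
pose mu : {measure set (measurableTypeR R) -> \bar R} := mscale (NngNum nk) nu.
suff -> : lebesgue_measure D = mu D.
  by rewrite /mu /mscale/= muleA -EFinM mulVf ?normr_eq0// mul1e.
apply: lebesgue_measure_unique => // X /ocitvP[->|[[a b] /= ab ->]].
  by rewrite !measure0.
rewrite /mu /mscale /pushforward /=.
change (pushforward lebesgue_measure f) with (fun A => @lebesgue_measure R (f @^-1` A)); cbv beta.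
have [kpos|kneg|] := ltgtP k 0; last by move/eqP; rewrite (negbTE k0).
(* Case k < 0: the interval is reversed, so the closed end is now the left one. *)
- have -> : f @^-1` `]a, b] = `[(b - c) / k, (a - c) / k[%classic.
    apply/seteqP; split => y /=; rewrite !in_itv /= /f => /andP[h1 h2]; apply/andP; split.
    + by rewrite ler_ndivrMr// mulrC; lra.
    + by rewrite ltr_ndivlMr// mulrC; lra.
    + by move: h2; rewrite ltr_ndivlMr// mulrC; lra.
    + by move: h1; rewrite ler_ndivrMr// mulrC; lra.
  rewrite !lebesgue_measure_itv/= !lte_fin ab ltr_ndivrMr// divfK//.
  have -> : a - c < b - c by lra.
  rewrite -!EFinD -EFinM ltr0_norm//; congr (_%:E); field.
  exact: k0.
- have -> : f @^-1` `]a, b] = `](a - c) / k, (b - c) / k]%classic.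
    apply/seteqP; split => y /=; rewrite !in_itv /= /f => /andP[h1 h2]; apply/andP; split.
    + by rewrite ltr_pdivrMr// mulrC; lra.
    + by rewrite ler_pdivlMr// mulrC; lra.
    + by move: h1; rewrite ltr_pdivrMr// mulrC; lra.
    + by move: h2; rewrite ler_pdivlMr// mulrC; lra.
  rewrite !lebesgue_measure_itv/= !lte_fin ab ltr_pdivrMr// divfK//.
  have -> : a - c < b - c by lra.
  rewrite -!EFinD -EFinM gtr0_norm//; congr (_%:E); field.
  exact: k0.
Qed.

Section plane.
Variable R : realType.
Local Notation T := (measurableTypeR R).
Local Notation mu := (@lebesgue_measure R).

(** Tonelli: slicing in the other order, for maps that act on the first coordinate. *)
Lemma lebesgue_measure2_yx (D : set (T * T)) : measurable D ->
  lebesgue_measure2 D = (\int[mu]_y mu (ysection D y))%E.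
Proof.
move=> mD; rewrite /lebesgue_measure2.
have := @product_measure_unique _ _ T T R mu mu (mu \x^ mu)%E _ D mD.
by apply => A B mA mB; rewrite [LHS]product_measure2E.
Qed.

Lemma lebesgue_measure2_row (k l c : R) (D : set (T * T)) : k != 0 ->
  measurable D ->
  lebesgue_measure2 [set z : T * T | D (z.1, l * z.1 + k * z.2 + c)] =
  (`|k|^-1%:E * lebesgue_measure2 D)%E.
Proof.
move=> k0 mD; rewrite /lebesgue_measure2 /product_measure1 /=.
rewrite -ge0_integralZl//; last exact: measurable_fun_xsection.
apply: eq_integral => x _ /=.
rewrite -(@lebesgue_measure_affine R k (l * x + c) (xsection D x) k0); last first.
  exact: measurable_xsection.
congr (mu _); apply/seteqP; split => y;
  rewrite /xsection /= !inE /=;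
  by have -> : l * x + k * y + c = k * y + (l * x + c) by ring.
Qed.

Lemma lebesgue_measure2_col (k l c : R) (D : set (T * T)) : k != 0 ->
  measurable D ->
  measurable [set z : T * T | D (k * z.1 + l * z.2 + c, z.2)] ->
  lebesgue_measure2 [set z : T * T | D (k * z.1 + l * z.2 + c, z.2)] =
  (`|k|^-1%:E * lebesgue_measure2 D)%E.
Proof.
move=> k0 mD mD'; rewrite !lebesgue_measure2_yx//.
rewrite -ge0_integralZl//; last exact: measurable_fun_ysection.
apply: eq_integral => y _ /=.
rewrite -(@lebesgue_measure_affine R k (l * y + c) (ysection D y) k0); last first.
  exact: measurable_ysection.
congr (mu _); apply/seteqP; split => x;
  rewrite /ysection /= !inE /=;
  by have -> : k * x + l * y + c = k * x + (l * y + c) by ring.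
Qed.

Lemma measurable_affine2 (a b c : R) :
  measurable_fun [set: T * T] (fun z : T * T => (a * z.1 + b * z.2 + c : T)).
Proof.
apply: measurable_funD => //; apply: measurable_funD; apply: measurable_funM => //.
Qed.

Lemma measurable_affine2_preimage (a b c a' b' c' : R) (D : set (T * T)) :
  measurable D ->
  measurable [set z : T * T | D (a * z.1 + b * z.2 + c, a' * z.1 + b' * z.2 + c')].
Proof.
move=> mD; rewrite -[X in measurable X]setTI.
have := @measurable_fun_pair _ _ _ (T * T)%type T T _ _
  (measurable_affine2 a b c) (measurable_affine2 a' b' c') measurableT D mD.
exact.
Qed.

(** An invertible 2 x 2 matrix with nonzero pivot is a map changing only the first coordinate
    followed by one changing only the second, and each is handled by slicing. *)
Lemma lebesgue_measure2_affine (a b c a' b' c' : R) (D : set (T * T)) :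
  a * b' - b * a' != 0 -> measurable D ->
  lebesgue_measure2 [set z : T * T |
    D (a * z.1 + b * z.2 + c, a' * z.1 + b' * z.2 + c')] =
  (`|a * b' - b * a'|^-1%:E * lebesgue_measure2 D)%E.
Proof.
move=> d0 mD.
wlog a0 : a b a' b' d0 / a != 0.
  (* If a = 0, the map is the shear (z_1, z_2) |-> (z_1, z_1 + z_2) followed by a map with pivot a -
     b = - b, which is nonzero with the determinant. *)
  move=> H; have [a0|] := eqVneq a 0; last exact: H.
  pose D1 := [set z : T * T |
    D ((a - b) * z.1 + b * z.2 + c, (a' - b') * z.1 + b' * z.2 + c')].
  have d1 : (a - b) * b' - b * (a' - b') = a * b' - b * a' by ring.
  have b0 : b != 0 by apply: contraNneq d0 => ->; rewrite a0; apply/eqP; ring.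
  have := lebesgue_measure2_row 1 1 0 D1 (oner_neq0 _)
    (measurable_affine2_preimage _ _ _ _ _ _ _ mD).
  rewrite /D1 /= normr1 invr1 mul1e.
  have -> : [set z : T * T | D ((a - b) * z.1 + b * (1 * z.1 + 1 * z.2 + 0) + c,
      (a' - b') * z.1 + b' * (1 * z.1 + 1 * z.2 + 0) + c')] =
    [set z : T * T | D (a * z.1 + b * z.2 + c, a' * z.1 + b' * z.2 + c')].
    apply/funext => z /=; congr (D (_, _)); ring.
  by move=> ->; rewrite H ?d1// a0 sub0r oppr_eq0.
pose k := (a * b' - b * a') / a.
have k0 : k != 0 by rewrite mulf_neq0// invr_eq0.
pose D1 := [set z : T * T | D (1 * z.1 + 0 * z.2 + 0,
  (a' / a) * z.1 + k * z.2 + (c' - a' / a * c))].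
have mD1 : measurable D1 by exact: measurable_affine2_preimage.
pose D2 := [set z : T * T | D1 (a * z.1 + b * z.2 + c, 0 * z.1 + 1 * z.2 + 0)].
have mD2 : measurable D2 by exact: measurable_affine2_preimage.
have E2 : D2 = [set z : T * T | D1 (a * z.1 + b * z.2 + c, z.2)].
  by apply/funext => z; rewrite /D2 /=; congr (D1 (_, _)); ring.
have E1 : D1 = [set z : T * T | D (z.1, (a' / a) * z.1 + k * z.2 + (c' - a' / a * c))].
  by apply/funext => z; rewrite /D1 /=; congr (D (_, _)); ring.
have -> : [set z : T * T | D (a * z.1 + b * z.2 + c, a' * z.1 + b' * z.2 + c')] = D2.
  apply/funext => z; rewrite /D2 /D1 /= /k; congr (D (_, _)); first by ring.
  field; exact: a0.
rewrite E2 lebesgue_measure2_col -?E2//.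
rewrite E1 lebesgue_measure2_row// muleA -EFinM /k; congr (_%:E * _)%E.
by rewrite normrM normfV; field; rewrite !normr_eq0 a0 d0.
Qed.

End plane.

(** * Areas of planar triangles and quadrilaterals *)

Section planar_regions.
Variable R : realType.
Local Notation T := (measurableTypeR R).
Local Notation mu := (@lebesgue_measure R).

Lemma measurable_halfplane (a b c : R) :
  measurable [set z : T * T | 0 <= a * z.1 + b * z.2 + c].
Proof.
rewrite -[X in measurable X]setTI.
have := @measurable_affine2 R a b c measurableT `[0, +oo[%classic.
rewrite (_ : _ @^-1` _ = [set z : T * T | 0 <= a * z.1 + b * z.2 + c]).
  by apply; exact: measurable_itv.
by apply/seteqP; split => z /=; rewrite in_itv/= andbT.
Qed.

Lemma measurable_line (a b c : R) :
  measurable [set z : T * T | a * z.1 + b * z.2 = c].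
Proof.
rewrite -[X in measurable X]setTI.
have := @measurable_affine2 R a b 0 measurableT [set c].
rewrite (_ : _ @^-1` _ = [set z : T * T | a * z.1 + b * z.2 = c]).
  by apply; exact: measurable_set1.
by apply/seteqP; split => z /=; rewrite addr0.
Qed.

(** The similarity with rows (a, b) and (- b, a) makes the line vertical; its determinant is a^2 +
    b^2. *)
Lemma lebesgue_measure2_line (a b c : R) : (a != 0) || (b != 0) ->
  lebesgue_measure2 [set z : T * T | a * z.1 + b * z.2 = c] = 0%E.
Proof.
move=> ab.
pose D : set (T * T) := [set c] `*` setT.
have mD : measurable D by apply: measurableX => //; exact: measurable_set1.
have D0 : lebesgue_measure2 D = 0%E.
  rewrite /lebesgue_measure2 [LHS]product_measure1E//.
  by rewrite [X in (X * _)%E](lebesgue_measure_set1 c) mul0e.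
have d0 : a * a - b * (- b) != 0.
  rewrite mulrN opprK -!expr2 paddr_eq0 ?sqr_ge0// !sqrf_eq0 negb_and.
  exact: ab.
have := @lebesgue_measure2_affine R a b 0 (- b) a 0 D d0 mD.
rewrite D0 mule0 => <-; congr lebesgue_measure2.
by apply/seteqP; split => z /=; rewrite /D/= addr0 => // -[].
Qed.

Lemma lebesgue_measure2_subset0 (A B : set (T * T)) :
  measurable A -> measurable B -> A `<=` B ->
  lebesgue_measure2 B = 0%E -> lebesgue_measure2 A = 0%E.
Proof. by move=> mA mB AB B0; apply: (@subset_measure0 _ _ _ (mu \x mu)%E A B). Qed.

Lemma lebesgue_measure2_setU (A B L : set (T * T)) :
  measurable A -> measurable B -> measurable L ->
  A `&` B `<=` L -> lebesgue_measure2 L = 0%E ->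
  lebesgue_measure2 (A `|` B) = (lebesgue_measure2 A + lebesgue_measure2 B)%E.
Proof.
move=> mA mB mL ABL L0.
have AB0 : lebesgue_measure2 (B `&` A) = 0%E.
  by apply: lebesgue_measure2_subset0 L0 => //; [exact: measurableI|rewrite setIC].
have -> : A `|` B = A `|` (B `\` A).
  by apply/seteqP; split => z [Az|Bz]; [left|have [?|?] := pselect (A z); [left|right]|left|right; case: Bz].
rewrite /lebesgue_measure2 measureU//; last 2 first.
- exact: measurableD.
- by apply/seteqP; split => z // -[Az []].
congr (_ + _)%E.
by rewrite [RHS](measureDI _ mB mA) [X in (_ + X)%E]AB0 adde0.
Qed.

Definition std_triangle : set (T * T) :=
  [set z | [/\ 0 <= z.1, 0 <= z.2 & z.1 + z.2 <= 1]].

Lemma measurable_std_triangle : measurable std_triangle.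
Proof.
have -> : std_triangle = [set z : T * T | 0 <= 1 * z.1 + 0 * z.2 + 0] `&`
    [set z : T * T | 0 <= 0 * z.1 + 1 * z.2 + 0] `&`
    [set z : T * T | 0 <= -1 * z.1 + -1 * z.2 + 1].
  apply/seteqP; split => z /= => [[? ? ?]|[[? ?] ?]]; first by split; [split|]; lra.
  by split; lra.
by apply: measurableI; [apply: measurableI|]; exact: measurable_halfplane.
Qed.

Lemma lebesgue_measure2_std_triangle :
  lebesgue_measure2 std_triangle = (2^-1)%:E.
Proof.
(* The reflection of the triangle in the centre of the unit square; the two halves meet only in the
   diagonal. *)
pose S : set (T * T) := [set z | std_triangle (-1 * z.1 + 0 * z.2 + 1, 0 * z.1 + -1 * z.2 + 1)].
have mT := measurable_std_triangle.
have mS : measurable S by exact: measurable_affine2_preimage.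
have ST : lebesgue_measure2 S = lebesgue_measure2 std_triangle.
  rewrite lebesgue_measure2_affine//.
  by rewrite mulrNN mulr1 mulr0 subr0 normr1 invr1 mul1e.
have L0 : lebesgue_measure2 [set z : T * T | 1 * z.1 + 1 * z.2 = 1] = 0%E.
  by apply: lebesgue_measure2_line; rewrite oner_neq0.
have cap : std_triangle `&` S `<=` [set z : T * T | 1 * z.1 + 1 * z.2 = 1].
  by clear; move=> z [] /= [? ? ?] [/= ? ? ?]; lra.
have := lebesgue_measure2_setU _ _ _ mT mS (measurable_line 1 1 1) cap L0.
have -> : std_triangle `|` S = `[0, 1]%classic `*` `[0, 1]%classic.
  clear; apply/seteqP; split => z; rewrite /S /std_triangle /= !in_itv/=.
    by move=> [[? ? ?]|[? ? ?]]; split; lra.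
  move=> [? ?]; have [h|h] := leP (z.1 + z.2) 1; [left|right]; split; lra.
rewrite [X in X = _ -> _]product_measure1E//; try exact: measurable_itv.
rewrite [X in (X * _)%E]lebesgue_measure_itv [X in (_ * X)%E]lebesgue_measure_itv/=.
rewrite lte_fin ltr01 oppr0 adde0 mul1e ST => H; clear -H; move: H.
have : (0 <= lebesgue_measure2 std_triangle)%E by exact: measure_ge0.
case: (lebesgue_measure2 std_triangle) => [r| |] //= r0; rewrite -?EFinD => -[] H.
by congr (_%:E); lra.
Qed.

Lemma lebesgue_measure2_triangle (a b c a' b' c' : R) : a * b' - b * a' != 0 ->
  lebesgue_measure2 [set z : T * T | [/\ 0 <= a * z.1 + b * z.2 + c,
    0 <= a' * z.1 + b' * z.2 + c' &
    (a * z.1 + b * z.2 + c) + (a' * z.1 + b' * z.2 + c') <= 1]] =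
  (`|a * b' - b * a'|^-1 / 2)%:E.
Proof.
move=> d0; have := @lebesgue_measure2_affine R a b c a' b' c' _ d0 measurable_std_triangle.
by rewrite lebesgue_measure2_std_triangle -EFinM.
Qed.

Lemma measurable_triangle (a b c a' b' c' : R) :
  measurable [set z : T * T | [/\ 0 <= a * z.1 + b * z.2 + c,
    0 <= a' * z.1 + b' * z.2 + c' &
    (a * z.1 + b * z.2 + c) + (a' * z.1 + b' * z.2 + c') <= 1]].
Proof. exact: (@measurable_affine2_preimage R a b c a' b' c' _ measurable_std_triangle). Qed.

Lemma area_corner_triangle (a b c : R) : 0 < a -> 0 < b -> 0 < c ->
  lebesgue_measure2 [set z : T * T | [/\ 0 <= z.1, 0 <= z.2 & a * z.1 + b * z.2 <= c]] =
  (c ^+ 2 / (2 * a * b))%:E.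
Proof.
move=> a0 b0 c0.
have -> : c ^+ 2 / (2 * a * b) = `|(a / c) * (b / c) - 0 * 0|^-1 / 2.
  rewrite mulr0 subr0 gtr0_norm; last by rewrite mulr_gt0// divr_gt0.
  by field; rewrite !gt_eqF.
rewrite -(@lebesgue_measure2_triangle _ _ 0 _ _ 0); last first.
  by rewrite mulr0 subr0 mulf_neq0// mulf_neq0 ?invr_eq0 ?gt_eqF.
congr lebesgue_measure2; apply/funext => z /=.
have -> : a / c * z.1 + 0 * z.2 + 0 = z.1 * (a / c) by ring.
have -> : 0 * z.1 + b / c * z.2 + 0 = z.2 * (b / c) by ring.
have -> : z.1 * (a / c) + z.2 * (b / c) = (a * z.1 + b * z.2) / c by ring.
by rewrite !pmulr_lge0 ?divr_gt0// ler_pdivrMr// mul1r.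
Qed.

Lemma measurable_quadrant (a b c a' b' c' : R) :
  measurable [set z : T * T | [/\ 0 <= z.1, 0 <= z.2,
    a * z.1 + b * z.2 <= c & a' * z.1 + b' * z.2 <= c']].
Proof.
rewrite (_ : mkset _ =
    ([set z : T * T | 0 <= 1 * z.1 + 0 * z.2 + 0] `&`
    [set z : T * T | 0 <= 0 * z.1 + 1 * z.2 + 0]) `&`
    ([set z : T * T | 0 <= - a * z.1 + - b * z.2 + c] `&`
    [set z : T * T | 0 <= - a' * z.1 + - b' * z.2 + c'])).
  by do 2 apply: measurableI; exact: measurable_halfplane.
apply/seteqP; split => z /= => [[? ? ? ?]|[[? ?] [? ?]]]; last by split; lra.
by do !split; lra.
Qed.

(* The diagonal through the corner (x, y) splits the quadrilateral into two
   triangles with common apex at the origin. *)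
Lemma area_corner_quad (a b c a' b' c' x y : R) :
  0 < a -> 0 <= b -> 0 <= a' -> 0 < b' -> 0 < x -> 0 < y ->
  0 <= a * b' - a' * b ->
  a * x + b * y = c -> a' * x + b' * y = c' ->
  lebesgue_measure2 [set z : T * T | [/\ 0 <= z.1, 0 <= z.2,
    a * z.1 + b * z.2 <= c & a' * z.1 + b' * z.2 <= c']] =
  ((c / a * y + c' / b' * x) / 2)%:E.
Proof.
move=> a0 b0 a'0 b'0 x0 y0 ab E1 E2.
have c0 : 0 < c by rewrite -E1; nra.
have c'0 : 0 < c' by rewrite -E2; nra.
(* Barycentric coordinates: [A] has vertices (0, 0), (c / a, 0), (x, y), and [B] has vertices (0,
   0), (x, y), (0, c' / b'). *)
pose A : set (T * T) := [set z | [/\ 0 <= (a / c) * z.1 + (- (x * a / (y * c))) * z.2 + 0,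
   0 <= 0 * z.1 + y^-1 * z.2 + 0 &
   ((a / c) * z.1 + (- (x * a / (y * c))) * z.2 + 0) + (0 * z.1 + y^-1 * z.2 + 0) <= 1]].
pose B : set (T * T) := [set z | [/\ 0 <= x^-1 * z.1 + 0 * z.2 + 0,
   0 <= (- (y * b' / (x * c'))) * z.1 + (b' / c') * z.2 + 0 &
   (x^-1 * z.1 + 0 * z.2 + 0) + ((- (y * b' / (x * c'))) * z.1 + (b' / c') * z.2 + 0) <= 1]].
have AE z : A z = [/\ x * z.2 <= y * z.1, 0 <= z.2 & a * z.1 + b * z.2 <= c].
  rewrite /A /=.
  have -> : a / c * z.1 + - (x * a / (y * c)) * z.2 + 0 =
      (y * z.1 - x * z.2) * (a / (y * c)) by field; rewrite !gt_eqF.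
  have -> : 0 * z.1 + y^-1 * z.2 + 0 = z.2 / y by ring.
  have -> : (y * z.1 - x * z.2) * (a / (y * c)) + z.2 / y = (a * z.1 + b * z.2) / c.
    by rewrite -E1; field; rewrite E1 !gt_eqF.
  by rewrite !pmulr_lge0 ?ler_pdivrMr ?mul1r ?subr_ge0 ?invr_gt0 ?divr_gt0 ?mulr_gt0.
have BE z : B z = [/\ 0 <= z.1, y * z.1 <= x * z.2 & a' * z.1 + b' * z.2 <= c'].
  rewrite /B /=.
  have -> : - (y * b' / (x * c')) * z.1 + b' / c' * z.2 + 0 =
      (x * z.2 - y * z.1) * (b' / (x * c')) by field; rewrite !gt_eqF.
  have -> : x^-1 * z.1 + 0 * z.2 + 0 = z.1 / x by ring.
  have -> : z.1 / x + (x * z.2 - y * z.1) * (b' / (x * c')) = (a' * z.1 + b' * z.2) / c'.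
    by rewrite -E2; field; rewrite E2 !gt_eqF.
  by rewrite !pmulr_lge0 ?ler_pdivrMr ?mul1r ?subr_ge0 ?invr_gt0 ?divr_gt0 ?mulr_gt0.
have -> : [set z : T * T | [/\ 0 <= z.1, 0 <= z.2,
    a * z.1 + b * z.2 <= c & a' * z.1 + b' * z.2 <= c']] = A `|` B.
  apply/seteqP; split => z.
    move=> /= [z1 z2 h h']; have [le|/ltW le] := leP (x * z.2) (y * z.1).
      by left; rewrite AE.
    by right; rewrite BE.
  case; [rewrite AE => -[d z2 h] /=|rewrite BE => -[z1 d h] /=].
    have z1 : 0 <= z.1 by rewrite -(pmulr_rge0 _ y0); apply: le_trans d; nra.
    (* In [A] the second line constrains nothing new: z_2 <= y, and the lines cross at (x, y) with a
       b' - a' b >= 0. *)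
    split=> //; have H : 0 <= (c' - (a' * z.1 + b' * z.2)) * a.
      have -> : (c' - (a' * z.1 + b' * z.2)) * a =
        a' * (c - (a * z.1 + b * z.2)) + (a * b' - a' * b) * (y - z.2).
        by rewrite -E1 -E2; ring.
      have : z.2 <= y.
        have : c * z.2 <= c * y by rewrite -{1}E1; nra.
        by rewrite ler_pM2l.
      nra.
    by rewrite pmulr_lge0// subr_ge0 in H.
  have z2 : 0 <= z.2 by rewrite -(pmulr_rge0 _ x0); apply: le_trans d; nra.
  split=> //; have H : 0 <= (c - (a * z.1 + b * z.2)) * b'.
    have -> : (c - (a * z.1 + b * z.2)) * b' =
      b * (c' - (a' * z.1 + b' * z.2)) + (a * b' - a' * b) * (x - z.1).
      by rewrite -E1 -E2; ring.
    have : z.1 <= x.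
      have : c' * z.1 <= c' * x by rewrite -{1}E2; nra.
      by rewrite ler_pM2l.
    nra.
  by rewrite pmulr_lge0// subr_ge0 in H.
rewrite (lebesgue_measure2_setU _ _ [set z : T * T | y * z.1 + - x * z.2 = 0]);
  [|exact: measurable_triangle|exact: measurable_triangle|exact: measurable_line| |]; last 2 first.
- by move=> z [] ; rewrite AE BE /= => -[? ? ?] [? ? ?]; lra.
- by apply: lebesgue_measure2_line; rewrite gt_eqF.
rewrite !lebesgue_measure2_triangle -?EFinD; last 2 first.
- by rewrite ?mulr0 ?mul0r subr0 !mulf_neq0 ?invr_eq0 ?gt_eqF.
- by rewrite ?mulr0 ?mul0r subr0 !mulf_neq0 ?invr_eq0 ?gt_eqF.
rewrite !mulr0 mul0r !subr0 !gtr0_norm ?mulr_gt0 ?invr_gt0//; congr (_%:E).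
by field; rewrite !gt_eqF.
Qed.

End planar_regions.

(** * Sections of the simplex *)

Section charts.
Variable R : realType.
Local Notation T := (measurableTypeR R).
Implicit Types (a x u v : 'rV[R]_4) (i : 'I_4).

Lemma sum_uniq4 (i0 i1 i2 i3 : 'I_4) (F : 'I_4 -> R) :
  uniq [:: i0; i1; i2; i3] ->
  \sum_(j < 4) F j = F i0 + F i1 + F i2 + F i3.
Proof.
move=> U; have -> : \sum_(j < 4) F j = \sum_(j <- [:: i0; i1; i2; i3]) F j.
  apply: perm_big; apply: uniq_perm => //; first exact: index_enum_uniq.
  have E := @uniq_min_size _ [:: i0; i1; i2; i3] (index_enum 'I_4) U.
  have [] := E _ _.
  - by move=> j _; rewrite mem_index_enum.
  - by rewrite /index_enum -enumT size_enum_ord.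
  - by move=> _ H j; rewrite H.
by rewrite !big_cons big_nil addr0 !addrA.
Qed.

Lemma forall_uniq4 (i0 i1 i2 i3 : 'I_4) (P : 'I_4 -> Prop) :
  uniq [:: i0; i1; i2; i3] ->
  (forall j, P j) <-> [/\ P i0, P i1, P i2 & P i3].
Proof.
move=> U; split=> [H|[P0 P1 P2 P3] j]; first by split; exact: H.
have : j \in [:: i0; i1; i2; i3].
  have [] := @uniq_min_size _ [:: i0; i1; i2; i3] (index_enum 'I_4) U.
  - by move=> k _; rewrite mem_index_enum.
  - by rewrite /index_enum -enumT size_enum_ord.
  - by move=> _ ->; rewrite mem_index_enum.
by rewrite !inE => /or4P[] /eqP ->.
Qed.

Lemma sorted_uniq4 a : exists i0 i1 i2 i3 : 'I_4,
  uniq [:: i0; i1; i2; i3] /\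
  [/\ a ord0 i1 <= a ord0 i0, a ord0 i2 <= a ord0 i1 & a ord0 i3 <= a ord0 i2].
Proof.
pose r : rel 'I_4 := fun i j => a ord0 j <= a ord0 i.
have tr : total r by move=> i j; rewrite /r; exact: le_total.
have := sort_sorted tr (enum 'I_4); have := sort_uniq r (enum 'I_4).
rewrite enum_uniq; have := size_sort r (enum 'I_4); rewrite size_enum_ord.
case: (sort r _) => [|i0 [|i1 [|i2 [|i3 [|]]]]] //= _ U /and4P[h1 h2 h3 _].
by exists i0, i1, i2, i3; rewrite /= U.
Qed.

(** The square matrix with rows [f i] satisfies M M^T = 1, hence also M^T M = 1. *)
Lemma orthonormal_expansion (f : 'I_4 -> 'rV[R]_4) x :
  (forall i j, dotp (f i) (f j) = (i == j)%:R) ->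
  x = \sum_(k < 4) dotp x (f k) *: f k.
Proof.
move=> H; pose M : 'M[R]_4 := \matrix_(i, j) f i ord0 j.
have MM : M *m M^T = 1%:M.
  apply/matrixP => i j; rewrite !mxE -(H i j) /dotp.
  by apply: eq_bigr => k _; rewrite !mxE.
rewrite -[LHS]mulmx1 -(mulmx1C MM) mulmxA.
apply/rowP => j; rewrite mxE summxE; apply: eq_bigr => k _.
rewrite !mxE; congr (_ * _); apply: eq_bigr => l _; rewrite !mxE.
by rewrite (ord1 0).
Qed.

Definition vec_at (i0 i1 i2 i3 : 'I_4) (x0 x1 x2 x3 : R) : 'rV[R]_4 :=
  \row_j (if j == i0 then x0 else if j == i1 then x1 else
          if j == i2 then x2 else x3).

Lemma vec_atE (i0 i1 i2 i3 : 'I_4) (x0 x1 x2 x3 : R) :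
  uniq [:: i0; i1; i2; i3] ->
  let y := vec_at i0 i1 i2 i3 x0 x1 x2 x3 in
  [/\ y ord0 i0 = x0, y ord0 i1 = x1, y ord0 i2 = x2 & y ord0 i3 = x3].
Proof.
move=> U y; rewrite !mxE; move: U; rewrite /= !inE !negb_or -!andbA andbT.
case/and5P => h1 h2 h3 h4 /andP[h5 h6]; rewrite !eqxx.
rewrite !(eq_sym _ i0) (eq_sym i2 i1) (eq_sym i3 i1) (eq_sym i3 i2).
by rewrite (negbTE h1) (negbTE h2) (negbTE h3) (negbTE h4) (negbTE h5) (negbTE h6).
Qed.

Lemma dotpE (i0 i1 i2 i3 : 'I_4) x y : uniq [:: i0; i1; i2; i3] ->
  dotp x y = x ord0 i0 * y ord0 i0 + x ord0 i1 * y ord0 i1 +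
    x ord0 i2 * y ord0 i2 + x ord0 i3 * y ord0 i3.
Proof. by move=> U; rewrite /dotp (sum_uniq4 _ _ _ _ _ U). Qed.

Lemma dotpC n (x y : 'rV[R]_n) : dotp x y = dotp y x.
Proof. by apply: eq_bigr => j _; rewrite mulrC. Qed.

(* In the orthonormal frame (1,1,-1,-1)/2, (1,-1,1,-1)/2, (1,-1,-1,1)/2 of the
   hyperplane of zero sum, a has coordinates (p, q, r), and the two directions
   of the chart are (-q, p, 0) and (p, q, r) x (-q, p, 0), normalized. *)
Lemma section_chart_exists a t : directions a ->
  exists c, orthonormal_chart c /\
    [set x | simplex3 x /\ dotp a x = t] `<=` range (chart c).
Proof.
move=> [a2 a1]; have [i0 [i1 [i2 [i3 [U [h01 h12 h23]]]]]] := sorted_uniq4 a.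
rewrite /sphere3 /= (sum_uniq4 _ _ _ _ _ U) in a2; rewrite (sum_uniq4 _ _ _ _ _ U) in a1.
pose p := a ord0 i0 + a ord0 i1; pose q := a ord0 i0 + a ord0 i2.
pose r := a ord0 i0 + a ord0 i3.
have nrm : p ^+ 2 + q ^+ 2 + r ^+ 2 = 1.
  rewrite -a2 /p /q /r; have -> : a ord0 i3 = - (a ord0 i0 + a ord0 i1 + a ord0 i2) by lra.
  ring.
have [c0 c1 c2 c3] : [/\ a ord0 i0 = (p + q + r) / 2, a ord0 i1 = (p - q - r) / 2,
    a ord0 i2 = (q - p - r) / 2 & a ord0 i3 = (r - p - q) / 2].
  by rewrite /p /q /r; split; lra.
have pq0 : 0 < p ^+ 2 + q ^+ 2.
  rewrite lt0r addr_ge0 ?sqr_ge0// andbT paddr_eq0 ?sqr_ge0// !sqrf_eq0.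
  (* With p = q = 0 the entries are r/2, - r/2, - r/2, r/2, and the ordering forces r = 0, against
     the unit norm. *)
  apply/negP => /andP[/eqP p0 /eqP q0]; have r0 : r = 0.
    by move: h01 h12 h23; rewrite c0 c1 c2 c3 p0 q0; lra.
  by move: nrm; rewrite p0 q0 r0; lra.
pose N := Num.sqrt (p ^+ 2 + q ^+ 2).
have N0 : N != 0 by rewrite gt_eqF// sqrtr_gt0.
have N2 : N ^+ 2 = p ^+ 2 + q ^+ 2 by rewrite sqr_sqrtr// ltW.
pose h : 'rV[R]_4 := vec_at i0 i1 i2 i3 2^-1 2^-1 2^-1 2^-1.
pose e : 'rV[R]_4 := vec_at i0 i1 i2 i3 ((p - q) / (2 * N)) (- (p + q) / (2 * N))
  ((p + q) / (2 * N)) ((q - p) / (2 * N)).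
pose g : 'rV[R]_4 := vec_at i0 i1 i2 i3 ((N ^+ 2 - r * (p + q)) / (2 * N))
  ((r * (q - p) - N ^+ 2) / (2 * N)) ((r * (p - q) - N ^+ 2) / (2 * N))
  ((N ^+ 2 + r * (p + q)) / (2 * N)).
have [hE0 hE1 hE2 hE3] := @vec_atE i0 i1 i2 i3 2^-1 2^-1 2^-1 2^-1 U.
have [eE0 eE1 eE2 eE3] := @vec_atE i0 i1 i2 i3 ((p - q) / (2 * N)) (- (p + q) / (2 * N))
  ((p + q) / (2 * N)) ((q - p) / (2 * N)) U.
have [gE0 gE1 gE2 gE3] := @vec_atE i0 i1 i2 i3 ((N ^+ 2 - r * (p + q)) / (2 * N))
  ((r * (q - p) - N ^+ 2) / (2 * N)) ((r * (p - q) - N ^+ 2) / (2 * N))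
  ((N ^+ 2 + r * (p + q)) / (2 * N)) U.
rewrite -/h in hE0 hE1 hE2 hE3; rewrite -/e in eE0 eE1 eE2 eE3.
rewrite -/g in gE0 gE1 gE2 gE3.
have r2 : r ^+ 2 = 1 - N ^+ 2 by rewrite N2; lra.
have hh : dotp h h = 1 by rewrite (dotpE _ _ _ _ _ _ U) hE0 hE1 hE2 hE3; field.
have ha : dotp h a = 0.
  by rewrite (dotpE _ _ _ _ _ _ U) hE0 hE1 hE2 hE3 -!mulrDr a1 mulr0.
have aa : dotp a a = 1 by rewrite (dotpE _ _ _ _ _ _ U) -!expr2.
have he : dotp h e = 0.
  by rewrite (dotpE _ _ _ _ _ _ U) hE0 hE1 hE2 hE3 eE0 eE1 eE2 eE3; field.
have hg : dotp h g = 0.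
  by rewrite (dotpE _ _ _ _ _ _ U) hE0 hE1 hE2 hE3 gE0 gE1 gE2 gE3; field.
have ae : dotp a e = 0.
  by rewrite (dotpE _ _ _ _ _ _ U) c0 c1 c2 c3 eE0 eE1 eE2 eE3; field.
have ag : dotp a g = 0.
  rewrite (dotpE _ _ _ _ _ _ U) c0 c1 c2 c3 gE0 gE1 gE2 gE3.
  have -> : forall A B C D E F G H : R, A / 2 * (B / (2 * N)) + C / 2 * (D / (2 * N)) +
      E / 2 * (F / (2 * N)) + G / 2 * (H / (2 * N)) =
      (A * B + C * D + E * F + G * H) / (4 * N) by move=> *; field.
  by rewrite (_ : _ + _ = 0) ?mul0r// N2; ring.
have ee : dotp e e = 1.
  rewrite (dotpE _ _ _ _ _ _ U) eE0 eE1 eE2 eE3.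
  have -> : forall A B C D : R, A / (2 * N) * (A / (2 * N)) + B / (2 * N) * (B / (2 * N)) +
      C / (2 * N) * (C / (2 * N)) + D / (2 * N) * (D / (2 * N)) =
      (A ^+ 2 + B ^+ 2 + C ^+ 2 + D ^+ 2) / (4 * N ^+ 2) by move=> *; field.
  rewrite (_ : _ + _ = 4 * N ^+ 2) ?N2; last by ring.
  by rewrite divff// mulf_neq0// -N2 expf_neq0.
have gg : dotp g g = 1.
  rewrite (dotpE _ _ _ _ _ _ U) gE0 gE1 gE2 gE3.
  have -> : forall A B C D : R, A / (2 * N) * (A / (2 * N)) + B / (2 * N) * (B / (2 * N)) +
      C / (2 * N) * (C / (2 * N)) + D / (2 * N) * (D / (2 * N)) =
      (A ^+ 2 + B ^+ 2 + C ^+ 2 + D ^+ 2) / (4 * N ^+ 2) by move=> *; field.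
  rewrite [X in X / _](_ : _ = 4 * N ^+ 2); first by rewrite divff// mulf_neq0// expf_neq0.
  transitivity (4 * r ^+ 2 * (p ^+ 2 + q ^+ 2) + 4 * N ^+ 2 * N ^+ 2); first by ring.
  by rewrite r2 -N2; ring.
have eg : dotp e g = 0.
  by rewrite (dotpE _ _ _ _ _ _ U) gE0 gE1 gE2 gE3 eE0 eE1 eE2 eE3; field.
pose f (k : 'I_4) : 'rV[R]_4 := [:: h; a; e; g]`_k.
have fON i j : dotp (f i) (f j) = (i == j)%:R.
  case: i => -[|[|[|[|//]]]] ? ; case: j => -[|[|[|[|//]]]] ? ;
  by rewrite /f /= ?(dotpC _ a h) ?(dotpC _ e h) ?(dotpC _ g h) ?(dotpC _ e a) ?(dotpC _ g a) ?(dotpC _ g e) ?hh ?ha ?he ?hg ?aa ?ae ?ag ?ee ?eg ?gg.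
(* [h] and [a] are normal to the section: its points have coordinate 1/2 along [h], because their
   entries sum to 1, and t along [a]. *)
exists (2^-1 *: h + t *: a, e, g); split; first by split.
move=> x [[x0 x1] ax]; exists (dotp x e, dotp x g) => //.
rewrite [RHS](orthonormal_expansion _ _ fON) !big_ord_recl big_ord0 /f /= addr0.
rewrite /chart /= (dotpC _ x a) ax !addrA; do 3 congr (_ + _); congr (_ *: _).
by rewrite (dotpE _ _ _ _ _ _ U) hE0 hE1 hE2 hE3 -!mulrDl -(sum_uniq4 _ _ _ _ _ U) x1 mul1r.
Qed.

End charts.

(* Gram determinant of the map (x1, x2) |-> x parametrizing {1, a}^_|_. *)
Lemma orthonormal_minor (F : fieldType) (a0 a1 a2 a3 u0 u1 u2 u3 v0 v1 v2 v3 : F) :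
  a0 - a3 != 0 -> (4 : F) != 0 ->
  a0 + a1 + a2 + a3 = 0 -> a0 * a0 + a1 * a1 + a2 * a2 + a3 * a3 = 1 ->
  u0 + u1 + u2 + u3 = 0 -> a0 * u0 + a1 * u1 + a2 * u2 + a3 * u3 = 0 ->
  v0 + v1 + v2 + v3 = 0 -> a0 * v0 + a1 * v1 + a2 * v2 + a3 * v3 = 0 ->
  u0 * u0 + u1 * u1 + u2 * u2 + u3 * u3 = 1 ->
  v0 * v0 + v1 * v1 + v2 * v2 + v3 * v3 = 1 ->
  u0 * v0 + u1 * v1 + u2 * v2 + u3 * v3 = 0 ->
  4 * (u1 * v2 - v1 * u2) ^+ 2 = (a0 - a3) ^+ 2.
Proof.
move=> d0 four sa aa su au sv av uu vv uv.
pose d := a0 - a3.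
have solve0 (x0 x1 x2 x3 : F) : x0 + x1 + x2 + x3 = 0 ->
    a0 * x0 + a1 * x1 + a2 * x2 + a3 * x3 = 0 ->
    d * x0 = - (a1 - a3) * x1 - (a2 - a3) * x2.
  move=> sx ax; apply/eqP; rewrite -subr_eq0; apply/eqP.
  transitivity ((a0 * x0 + a1 * x1 + a2 * x2 + a3 * x3) - a3 * (x0 + x1 + x2 + x3)).
    by rewrite /d; ring.
  by rewrite sx ax; ring.
have solve3 (x0 x1 x2 x3 : F) : x0 + x1 + x2 + x3 = 0 ->
    a0 * x0 + a1 * x1 + a2 * x2 + a3 * x3 = 0 ->
    d * x3 = - (a0 - a1) * x1 - (a0 - a2) * x2.
  move=> sx ax; apply/eqP; rewrite -subr_eq0; apply/eqP.
  transitivity (a0 * (x0 + x1 + x2 + x3) - (a0 * x0 + a1 * x1 + a2 * x2 + a3 * x3)).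
    by rewrite /d; ring.
  by rewrite sx ax; ring.
pose g11 := d ^+ 2 + (a1 - a3) ^+ 2 + (a0 - a1) ^+ 2.
pose g22 := d ^+ 2 + (a2 - a3) ^+ 2 + (a0 - a2) ^+ 2.
pose g12 := (a1 - a3) * (a2 - a3) + (a0 - a1) * (a0 - a2).
have gram (x0 x1 x2 x3 y0 y1 y2 y3 : F) :
    d * x0 = - (a1 - a3) * x1 - (a2 - a3) * x2 ->
    d * x3 = - (a0 - a1) * x1 - (a0 - a2) * x2 ->
    d * y0 = - (a1 - a3) * y1 - (a2 - a3) * y2 ->
    d * y3 = - (a0 - a1) * y1 - (a0 - a2) * y2 ->
    d ^+ 2 * (x0 * y0 + x1 * y1 + x2 * y2 + x3 * y3) =
    g11 * x1 * y1 + g12 * (x1 * y2 + x2 * y1) + g22 * x2 * y2.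
  move=> Ex0 Ex3 Ey0 Ey3.
  transitivity ((d * x0) * (d * y0) + d ^+ 2 * (x1 * y1 + x2 * y2) + (d * x3) * (d * y3)).
    by ring.
  by rewrite Ex0 Ex3 Ey0 Ey3 /g11 /g12 /g22; ring.
have u_0 := solve0 _ _ _ _ su au; have u_3 := solve3 _ _ _ _ su au.
have v_0 := solve0 _ _ _ _ sv av; have v_3 := solve3 _ _ _ _ sv av.
have Guu := gram _ _ _ _ _ _ _ _ u_0 u_3 u_0 u_3.
have Gvv := gram _ _ _ _ _ _ _ _ v_0 v_3 v_0 v_3.
have Guv := gram _ _ _ _ _ _ _ _ u_0 u_3 v_0 v_3.
rewrite uu in Guu; rewrite vv in Gvv; rewrite uv in Guv.
have detg : g11 * g22 - g12 ^+ 2 = 4 * d ^+ 2.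
  transitivity (d ^+ 2 * (4 * (a0 * a0 + a1 * a1 + a2 * a2 + a3 * a3) -
     (a0 + a1 + a2 + a3) ^+ 2)); first by rewrite /g11 /g22 /g12 /d; ring.
  by rewrite aa sa; ring.
(* det (U^T G U) = det G (det U)^2, with G the form in [gram] and U the middle coordinates of u and
   v; by orthonormality U^T G U is d^2 times the identity. *)
have E : d ^+ 2 * (4 * (u1 * v2 - v1 * u2) ^+ 2) = d ^+ 2 * d ^+ 2.
  transitivity ((g11 * g22 - g12 ^+ 2) * (u1 * v2 - v1 * u2) ^+ 2).
    by rewrite detg; ring.
  transitivity ((g11 * u1 * u1 + g12 * (u1 * u2 + u2 * u1) + g22 * u2 * u2) *
    (g11 * v1 * v1 + g12 * (v1 * v2 + v2 * v1) + g22 * v2 * v2) -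
    (g11 * u1 * v1 + g12 * (u1 * v2 + u2 * v1) + g22 * u2 * v2) ^+ 2).
    by ring.
  by rewrite -Guu -Gvv -Guv; ring.
by apply: (mulfI _ E); rewrite expf_neq0.
Qed.

(** Cramer's rule at three non-collinear points. Applied to the coordinate sum and to the product
    with a, it makes both chart vectors orthogonal to (1,1,1,1) and to a. *)
Lemma affine_const (F : fieldType) (p u v k s0 r0 s1 r1 s2 r2 : F) :
  (s1 - s0) * (r2 - r0) - (s2 - s0) * (r1 - r0) != 0 ->
  p + s0 * u + r0 * v = k -> p + s1 * u + r1 * v = k ->
  p + s2 * u + r2 * v = k -> [/\ u = 0, v = 0 & p = k].
Proof.
set d := (X in X != 0) => d0 E0 E1 E2.
have u0 : u = 0.
  apply: (mulfI d0); rewrite mulr0 /d.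
  transitivity ((r2 - r0) * ((p + s1 * u + r1 * v) - (p + s0 * u + r0 * v)) -
    (r1 - r0) * ((p + s2 * u + r2 * v) - (p + s0 * u + r0 * v))); first by ring.
  by rewrite E0 E1 E2; ring.
have v0 : v = 0.
  apply: (mulfI d0); rewrite mulr0 /d.
  transitivity ((s1 - s0) * ((p + s2 * u + r2 * v) - (p + s0 * u + r0 * v)) -
    (s2 - s0) * ((p + s1 * u + r1 * v) - (p + s0 * u + r0 * v))); first by ring.
  by rewrite E0 E1 E2; ring.
by split=> //; rewrite -E0 u0 v0; ring.
Qed.

(** * Projection of a section to its middle coordinates *)

Section section_area.
Variable R : realType.
Local Notation T := (measurableTypeR R).

Lemma chartE (c : 'rV[R]_4 * 'rV[R]_4 * 'rV[R]_4) z (j : 'I_4) :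
  chart c z ord0 j = c.1.1 ord0 j + z.1 * c.1.2 ord0 j + z.2 * c.2 ord0 j.
Proof. by rewrite /chart !mxE. Qed.

(** [section_chart_exists] makes the set given to [xget] nonempty, so the chosen chart has the
    defining properties, and nothing more is known about it. *)
Lemma section_area_chart (a : 'rV[R]_4) t : directions a ->
  exists c : 'rV[R]_4 * 'rV[R]_4 * 'rV[R]_4, [/\ orthonormal_chart c,
    [set x | simplex3 x /\ dotp a x = t] `<=` range (chart c) &
    section_area a t =
      lebesgue_measure2 (chart c @^-1` [set x | simplex3 x /\ dotp a x = t])].
Proof.
move=> da; rewrite /section_area /vol2.
set S := [set x | _ /\ dotp a x = t].
set P := [set c | _ /\ S `<=` _]; have [c0 Pc0] : exists c, P c.
  by have [c cP] := section_chart_exists _ a t da; exists c.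
by have := @xgetPex _ (0, 0, 0) P (ex_intro _ c0 Pc0) => -[? ?]; exists (xget (0, 0, 0) P).
Qed.

Definition corner_region (a b c a' b' c' : R) : set (T * T) :=
  [set z | [/\ 0 <= z.1, 0 <= z.2, a * z.1 + b * z.2 <= c & a' * z.1 + b' * z.2 <= c']].

(* The projection x |-> (x_i1, x_i2) maps the section onto a corner region and, by
   orthonormal_minor, multiplies areas by |a_i0 - a_i3| / 2 whatever the chart.
   The bounds on eps put (0, 0), (eps, 0) and (0, eps) into that region, so that
   every chart containing the section is orthogonal to a and to (1,1,1,1). *)
Lemma section_area_project (a : 'rV[R]_4) t (i0 i1 i2 i3 : 'I_4) (eps : R) :
  directions a -> uniq [:: i0; i1; i2; i3] -> a ord0 i3 < a ord0 i0 -> 0 < eps ->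
  a ord0 i3 <= t <= a ord0 i0 ->
  eps * (a ord0 i1 - a ord0 i3) <= t - a ord0 i3 ->
  eps * (a ord0 i2 - a ord0 i3) <= t - a ord0 i3 ->
  eps * (a ord0 i0 - a ord0 i1) <= a ord0 i0 - t ->
  eps * (a ord0 i0 - a ord0 i2) <= a ord0 i0 - t ->
  section_area a t = ((2 / (a ord0 i0 - a ord0 i3))%:E *
   lebesgue_measure2 (corner_region
    (a ord0 i1 - a ord0 i3) (a ord0 i2 - a ord0 i3) (t - a ord0 i3)
    (a ord0 i0 - a ord0 i1) (a ord0 i0 - a ord0 i2) (a ord0 i0 - t)))%E.
Proof.
move=> da U a30 eps0 /andP[ta3 ta0] e1 e2 e3 e4.
have [c [[uu vv uv] Sc ->]] := section_area_chart a t da.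
move: da => [aa sa]; rewrite /sphere3/= in aa.
rewrite (sum_uniq4 _ _ _ _ _ _ U) in aa; rewrite (sum_uniq4 _ _ _ _ _ _ U) in sa.
set S := [set x | _] in Sc *.
rewrite (dotpE _ _ _ _ _ _ _ U) in uu; rewrite (dotpE _ _ _ _ _ _ _ U) in vv.
rewrite (dotpE _ _ _ _ _ _ _ U) in uv.
have SE x : S x <-> [/\ 0 <= x ord0 i0, 0 <= x ord0 i1, 0 <= x ord0 i2 & 0 <= x ord0 i3] /\
    (x ord0 i0 + x ord0 i1 + x ord0 i2 + x ord0 i3 = 1 /\
    a ord0 i0 * x ord0 i0 + a ord0 i1 * x ord0 i1 + a ord0 i2 * x ord0 i2 +
      a ord0 i3 * x ord0 i3 = t).
  rewrite /S /simplex3 /= (sum_uniq4 _ _ _ _ _ _ U) (dotpE _ _ _ _ _ _ _ U).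
  by rewrite (forall_uniq4 _ _ _ _ (fun j => 0 <= x ord0 j) U); tauto.
set a0 := a ord0 i0 in a30 ta0 aa sa e1 e2 e3 e4 SE *.
set a1 := a ord0 i1 in a30 aa sa e1 e2 e3 e4 SE *.
set a2 := a ord0 i2 in a30 aa sa e1 e2 e3 e4 SE *.
set a3 := a ord0 i3 in a30 ta3 aa sa e1 e2 e3 e4 SE *.
have d0 : 0 < a0 - a3 by rewrite subr_gt0.
have d0' : a0 - a3 != 0 by rewrite gt_eqF.
(* The inverse of the projection: the outer two coordinates are solved from the sum 1 and the
   product t with a. *)
pose X (y1 y2 : R) : 'rV[R]_4 := vec_at R i0 i1 i2 i3
  ((t - a3 - (a1 - a3) * y1 - (a2 - a3) * y2) / (a0 - a3)) y1 y2
  ((a0 - t - (a0 - a1) * y1 - (a0 - a2) * y2) / (a0 - a3)).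
have XS y1 y2 : 0 <= y1 -> 0 <= y2 -> (a1 - a3) * y1 + (a2 - a3) * y2 <= t - a3 ->
    (a0 - a1) * y1 + (a0 - a2) * y2 <= a0 - t -> S (X y1 y2).
  move=> y10 y20 h1 h2; apply/SE.
  have [-> -> -> ->] := vec_atE _ _ _ _ _ ((t - a3 - (a1 - a3) * y1 - (a2 - a3) * y2) / (a0 - a3)) y1 y2
    ((a0 - t - (a0 - a1) * y1 - (a0 - a2) * y2) / (a0 - a3)) U.
  split; last by split; field.
  by split=> //; rewrite pmulr_lge0 ?invr_gt0//; lra.
have XE y1 y2 : X y1 y2 ord0 i1 = y1 /\ X y1 y2 ord0 i2 = y2.
  by have [_ -> -> _] := vec_atE _ _ _ _ _ ((t - a3 - (a1 - a3) * y1 - (a2 - a3) * y2) / (a0 - a3)) y1 y2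
    ((a0 - t - (a0 - a1) * y1 - (a0 - a2) * y2) / (a0 - a3)) U.
have hX y1 y2 : S (X y1 y2) -> exists z : R * R, [/\
    c.1.1 ord0 i1 + z.1 * c.1.2 ord0 i1 + z.2 * c.2 ord0 i1 = y1,
    c.1.1 ord0 i2 + z.1 * c.1.2 ord0 i2 + z.2 * c.2 ord0 i2 = y2 &
    S (chart c z)].
  move=> SX; have [z _ zE] := Sc _ SX; exists z.
  have [E1 E2] := XE y1 y2.
  by rewrite -!chartE zE.
have [z0 [Z01 Z02 /SE [_ []]]] : exists z : R * R, [/\
    c.1.1 ord0 i1 + z.1 * c.1.2 ord0 i1 + z.2 * c.2 ord0 i1 = 0,
    c.1.1 ord0 i2 + z.1 * c.1.2 ord0 i2 + z.2 * c.2 ord0 i2 = 0 &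
    S (chart c z)] by apply/hX/XS; lra.
have [z1 [Z11 Z12 /SE [_ []]]] : exists z : R * R, [/\
    c.1.1 ord0 i1 + z.1 * c.1.2 ord0 i1 + z.2 * c.2 ord0 i1 = eps,
    c.1.1 ord0 i2 + z.1 * c.1.2 ord0 i2 + z.2 * c.2 ord0 i2 = 0 &
    S (chart c z)] by apply/hX/XS; lra.
have [z2 [Z21 Z22 /SE [_ []]]] : exists z : R * R, [/\
    c.1.1 ord0 i1 + z.1 * c.1.2 ord0 i1 + z.2 * c.2 ord0 i1 = 0,
    c.1.1 ord0 i2 + z.1 * c.1.2 ord0 i2 + z.2 * c.2 ord0 i2 = eps &
    S (chart c z)] by apply/hX/XS; lra.
rewrite !chartE.
set p0 := c.1.1 ord0 i0 in Z01 Z02 Z11 Z12 Z21 Z22 *.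
set p1 := c.1.1 ord0 i1 in Z01 Z02 Z11 Z12 Z21 Z22 *.
set p2 := c.1.1 ord0 i2 in Z01 Z02 Z11 Z12 Z21 Z22 *.
set p3 := c.1.1 ord0 i3 in Z01 Z02 Z11 Z12 Z21 Z22 *.
set u0 := c.1.2 ord0 i0 in Z01 Z02 Z11 Z12 Z21 Z22 uu uv *.
set u1 := c.1.2 ord0 i1 in Z01 Z02 Z11 Z12 Z21 Z22 uu uv *.
set u2 := c.1.2 ord0 i2 in Z01 Z02 Z11 Z12 Z21 Z22 uu uv *.
set u3 := c.1.2 ord0 i3 in Z01 Z02 Z11 Z12 Z21 Z22 uu uv *.
set v0 := c.2 ord0 i0 in Z01 Z02 Z11 Z12 Z21 Z22 vv uv *.
set v1 := c.2 ord0 i1 in Z01 Z02 Z11 Z12 Z21 Z22 vv uv *.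
set v2 := c.2 ord0 i2 in Z01 Z02 Z11 Z12 Z21 Z22 vv uv *.
set v3 := c.2 ord0 i3 in Z01 Z02 Z11 Z12 Z21 Z22 vv uv *.
move=> s2 A2 s1 A1 s0 A0.
(* The three chart points project to (0, 0), (eps, 0), (0, eps), so they are not collinear. *)
have detz : (z1.1 - z0.1) * (z2.2 - z0.2) - (z2.1 - z0.1) * (z1.2 - z0.2) != 0.
  apply/eqP => detz; have : eps ^+ 2 = 0.
    transitivity (((p1 + z1.1 * u1 + z1.2 * v1) - (p1 + z0.1 * u1 + z0.2 * v1)) *
        ((p2 + z2.1 * u2 + z2.2 * v2) - (p2 + z0.1 * u2 + z0.2 * v2)) -
        ((p2 + z1.1 * u2 + z1.2 * v2) - (p2 + z0.1 * u2 + z0.2 * v2)) *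
        ((p1 + z2.1 * u1 + z2.2 * v1) - (p1 + z0.1 * u1 + z0.2 * v1))).
      by rewrite Z01 Z02 Z11 Z12 Z21 Z22; ring.
    transitivity ((u1 * v2 - u2 * v1) *
      ((z1.1 - z0.1) * (z2.2 - z0.2) - (z2.1 - z0.1) * (z1.2 - z0.2))); first by ring.
    by rewrite detz mulr0.
  by apply/eqP; rewrite expf_neq0// gt_eqF.
have [su sv sp] : [/\ u0 + u1 + u2 + u3 = 0, v0 + v1 + v2 + v3 = 0 &
    p0 + p1 + p2 + p3 = 1].
  apply: (affine_const _ _ _ _ _ _ _ _ _ _ _ detz).
  - by rewrite -[RHS]s0; ring.
  - by rewrite -[RHS]s1; ring.
  - by rewrite -[RHS]s2; ring.
have [au av ap] : [/\ a0 * u0 + a1 * u1 + a2 * u2 + a3 * u3 = 0,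
    a0 * v0 + a1 * v1 + a2 * v2 + a3 * v3 = 0 &
    a0 * p0 + a1 * p1 + a2 * p2 + a3 * p3 = t].
  apply: (affine_const _ _ _ _ _ _ _ _ _ _ _ detz).
  - by rewrite -[RHS]A0; ring.
  - by rewrite -[RHS]A1; ring.
  - by rewrite -[RHS]A2; ring.
have aa' : a0 * a0 + a1 * a1 + a2 * a2 + a3 * a3 = 1 by rewrite -!expr2.
have four : (4 : R) != 0 by rewrite pnatr_eq0.
have := orthonormal_minor _ _ _ _ _ _ _ _ _ _ _ _ _ d0' four sa aa' su au sv av uu vv uv.
set m := u1 * v2 - v1 * u2 => Em.
have m2 : (2 * `|m|) = a0 - a3.
  apply/eqP; rewrite -(@eqrXn2 _ 2)// ?mulr_ge0// ?(ltW d0)//.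
  by rewrite exprMn real_normK ?num_real// -Em; apply/eqP; ring.
have m0 : m != 0 by apply/eqP => m0; move: m2; rewrite m0 normr0; lra.
have -> : (2 / (a0 - a3)) = `|m|^-1.
  by rewrite -m2; field; rewrite normr_eq0 m0.
have mD := @measurable_quadrant R (a1 - a3) (a2 - a3) (t - a3) (a0 - a1) (a0 - a2) (a0 - t).
have := @lebesgue_measure2_affine R u1 v1 p1 u2 v2 p2 _ m0 mD.
rewrite -/(corner_region _ _ _ _ _ _) => <-.
congr lebesgue_measure2; apply/seteqP.
clear -SE su sv sp au av ap d0.
split => z; [move=> /SE|move=> Dz; apply/SE; move: Dz];
  rewrite ?chartE -/p0 -/p1 -/p2 -/p3 -/u0 -/u1 -/u2 -/u3 -/v0 -/v1 -/v2 -/v3.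
  move=> [[x0 x1 x2 x3] [sx ax]]; rewrite /corner_region /=.
  have -> : u1 * z.1 + v1 * z.2 + p1 = p1 + z.1 * u1 + z.2 * v1 by ring.
  have -> : u2 * z.1 + v2 * z.2 + p2 = p2 + z.1 * u2 + z.2 * v2 by ring.
  move: x0 x1 x2 x3 sx ax.
  move: (p0 + _ + _) (p1 + _ + _) (p2 + _ + _) (p3 + _ + _) => y0 y1 y2 y3.
  move=> x0 x1 x2 x3 sx ax; have -> : t = a0 * y0 + a1 * y1 + a2 * y2 + a3 * y3 by [].
  clear -sx x0 x1 x2 x3 d0.
  have -> : y3 = 1 - y0 - y1 - y2 by lra.
  split=> //.
  - have : 0 <= (a0 - a3) * y0 by rewrite mulr_ge0// ltW.
    lra.
  - have : 0 <= (a0 - a3) * y3 by rewrite mulr_ge0// ltW.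
    have -> : y3 = 1 - y0 - y1 - y2 by lra.
    lra.
rewrite /corner_region /=.
have -> : u1 * z.1 + v1 * z.2 + p1 = p1 + z.1 * u1 + z.2 * v1 by ring.
have -> : u2 * z.1 + v2 * z.2 + p2 = p2 + z.1 * u2 + z.2 * v2 by ring.
have sx : p0 + z.1 * u0 + z.2 * v0 + (p1 + z.1 * u1 + z.2 * v1) +
  (p2 + z.1 * u2 + z.2 * v2) + (p3 + z.1 * u3 + z.2 * v3) = 1.
  transitivity ((p0 + p1 + p2 + p3) + z.1 * (u0 + u1 + u2 + u3) +
    z.2 * (v0 + v1 + v2 + v3)); first by ring.
  by rewrite su sv sp; ring.
have ax : a0 * (p0 + z.1 * u0 + z.2 * v0) + a1 * (p1 + z.1 * u1 + z.2 * v1) +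
  a2 * (p2 + z.1 * u2 + z.2 * v2) + a3 * (p3 + z.1 * u3 + z.2 * v3) = t.
  transitivity ((a0 * p0 + a1 * p1 + a2 * p2 + a3 * p3) +
    z.1 * (a0 * u0 + a1 * u1 + a2 * u2 + a3 * u3) +
    z.2 * (a0 * v0 + a1 * v1 + a2 * v2 + a3 * v3)); first by ring.
  by rewrite au av ap; ring.
move: sx ax.
move: (p0 + _ + _) (p1 + _ + _) (p2 + _ + _) (p3 + _ + _) => y0 y1 y2 y3 sx ax.
rewrite -{1 2}ax; clear -sx ax d0 => -[x1 x2 h0 h3]; split=> //.
split=> //.
- rewrite -(pmulr_rge0 _ d0); move: h0.
  have -> : y3 = 1 - y0 - y1 - y2 by lra.
  lra.
- rewrite -(pmulr_rge0 _ d0); move: h3.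
  have -> : y0 = 1 - y3 - y1 - y2 by lra.
  lra.
Qed.

End section_area.

(** * Closed formulas for the section area *)

Section area_formulas.
Variable R : realType.
Local Notation T := (measurableTypeR R).
Implicit Types (a : 'rV[R]_4) (t : R).

Lemma measurable_section_chart a t (c : 'rV[R]_4 * 'rV[R]_4 * 'rV[R]_4) :
  measurable (chart c @^-1` [set x | simplex3 x /\ dotp a x = t] : set (T * T)).
Proof.
have -> : chart c @^-1` [set x | simplex3 x /\ dotp a x = t] =
  (\bigcap_(j in [set: 'I_4]) [set z : T * T |
      0 <= c.1.2 ord0 j * z.1 + c.2 ord0 j * z.2 + c.1.1 ord0 j]) `&`
  ([set z : T * T | (\sum_j c.1.2 ord0 j) * z.1 + (\sum_j c.2 ord0 j) * z.2 =
     1 - \sum_j c.1.1 ord0 j] `&`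
   [set z : T * T | dotp a c.1.2 * z.1 + dotp a c.2 * z.2 = t - dotp a c.1.1]).
  have sE z : \sum_j chart c z ord0 j = (\sum_j c.1.2 ord0 j) * z.1 +
      (\sum_j c.2 ord0 j) * z.2 + \sum_j c.1.1 ord0 j.
    rewrite !mulr_suml -!big_split /=; apply: eq_bigr => j _.
    by rewrite chartE; ring.
  have dE z : dotp a (chart c z) = dotp a c.1.2 * z.1 +
      dotp a c.2 * z.2 + dotp a c.1.1.
    rewrite /dotp !mulr_suml -!big_split /=; apply: eq_bigr => j _.
    by rewrite chartE; ring.
  apply/seteqP; split => z /=.
    move=> [[x0 x1] ax]; split; last first.
      by split; [rewrite -x1 sE addrK|rewrite -ax dE addrK].
    by move=> j _; have := x0 j; rewrite /= chartE; congr (_ <= _); ring.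
  move=> [x0 [x1 ax]]; split; last by rewrite dE ax subrK.
  split; last by rewrite sE x1 subrK.
  by move=> j; have := x0 j I; rewrite /= chartE; congr (_ <= _); ring.
apply: measurableI; last by apply: measurableI; exact: measurable_line.
apply: fin_bigcap_measurable; first exact: finite_finset.
by move=> j _; exact: measurable_halfplane.
Qed.

(** The section lies on an edge, so a chart sees it inside a line: one of the equations x_i2 = 0,
    x_i3 = 0, x_i0 + x_i1 = 1 is not constant in the chart. *)
Lemma section_area_degenerate a t (i0 i1 i2 i3 : 'I_4) :
  directions a -> uniq [:: i0; i1; i2; i3] ->
  (forall x, simplex3 x -> dotp a x = t -> x ord0 i2 = 0 /\ x ord0 i3 = 0) ->
  section_area a t = 0%E.
Proof.
move=> da U H; have [c [[uu vv uv] _ ->]] := section_area_chart _ _ t da.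
have mS := measurable_section_chart a t c.
rewrite (dotpE _ _ _ _ _ _ _ U) in uu; rewrite (dotpE _ _ _ _ _ _ _ U) in vv.
rewrite (dotpE _ _ _ _ _ _ _ U) in uv.
have sub al be ga : (al != 0) || (be != 0) ->
    (forall z, simplex3 (chart c z) -> dotp a (chart c z) = t ->
       al * z.1 + be * z.2 = ga) ->
    lebesgue_measure2 (chart c @^-1` [set x | simplex3 x /\ dotp a x = t]) = 0%E.
  move=> ab L; have L0 := @lebesgue_measure2_line R al be ga ab.
  have SL : (chart c @^-1` [set x | simplex3 x /\ dotp a x = t] : set (T * T)) `<=`
      [set z : T * T | al * z.1 + be * z.2 = ga].
    by move=> z /= [sz dz]; exact: L.
  exact: (@lebesgue_measure2_subset0 R _ _ mS (measurable_line _ al be ga) SL L0).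
have [h2|h2] := boolP ((c.1.2 ord0 i2 != 0) || (c.2 ord0 i2 != 0)).
  apply: (sub _ _ (- c.1.1 ord0 i2) h2) => z sz dz; have [] := H _ sz dz.
  by rewrite chartE => + _ => E; apply/eqP; rewrite -subr_eq0 -E; apply/eqP; ring.
have [h3|h3] := boolP ((c.1.2 ord0 i3 != 0) || (c.2 ord0 i3 != 0)).
  apply: (sub _ _ (- c.1.1 ord0 i3) h3) => z sz dz; have [] := H _ sz dz.
  by move=> _; rewrite chartE => E; apply/eqP; rewrite -subr_eq0 -E; apply/eqP; ring.
move: h2 h3; rewrite !negb_or !negbK => /andP[/eqP u2 /eqP v2] /andP[/eqP u3 /eqP v3].
(* If this equation were constant too, both chart vectors would be multiples of (1, - 1) in the
   coordinates i0, i1, against orthonormality. *)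
apply: (sub (c.1.2 ord0 i0 + c.1.2 ord0 i1) (c.2 ord0 i0 + c.2 ord0 i1)
  (1 - c.1.1 ord0 i0 - c.1.1 ord0 i1)).
  move: uu vv uv; rewrite u2 u3 v2 v3.
  move: (c.1.2 ord0 i0) (c.1.2 ord0 i1) (c.2 ord0 i0) (c.2 ord0 i1) => u0 u1 v0 v1.
  clear; move=> uu vv uv; rewrite -negb_and; apply/negP => /andP[/eqP hu /eqP hv].
  have E1 : u1 = - u0 by lra.
  have E2 : v1 = - v0 by lra.
  move: uu vv uv; rewrite E1 E2 !mulr0 !addr0 => uu vv uv.
  have : (2 * (u0 * v0)) * (2 * (u0 * v0)) = 1.
    transitivity ((u0 * u0 + - u0 * - u0) * (v0 * v0 + - v0 * - v0)); first by ring.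
    by rewrite uu vv mulr1.
  have -> : 2 * (u0 * v0) = 0 by rewrite -[RHS]uv; ring.
  by rewrite mulr0 => /eqP; rewrite eq_sym oner_eq0.
move=> z sz dz; have [x2 x3] := H _ sz dz; move: sz => [_].
rewrite (sum_uniq4 _ _ _ _ _ _ U) x2 x3 !chartE => E.
by rewrite -E; ring.
Qed.

Definition sorted_values a (a0 a1 a2 a3 : R) : Prop :=
  [/\ a1 <= a0, a2 <= a1, a3 <= a2 & exists i0 i1 i2 i3 : 'I_4,
    uniq [:: i0; i1; i2; i3] /\
    [/\ a ord0 i0 = a0, a ord0 i1 = a1, a ord0 i2 = a2 & a ord0 i3 = a3]].

(** At or above the largest entry the section lies in the face where that entry is attained. The
    last hypothesis excludes t = a0 = a1 = a2, where this face is a facet of positive area. *)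
Lemma section_area_beyond a t (a0 a1 a2 a3 : R) :
  directions a -> sorted_values a a0 a1 a2 a3 ->
  a0 <= t -> a2 < a0 \/ a0 < t -> section_area a t = 0%E.
Proof.
move=> da [h01 h12 h23 [i0 [i1 [i2 [i3 [U [E0 E1 E2 E3]]]]]]] at0 h.
apply: (@section_area_degenerate a t i0 i1 i2 i3 da U) => x [x0 sx] dx.
rewrite (dotpE _ _ _ _ _ _ _ U) E0 E1 E2 E3 in dx; rewrite (sum_uniq4 _ _ _ _ _ _ U) in sx.
have := x0 i0; have := x0 i1; have := x0 i2; have := x0 i3.
move: (x ord0 i0) (x ord0 i1) (x ord0 i2) (x ord0 i3) dx sx => x_0 x1 x2 x3 dx sx.
move=> p3 p2 p1 p0.
have E : (a0 - a1) * x1 + (a0 - a2) * x2 + (a0 - a3) * x3 = a0 - t.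
  transitivity (a0 * (x_0 + x1 + x2 + x3) - (a0 * x_0 + a1 * x1 + a2 * x2 + a3 * x3)).
    by ring.
  by rewrite dx sx mulr1.
have q1 : 0 <= (a0 - a1) * x1 by rewrite mulr_ge0// subr_ge0.
have q2 : 0 <= (a0 - a2) * x2 by rewrite mulr_ge0// subr_ge0 (le_trans h12).
have q3 : 0 <= (a0 - a3) * x3 by rewrite mulr_ge0// subr_ge0 (le_trans h23)// (le_trans h12).
case: h => h; last by exfalso; lra.
have /eqP : (a0 - a2) * x2 = 0 by lra.
have /eqP : (a0 - a3) * x3 = 0 by lra.
rewrite !mulf_eq0 ![_ - _ == 0]gt_eqF ?subr_gt0//= ?(le_lt_trans h23 h)//.
by move=> /eqP -> /eqP ->.
Qed.

Lemma section_area_corner a t (a0 a1 a2 a3 : R) :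
  directions a -> sorted_values a a0 a1 a2 a3 ->
  a3 < t -> t < a0 \/ t = a0 /\ a2 = a0 ->
  section_area a t = ((2 / (a0 - a3))%:E * lebesgue_measure2
    (corner_region _ (a1 - a3)%R (a2 - a3)%R (t - a3)%R
      (a0 - a1)%R (a0 - a2)%R (a0 - t)%R))%E.
Proof.
move=> da [h01 h12 h23 [i0 [i1 [i2 [i3 [U [E0 E1 E2 E3]]]]]]] h3 h0.
have d0 : 0 < a0 - a3 by case: h0 => [?|[? ?]]; lra.
case: h0 => [h0|[h0 h2]]; last first.
  by subst a0 a1 a2 a3; apply: (@section_area_project _ a t i0 i1 i2 i3 1) => //; lra.
(* Every gap between entries is at most a0 - a3, so this eps meets the four bounds of
   [section_area_project]. *)
pose g := Num.min ((t - a3) / (a0 - a3)) ((a0 - t) / (a0 - a3)).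
have g0 : 0 < g by rewrite lt_min !divr_gt0//; lra.
have g1 : g * (a0 - a3) <= t - a3 by rewrite -ler_pdivlMr// ge_min lexx.
have g2 : g * (a0 - a3) <= a0 - t by rewrite -ler_pdivlMr// ge_min lexx orbT.
subst a0 a1 a2 a3; apply: (@section_area_project _ a t i0 i1 i2 i3 g) => //; first lra.
- lra.
- by apply: le_trans g1; rewrite ler_pM2l//; lra.
- by apply: le_trans g1; rewrite ler_pM2l//; lra.
- by apply: le_trans g2; rewrite ler_pM2l//; lra.
- by apply: le_trans g2; rewrite ler_pM2l//; lra.
Qed.

Lemma section_area_top a t (a0 a1 a2 a3 : R) :
  directions a -> sorted_values a a0 a1 a2 a3 ->
  a3 < t -> a1 <= t -> t < a0 ->
  section_area a t = ((a0 - t) ^+ 2 / ((a0 - a1) * (a0 - a2) * (a0 - a3)))%:E.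
Proof.
move=> da sa; have [h01 h12 h23 _] := sa; move=> h3 h1 h0; rewrite (section_area_corner _ _ _ _ _ _ da sa)//; last by left.
have -> : corner_region _ (a1 - a3) (a2 - a3) (t - a3) (a0 - a1) (a0 - a2) (a0 - t) =
    [set z : T * T | [/\ 0 <= z.1, 0 <= z.2 & (a0 - a1) * z.1 + (a0 - a2) * z.2 <= a0 - t]].
  apply/seteqP; split => z; rewrite /corner_region /=; first by case.
  (* Both middle entries are at most t, so the kept constraint gives z_1 + z_2 <= 1, which implies
     the dropped one. *)
  move=> [z1 z2 h]; split => //; have : (z.1 + z.2) * (a0 - t) <= a0 - t.
    apply: le_trans h; rewrite mulrDl; apply: lerD; rewrite mulrC ler_wpM2r//; lra.
  rewrite ger_pMl ?subr_gt0// => z12.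
  have : (a1 - a3) * z.1 <= (t - a3) * z.1 by rewrite ler_wpM2r//; lra.
  have : (a2 - a3) * z.2 <= (t - a3) * z.2 by rewrite ler_wpM2r//; lra.
  have : (t - a3) * (z.1 + z.2) <= t - a3 by rewrite ger_pMr ?subr_gt0.
  lra.
rewrite area_corner_triangle; [|lra|lra|lra].
by rewrite -EFinM; congr (_%:E); field; do ?[apply/andP; split]; rewrite ?subr_eq0 ?gt_eqF//; lra.
Qed.

Lemma section_area_bottom a t (a0 a1 a2 a3 : R) :
  directions a -> sorted_values a a0 a1 a2 a3 ->
  a3 < t -> t <= a2 ->
  section_area a t = ((t - a3) ^+ 2 / ((a0 - a3) * (a1 - a3) * (a2 - a3)))%:E.
Proof.
move=> da sa; have [h01 h12 h23 _] := sa; move=> h3 h2.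
have h0 : t < a0 \/ t = a0 /\ a2 = a0.
  by have [?|?] := ltP t a0; [left|right; split; lra].
rewrite (section_area_corner _ _ _ _ _ _ da sa)//.
have -> : corner_region _ (a1 - a3) (a2 - a3) (t - a3) (a0 - a1) (a0 - a2) (a0 - t) =
    [set z : T * T | [/\ 0 <= z.1, 0 <= z.2 & (a1 - a3) * z.1 + (a2 - a3) * z.2 <= t - a3]].
  apply/seteqP; split => z; rewrite /corner_region /=; first by case.
  move=> [z1 z2 h]; split => //; have : (z.1 + z.2) * (t - a3) <= t - a3.
    apply: le_trans h; rewrite mulrDl; apply: lerD; rewrite mulrC ler_wpM2r//; lra.
  rewrite ger_pMl ?subr_gt0// => z12.
  have : (a0 - a1) * z.1 <= (a0 - t) * z.1 by rewrite ler_wpM2r//; lra.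
  have : (a0 - a2) * z.2 <= (a0 - t) * z.2 by rewrite ler_wpM2r//; lra.
  have : (a0 - t) * (z.1 + z.2) <= a0 - t by rewrite ler_piMr// subr_ge0; lra.
  lra.
rewrite area_corner_triangle; [|lra|lra|lra].
by rewrite -EFinM; congr (_%:E); field; do ?[apply/andP; split]; rewrite ?subr_eq0 ?gt_eqF//; lra.
Qed.

Lemma section_area_middle a t (a0 a1 a2 a3 : R) :
  directions a -> sorted_values a a0 a1 a2 a3 ->
  a2 < t -> t < a1 ->
  section_area a t = (((t - a3) * (a1 - t) / (a1 - a3) + (a0 - t) * (t - a2) / (a0 - a2)) /
     ((a1 - a2) * (a0 - a3)))%:E.
Proof.
move=> da sa; have [h01 h12 h23 _] := sa; move=> h2 h1; rewrite (section_area_corner _ _ _ _ _ _ da sa)//; [|lra|by left; lra].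
(* The corner has coordinate sum 1: it is the vertex of the section on the edge joining the two
   middle vertices of the tetrahedron. *)
rewrite /corner_region (@area_corner_quad _ _ _ _ _ _ _ ((t - a2) / (a1 - a2)) ((a1 - t) / (a1 - a2))).
- by rewrite -EFinM; congr (_%:E); field; do ?[apply/andP; split]; rewrite ?subr_eq0 ?gt_eqF//; lra.
- lra.
- lra.
- lra.
- lra.
- by rewrite divr_gt0//; lra.
- by rewrite divr_gt0//; lra.
- have : 0 <= (a0 - a3) * (a1 - a2) by rewrite mulr_ge0//; lra.
  lra.
- by field; rewrite subr_eq0 gt_eqF//; lra.
- by field; rewrite subr_eq0 gt_eqF//; lra.
Qed.

End area_formulas.

(** * Inequalities for the area formulas *)

Section triangular_sections.
Variable R : realFieldType.
Implicit Types x y z w t p q r c : R.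

Lemma ler_sqr_nneg x y : 0 <= x -> 0 <= y -> (x ^+ 2 <= y ^+ 2) = (x <= y).
Proof. by move=> *; rewrite ler_pXn2r ?nnegrE. Qed.

Lemma ltr_sqr_nneg x y : 0 <= x -> 0 <= y -> (x ^+ 2 < y ^+ 2) = (x < y).
Proof. by move=> *; rewrite ltr_pXn2r ?nnegrE. Qed.

(* The sorted entries of a direction. *)
Definition direction4 x y z w : Prop :=
  [/\ y <= x, z <= y, w <= z, x + y + z + w = 0 & x ^+ 2 + y ^+ 2 + z ^+ 2 + w ^+ 2 = 1].

Lemma direction4_opp x y z w : direction4 x y z w -> direction4 (- w) (- z) (- y) (- x).
Proof. by case=> *; split; rewrite ?lerN2// ?sqrrN; lra. Qed.

(* (x - z)(x - w) = topM x y for the entries of a direction. *)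
Definition topM x t : R := 3 * x ^+ 2 + 2 * x * t + t ^+ 2 - 2^-1.

Lemma direction4_topM x y z w : direction4 x y z w -> (x - z) * (x - w) = topM x y.
Proof.
move=> [_ _ _ s n]; have w0 : w = - x - y - z by lra.
have -> : topM x y = 3 * x ^+ 2 + 2 * x * y + y ^+ 2 -
  (x ^+ 2 + y ^+ 2 + z ^+ 2 + w ^+ 2) / 2 by rewrite n /topM; lra.
by rewrite w0; field.
Qed.

Lemma direction4_secondM x y z w : direction4 x y z w -> (y - z) * (y - w) = topM y x.
Proof.
move=> [_ _ _ s n]; have w0 : w = - x - y - z by lra.
have -> : topM y x = 3 * y ^+ 2 + 2 * y * x + x ^+ 2 -
  (x ^+ 2 + y ^+ 2 + z ^+ 2 + w ^+ 2) / 2 by rewrite n /topM; lra.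
by rewrite w0; field.
Qed.

Definition top_area x y z w t : R := (x - t) ^+ 2 / ((x - y) * (x - z) * (x - w)).

(* For fixed x, the product (x-y)(x-z)(x-w) = (x-y) topM x y decreases in y. *)
Lemma top_area_le x y z w t : direction4 x y z w -> y <= t -> t < x ->
  [/\ 0 < topM x t, 0 <= topM t x, 0 <= x + t & top_area x y z w t <= (x - t) / topM x t].
Proof.
move=> D yt tx; have EM := direction4_topM _ _ _ _ D; have EG := direction4_secondM _ _ _ _ D.
have [yx zy wz s n] := D.
have M0 : 0 < topM x y by rewrite -EM mulr_gt0//; lra.
have G0 : 0 <= topM y x by rewrite -EG mulr_ge0//; lra.
have Mt : 0 < topM x t.
  have -> : topM x t = topM x y + (t - y) * (2 * x + t + y) by rewrite /topM; ring.
  by rewrite ltr_pwDl// mulr_ge0//; lra.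
split=> //.
- have -> : topM t x = topM y x + (t - y) * (3 * (t + y) + 2 * x) by rewrite /topM; ring.
  by rewrite addr_ge0// mulr_ge0//; lra.
- lra.
rewrite /top_area -mulrA EM ler_pdivlMr// mulrAC ler_pdivrMr; last by rewrite mulr_gt0//; lra.
rewrite expr2 -mulrA ler_pM2l ?subr_gt0// -subr_ge0.
have -> : (x - y) * topM x y - (x - t) * topM x t =
    (t - y) * (topM y x + (t - y) * (x + t + 2 * y)) by rewrite /topM; ring.
have h1 : 0 <= (t - y) * (x + t + 2 * y) by rewrite mulr_ge0//; lra.
by rewrite mulr_ge0//; lra.
Qed.

Lemma top_area_le_bracket x y z w t Z : direction4 x y z w -> y <= t -> t < x ->
  12 * t ^+ 2 <= 1 -> 0 < Z -> Z ^+ 2 = 2 - 8 * t ^+ 2 ->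
  top_area x y z w t <= Z^-1.
Proof.
move=> D yt tx t12 Z0 Z2; have [M0 G0 xt0 le] := top_area_le _ _ _ _ _ D yt tx.
apply: (le_trans le); rewrite ler_pdivrMr// mulrC ler_pdivlMr//.
(* [0 <= topM t x] says exactly Z^2 <= (2 (x + t))^2. *)
have sZ : Z <= 2 * (x + t).
  rewrite -ler_sqr_nneg//; [|exact: ltW|by rewrite mulr_ge0].
  by rewrite Z2 -subr_ge0; move: G0; rewrite /topM; lra.
have Zt : 2 * t <= Z.
  have [t0|/ltW t0] := leP 0 t; last by lra.
  rewrite -ler_sqr_nneg//; [|lra|exact: ltW].
  by rewrite Z2; lra.
rewrite -subr_ge0.
have -> : topM x t - (x - t) * Z = (2 * (x + t) - Z) * (6 * (x + t) + Z - 8 * t) / 4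
     + (Z ^+ 2 - (2 - 8 * t ^+ 2)) / 4 by rewrite /topM; field.
by rewrite Z2 subrr mul0r addr0 divr_ge0// mulr_ge0//; lra.
Qed.

Definition middle_area x y z w t : R :=
  ((t - w) * (y - t) / (y - w) + (x - t) * (t - z) / (x - z)) / ((y - z) * (x - w)).

Lemma middle_area_le_bracket x y z w t Z : direction4 x y z w -> z < t -> t < y ->
  0 < Z -> Z ^+ 2 = 2 - 8 * t ^+ 2 -> middle_area x y z w t <= Z^-1.
Proof.
move=> [yx zy wz s n] zt ty Z0 Z2.
(* A and B are the outer and inner gaps; e and h are twice the offsets of t from the midpoints of
   [w, x] and [z, y]. *)
pose A := x - w; pose B := y - z; pose r := x + w; pose e := 2 * t - r; pose h := 2 * t + r.
have A0 : 0 < A by rewrite /A; lra.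
have B0 : 0 < B by rewrite /B; lra.
have [e1 e2] : -A < e /\ e < A by rewrite /e /A /r; split; lra.
have [h1 h2] : -B < h /\ h < B.
  have -> : h = 2 * t - (y + z) by rewrite /h /r; lra.
  by rewrite /B; split; lra.
have nAB : A ^+ 2 + B ^+ 2 + 2 * r ^+ 2 = 2.
  transitivity (2 * (x ^+ 2 + y ^+ 2 + z ^+ 2 + w ^+ 2) - (y + z) ^+ 2 + r ^+ 2).
    by rewrite /A /B /r; ring.
  have -> : y + z = - r by rewrite /r; lra.
  by rewrite n sqrrN; ring.
have Zeh : Z ^+ 2 = A ^+ 2 + B ^+ 2 - 2 * (e * h).
  have -> : e * h = 4 * t ^+ 2 - r ^+ 2 by rewrite /e /h; ring.
  by rewrite Z2; lra.
have eA : e ^+ 2 <= A ^+ 2 by nra.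
have hB : h ^+ 2 <= B ^+ 2 by nra.
have eh : - (A * B) <= e * h by nra.
have ZAB : Z <= A + B.
  rewrite -ler_sqr_nneg//; [|exact: ltW|by rewrite addr_ge0// ltW].
  rewrite Zeh; nra.
have c1 : 0 < y - w by lra.
have c2 : 0 < x - z by lra.
have -> : middle_area x y z w t =
   (A * B * (A + B) - B * e ^+ 2 - A * h ^+ 2) / (4 * (A * B) * ((y - w) * (x - z))).
  rewrite /middle_area -/A -/B.
  have -> : t - w = (A + e) / 2 by rewrite /A /e /r; lra.
  have -> : y - t = (B - h) / 2 by rewrite /B /h /r; lra.
  have -> : x - t = (A - e) / 2 by rewrite /A /e /r; lra.
  have -> : t - z = (B + h) / 2 by rewrite /B /h /r; lra.
  transitivity (((A + e) * (B - h) * (x - z) + (A - e) * (B + h) * (y - w)) /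
      (4 * (A * B) * ((y - w) * (x - z)))).
    by field; rewrite !gt_eqF.
  congr (_ / _).
  have -> : y - w = (A + B - (h - e)) / 2 by rewrite /A /B /h /e /r; lra.
  have -> : x - z = (A + B + (h - e)) / 2 by rewrite /A /B /h /e /r; lra.
  by field.
rewrite ler_pdivrMr ?mulr_gt0// ler_pdivlMl//.
have -> : 4 * (A * B) * ((y - w) * (x - z)) = A * B * ((A + B) ^+ 2 - (h - e) ^+ 2).
  have -> : (y - w) = (A + B - (h - e)) / 2 by rewrite /A /B /h /e /r; lra.
  have -> : (x - z) = (A + B + (h - e)) / 2 by rewrite /A /B /h /e /r; lra.
  by field.
(* With the numerator N = B (A^2 - e^2) + A (B^2 - h^2) one has N Z <= N (A + B), and A B ((A + B)^2
   - (h - e)^2) - N (A + B) = (B e + A h)^2. *)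
have p1 : 0 <= B * (A ^+ 2 - e ^+ 2) * (A + B - Z).
  by apply: mulr_ge0; [apply: mulr_ge0|]; lra.
have p2 : 0 <= A * (B ^+ 2 - h ^+ 2) * (A + B - Z).
  by apply: mulr_ge0; [apply: mulr_ge0|]; lra.
have p3 : 0 <= (B * e + A * h) ^+ 2 by exact: sqr_ge0.
nra.
Qed.

End triangular_sections.

(** * Upper bound for quadrilateral sections *)

Section quadrilateral_sections.
Variable R : realFieldType.
Implicit Types x y z w t p q r c : R.

(* The area of a quadrilateral section depends only on p = x + y and
   m = (x + z)(x + w), where p^2 + (x + z)^2 + (x + w)^2 = 1. *)
Definition quad_num (p m s : R) := p * (2 * p ^+ 2 - 1 - s ^+ 2) - 2 * s * m.
Definition quad_den (p m : R) := p ^+ 2 * (2 * p ^+ 2 - 1) + m ^+ 2.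

(** The coordinates p, q, r in the orthonormal frame already used for the charts; in them m is q
    r. *)
Lemma direction4_frame x y z w : direction4 R x y z w ->
  exists q r, [/\ x = (x + y + q + r) / 2, y = (x + y - q - r) / 2,
    z = (q - (x + y) - r) / 2 & w = (r - (x + y) - q) / 2] /\
    (x + y) ^+ 2 + q ^+ 2 + r ^+ 2 = 1 /\ q * r = (x + z) * (x + w).
Proof.
move=> [_ _ _ s n]; exists (x + z), (x + w); split; first by split; lra.
split=> //; rewrite -n; have -> : w = - x - y - z by lra.
by ring.
Qed.

Lemma quad_denE x y z w : direction4 R x y z w ->
  quad_den (x + y) ((x + z) * (x + w)) = (y - w) * (x - z) * ((y - z) * (x - w)).
Proof.
move=> D; have [q [r [[]]]] := direction4_frame _ _ _ _ D.
move: (x + y) ((x + z) * (x + w)) => p m xE yE zE wE [n mE].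
rewrite /quad_den -mE; have -> : 2 * p ^+ 2 - 1 = p ^+ 2 - q ^+ 2 - r ^+ 2 by lra.
by rewrite xE yE zE wE; field.
Qed.

Lemma quad_numE x y z w t : direction4 R x y z w ->
  quad_num (x + y) ((x + z) * (x + w)) (2 * t) =
  2 * ((t - w) * (y - t) * (x - z) + (x - t) * (t - z) * (y - w)).
Proof.
move=> D; have [q [r [[]]]] := direction4_frame _ _ _ _ D.
move: (x + y) ((x + z) * (x + w)) => p m xE yE zE wE [n mE].
rewrite /quad_num -mE; have -> : 2 * p ^+ 2 - 1 = p ^+ 2 - q ^+ 2 - r ^+ 2 by lra.
by rewrite xE yE zE wE; field.
Qed.

Lemma direction4_quad_range x y z w : direction4 R x y z w ->
  let p := x + y in let m := (x + z) * (x + w) in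
  [/\ 0 <= p, p <= 1, p ^+ 2 - 1 <= 2 * m & 2 * m <= 1 - p ^+ 2].
Proof.
move=> D; have [yx zy wz s _] := D; have [q [r [[]]]] := direction4_frame _ _ _ _ D.
have p0 : 0 <= x + y by lra.
move: (x + y) ((x + z) * (x + w)) p0 => p m p0 _ _ _ _ [n mE] /=.
(* The range of m is 2 |q r| <= q^2 + r^2 = 1 - p^2. *)
have m1 := sqr_ge0 (q + r); have m2 := sqr_ge0 (q - r).
split; [exact: p0| |rewrite -mE; lra|rewrite -mE; lra].
rewrite -ler_sqr_nneg// expr1n.
by have := sqr_ge0 q; have := sqr_ge0 r; lra.
Qed.

Lemma middle_areaE x y z w t : direction4 R x y z w -> z < t -> t < y ->
  let p := x + y in let m := (x + z) * (x + w) in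
  middle_area R x y z w t = quad_num p m (2 * t) / (2 * quad_den p m) /\
  0 < quad_den p m.
Proof.
move=> D zt ty p m; have [yx zy wz _ _] := D.
rewrite /p /m quad_numE// quad_denE//; split; last first.
  by apply: mulr_gt0; apply: mulr_gt0; lra.
by rewrite /middle_area; field; do ?[apply/andP; split]; rewrite gt_eqF//; lra.
Qed.

(* c bounds the quadrilateral formula at m = -(1 - p^2) / 2, that is x = y, for
   every p (with s = 2 t and the denominator cleared). *)
Definition gbound (c s : R) : Prop := forall p, s <= p <= 1 ->
  2 * (p * (2 * p ^+ 2 - 1 - s ^+ 2) + s * (1 - p ^+ 2)) <= c * (3 * p ^+ 2 - 1) ^+ 2.

Lemma quad_le_gbound (k c s p m : R) : 0 < k -> 3 * k ^+ 2 = 1 -> k <= s ->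
  s <= p <= 1 -> p ^+ 2 - 1 <= 2 * m <= 1 - p ^+ 2 -> 0 < quad_den p m ->
  gbound c s -> quad_num p m s / (2 * quad_den p m) <= c.
Proof.
move=> k0 k3 ks sp mV d0 gc; have g := gc _ sp.
move: sp => /andP[sp p1]; move: mV => /andP[m1 m2].
pose V := (1 - p ^+ 2) / 2.
have V2 : 2 * V = 1 - p ^+ 2 by rewrite /V; field.
have dV : quad_den p V = ((3 * p ^+ 2 - 1) / 2) ^+ 2.
  by rewrite /quad_den /V; field.
have mV : m ^+ 2 <= V ^+ 2 by nra.
have dV0 : 0 < quad_den p V by apply: (lt_le_trans d0); rewrite /quad_den; lra.
have s0 : 0 <= s by lra.
have V0 : 0 <= V by rewrite /V; lra.
(* This is the worst case V - m = 2 V of the factor in [key], doubled. In the scale p = k P it has a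
   double zero at P = 1 when s = k, and the part added for s > k is nonnegative. *)
have E0 : 0 <= s * (7 * p ^+ 4 - 2 * p ^+ 2 - 1) - 2 * p * (1 - p ^+ 2) * (2 * p ^+ 2 - 1)
    + 2 * p * (1 - p ^+ 2) * s ^+ 2.
  pose P := p / k; have pE : p = k * P by rewrite /P; field; rewrite gt_eqF.
  have P1 : 1 <= P by rewrite /P ler_pdivlMr// mul1r; lra.
  have k2 : k ^+ 2 = 3^-1 by lra.
  have p2 : p ^+ 2 = P ^+ 2 / 3 by rewrite pE exprMn k2 mulrC.
  have p4 : p ^+ 4 = P ^+ 4 / 9 by rewrite (exprM p 2 2) p2; field.
  have pk : p * k = P / 3 by rewrite pE mulrAC -expr2 k2 mulrC.
  have E1 : 7 * p ^+ 4 - 2 * p ^+ 2 - 1 + 4 * (p * k) * (1 - p ^+ 2) =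
      (P - 1) * (7 * P ^+ 3 + 3 * P ^+ 2 - 3 * P + 9) / 9.
    by rewrite p4 p2 pk; field.
  have E2 : k * (7 * p ^+ 4 - 2 * p ^+ 2 - 1) - 2 * p * (1 - p ^+ 2) * (2 * p ^+ 2 - 1 - k ^+ 2)
     = k / 9 * ((P - 1) ^+ 2 * (4 * P ^+ 3 + 15 * P ^+ 2 + 6 * P - 9)).
    transitivity (k * (7 * p ^+ 4 - 2 * p ^+ 2 - 1) -
        2 * (k * P) * (1 - p ^+ 2) * (2 * p ^+ 2 - 1 - k ^+ 2)); first by rewrite -pE.
    by rewrite p4 p2 k2; field.
  have -> : s * (7 * p ^+ 4 - 2 * p ^+ 2 - 1) - 2 * p * (1 - p ^+ 2) * (2 * p ^+ 2 - 1)
    + 2 * p * (1 - p ^+ 2) * s ^+ 2 =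
    (k * (7 * p ^+ 4 - 2 * p ^+ 2 - 1) - 2 * p * (1 - p ^+ 2) * (2 * p ^+ 2 - 1 - k ^+ 2))
    + (s - k) * (7 * p ^+ 4 - 2 * p ^+ 2 - 1 + 4 * (p * k) * (1 - p ^+ 2) +
        2 * (p * (1 - p ^+ 2)) * (s - k)) by ring.
  rewrite E1 E2.
  have h1 : 0 <= P - 1 by lra.
  have h2 : 0 <= 7 * P ^+ 3 + 3 * P ^+ 2 - 3 * P + 9 by nra.
  have h3 : 0 <= 4 * P ^+ 3 + 15 * P ^+ 2 + 6 * P - 9 by nra.
  have h4 : 0 <= p * (1 - p ^+ 2) by apply: mulr_ge0; lra.
  apply: addr_ge0.
    by apply: mulr_ge0; [lra|apply: mulr_ge0; [exact: sqr_ge0|]].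
  apply: mulr_ge0; first by lra.
  apply: addr_ge0; first by apply: divr_ge0 => //; apply: mulr_ge0.
  by apply: mulr_ge0; [apply: mulr_ge0|lra].
(* The denominator is even in m, so the cross difference vanishes at m = - V and V + m splits
   off. *)
have key : quad_num p m s * quad_den p V <= quad_num p (- V) s * quad_den p m.
  rewrite -subr_ge0.
  have -> : quad_num p (- V) s * quad_den p m - quad_num p m s * quad_den p V =
    (V + m) * (2 * s * quad_den p V - (V - m) * quad_num p (- V) s).
    by rewrite /quad_num /quad_den; ring.
  apply: mulr_ge0; first by lra.
  have [n0|n0] := leP (quad_num p (- V) s) 0.
    have h1 : 0 <= (V - m) * - quad_num p (- V) s by apply: mulr_ge0; lra.
    have h2 : 0 <= 2 * s * quad_den p V by apply: mulr_ge0; [lra|exact: ltW].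
    lra.
  have h1 : 0 <= (V + m) * quad_num p (- V) s by apply: mulr_ge0; lra.
  have h2 : 2 * (2 * s * quad_den p V - 2 * V * quad_num p (- V) s) =
     s * (7 * p ^+ 4 - 2 * p ^+ 2 - 1) - 2 * p * (1 - p ^+ 2) * (2 * p ^+ 2 - 1)
    + 2 * p * (1 - p ^+ 2) * s ^+ 2.
    by rewrite /quad_num /quad_den /V; field.
  lra.
rewrite ler_pdivrMr ?mulr_gt0// -(ler_pM2r dV0); apply: (le_trans key).
have -> : c * (2 * quad_den p m) * quad_den p V = (2 * c * quad_den p V) * quad_den p m by ring.
rewrite ler_pM2r// dV; move: g; rewrite /quad_num /V => g.
rewrite -subr_ge0; move: g; rewrite -subr_ge0.
set L := (X in 0 <= X -> _); set L' := (X in _ -> 0 <= X).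
have -> : L = 2 * L' by rewrite /L /L'; field.
by rewrite pmulr_rge0.
Qed.

End quadrilateral_sections.

(** * Triangular sections at heights from sqrt 3 / 4 on *)

Section far_triangular_sections.
Variable R : realFieldType.
Implicit Types x y z w t p q r c k u : R.

Lemma schur_sorted (a b c : R) : 0 <= a -> a <= b -> b <= c ->
  4 * (a + b + c) * (a * b + b * c + c * a) - (a + b + c) ^+ 3 <= 9 * (a * b * c).
Proof.
move=> a0 ab bc; rewrite -subr_ge0.
have -> : 9 * (a * b * c) - (4 * (a + b + c) * (a * b + b * c + c * a) - (a + b + c) ^+ 3) =
  (c - b) ^+ 2 * (c + b - a) + a * (b - a) * (c - a) by ring.
by apply: addr_ge0; apply: mulr_ge0; rewrite ?sqr_ge0//; [lra|apply: mulr_ge0; lra|lra].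
Qed.

(** The gaps x - y, x - z, x - w have sum 4 x and second symmetric function 6 x^2 - 1/2, so Schur's
    inequality bounds their product through x alone. *)
Lemma direction4_schur x y z w : direction4 R x y z w ->
  8 * x * (4 * x ^+ 2 - 1) <= 9 * ((x - y) * (x - z) * (x - w)).
Proof.
move=> [yx zy wz s n].
have h1 : 0 <= x - y by lra.
have h2 : x - y <= x - z by lra.
have h3 : x - z <= x - w by lra.
apply: le_trans (schur_sorted _ _ _ h1 h2 h3).
have w0 : w = - x - y - z by lra.
have -> : x - y + (x - z) + (x - w) = 4 * x by rewrite w0; ring.
have -> : (x - y) * (x - z) + (x - z) * (x - w) + (x - w) * (x - y) =
    6 * x ^+ 2 - (x ^+ 2 + y ^+ 2 + z ^+ 2 + w ^+ 2) / 2 by rewrite w0; field.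
by rewrite n -subr_ge0 (_ : _ - _ = 0)//; field.
Qed.

Lemma direction4_max x y z w : direction4 R x y z w -> 0 < x /\ 4 * x ^+ 2 <= 3.
Proof.
move=> [yx zy wz s n]; have x0 : 0 <= x by lra.
split.
  rewrite lt0r x0 andbT; apply/eqP => x00.
  have [y0 z0 w0] : [/\ y = 0, z = 0 & w = 0] by split; lra.
  by move: n; rewrite x00 y0 z0 w0; lra.
have : 0 <= (y - z) ^+ 2 + (z - w) ^+ 2 + (w - y) ^+ 2 by rewrite !addr_ge0 ?sqr_ge0.
have -> : (y - z) ^+ 2 + (z - w) ^+ 2 + (w - y) ^+ 2 =
  3 * (x ^+ 2 + y ^+ 2 + z ^+ 2 + w ^+ 2) - 3 * x ^+ 2 - (y + z + w) ^+ 2 by ring.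
have -> : y + z + w = - x by lra.
by rewrite n sqrrN; lra.
Qed.

Lemma top_area_schur x y z w t : direction4 R x y z w -> y <= t -> t < x ->
  1 < 4 * x ^+ 2 -> top_area R x y z w t <= 9 * (x - t) ^+ 2 / (8 * x * (4 * x ^+ 2 - 1)).
Proof.
move=> D yt tx x1; have S := direction4_schur _ _ _ _ D.
have [x0 _] := direction4_max _ _ _ _ D.
have [yx zy wz _ _] := D.
rewrite /top_area ler_pdivrMr; last by apply: mulr_gt0; [apply: mulr_gt0|]; lra.
rewrite mulrAC ler_pdivlMr; last by apply: mulr_gt0; lra.
by rewrite -[leRHS]mulrA mulrCA ler_wpM2l ?sqr_ge0.
Qed.

Lemma concave_quadratic_ge0 (a b c u u0 u1 : R) : 0 <= a -> u0 <= u -> u <= u1 ->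
  0 <= c + b * u0 - a * u0 ^+ 2 -> 0 <= c + b * u1 - a * u1 ^+ 2 ->
  0 <= c + b * u - a * u ^+ 2.
Proof.
move=> a0 h0 h1 f0 f1; have [E|u01] := eqVneq u0 u1.
  by have -> : u = u0 by lra.
have d : 0 < u1 - u0 by rewrite lt_neqAle subr_ge0 eq_sym subr_eq0 eq_sym u01; lra.
rewrite -(pmulr_lge0 _ d).
have -> : (c + b * u - a * u ^+ 2) * (u1 - u0) = (c + b * u0 - a * u0 ^+ 2) * (u1 - u) +
   (c + b * u1 - a * u1 ^+ 2) * (u - u0) + a * ((u - u0) * (u1 - u) * (u1 - u0)) by ring.
by rewrite !addr_ge0// !mulr_ge0//; lra.
Qed.

(* In the scale Y = 2 k x, u = 2 k t with k = 1 / sqrt 3, the vertex direction is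
   Y = 1. Schur's inequality is sharp enough for Y >= 2/3, top_area_le below. *)
Lemma top_area_large k x y z w t : 0 < k -> 3 * k ^+ 2 = 1 -> direction4 R x y z w ->
  y <= t -> t < x -> 3 * k <= 4 * t ->
  top_area R x y z w t <= 9 * k / 8 * (3 * k / 2 - t) ^+ 2.
Proof.
move=> k0 k3 D yt tx kt; have [M0 _ _ le1] := top_area_le _ _ _ _ _ _ D yt tx.
have le2 := top_area_schur _ _ _ _ _ D yt tx.
have [x0 x2] := direction4_max _ _ _ _ D.
pose Y := 2 * k * x; pose u := 2 * k * t.
have k2 : k ^+ 2 = 3^-1 by lra.
have kk : k * k = 3^-1 by rewrite -expr2.
have xE : x = 3 / 2 * (k * Y) by rewrite /Y; transitivity (3 * (k * k) * x); [rewrite kk; field|field].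
have tE : t = 3 / 2 * (k * u) by rewrite /u; transitivity (3 * (k * k) * t); [rewrite kk; field|field].
have Y1 : Y <= 1.
  rewrite -ler_sqr_nneg ?expr1n//; last by rewrite !mulr_ge0// ltW.
  by rewrite /Y !exprMn k2; lra.
have u1 : 1 / 2 <= u by rewrite /u; nra.
have uY : u < Y by rewrite /u /Y ltr_pM2l// mulr_gt0.
clearbody Y u.
have xt : x - t = 3 / 2 * k * (Y - u) by rewrite xE tE; ring.
have tgt : 9 * k / 8 * (3 * k / 2 - t) ^+ 2 = 27 / 32 * k * (1 - u) ^+ 2.
  have -> : 3 * k / 2 - t = 3 / 2 * k * (1 - u) by rewrite tE; field.
  by rewrite !exprMn k2; field.
rewrite tgt.
have [Y23|Y23] := leP (2 / 3) Y.
  have x1 : 4 * x ^+ 2 = 3 * Y ^+ 2.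
    by rewrite xE !exprMn k2; field.
  have Y3 : 0 < 3 * Y ^+ 2 - 1 by nra.
  have Y0 : 0 < Y by lra.
  apply: (le_trans (le2 _)); first by lra.
  rewrite x1 xt ler_pdivrMr; last by rewrite mulr_gt0//; lra.
  rewrite !exprMn k2.
  have -> : 8 * x = 12 * (k * Y) by rewrite xE; field.
  have -> : 27 / 32 * k * (1 - u) ^+ 2 * (12 * (k * Y) * (3 * Y ^+ 2 - 1)) =
     27 * 12 / 32 * (k * k) * ((1 - u) ^+ 2 * (Y * (3 * Y ^+ 2 - 1))) by field.
  rewrite kk.
  have h : 2 * (Y - u) ^+ 2 <= (1 - u) ^+ 2 * (Y * (3 * Y ^+ 2 - 1)).
    (* Equivalent to 2 (2 Y - 1)^2 <= Y (3 Y^2 - 1), which replaces the cubic by a square; what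
       remains is h4, where u >= 1/2 enters. *)
    have h1 : 0 <= (Y - 1) ^+ 2 * (3 * Y - 2) by rewrite mulr_ge0 ?sqr_ge0//; lra.
    have h2 : 2 * (2 * Y - 1) ^+ 2 <= Y * (3 * Y ^+ 2 - 1) by lra.
    have h3 : 0 <= Y - u by lra.
    have h4 : Y - u <= (1 - u) * (2 * Y - 1).
      have : 0 <= (1 - Y) * (2 * u - 1) by rewrite mulr_ge0; lra.
      lra.
    apply: (@le_trans _ _ ((1 - u) ^+ 2 * (2 * (2 * Y - 1) ^+ 2))); last first.
      by rewrite ler_wpM2l ?sqr_ge0.
    have -> : (1 - u) ^+ 2 * (2 * (2 * Y - 1) ^+ 2) = 2 * ((1 - u) * (2 * Y - 1)) ^+ 2 by ring.
    by rewrite ler_pM2l// ler_sqr_nneg//; exact: le_trans h4.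
  lra.
apply: (le_trans le1); rewrite ler_pdivrMr// xt.
have -> : topM R x t = (9 * Y ^+ 2 + 6 * Y * u + 3 * u ^+ 2 - 2) / 4.
  rewrite /topM xE tE.
  transitivity (k * k * (27 * Y ^+ 2 + 18 * Y * u + 9 * u ^+ 2) / 4 - 2^-1); first by field.
  by rewrite kk; field.
have h : 64 * (Y - u) <= 9 * (1 - u) ^+ 2 * (9 * Y ^+ 2 + 6 * Y * u + 3 * u ^+ 2 - 2).
  pose f v := 9 * (1 - u) ^+ 2 * (9 * v ^+ 2 + 6 * v * u + 3 * u ^+ 2 - 2) - 64 * (v - u).
  have f23 : 0 <= f (2 / 3).
    have v0 : 0 <= u - 1 / 2 by lra.
    have v1 : 0 <= 37 - 27 / 2 * (u - 1 / 2) by lra.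
    have h2 := mulr_ge0 v0 v1; have h3 := exprn_ge0 3 v0; have h4 := exprn_ge0 4 v0.
    by rewrite /f; lra.
  (* The difference quotient of f between Y and 2/3 is the left side minus 64, so f(Y) >= f(2/3). *)
  have q : 9 * (1 - u) ^+ 2 * (9 * (Y + 2 / 3) + 6 * u) <= 64 by nra.
  have : 0 <= (2 / 3 - Y) * (64 - 9 * (1 - u) ^+ 2 * (9 * (Y + 2 / 3) + 6 * u)).
    by rewrite mulr_ge0//; lra.
  move: f23; rewrite /f; lra.
have h' := ler_wpM2l (ltW k0) h.
lra.
Qed.

End far_triangular_sections.

(** * Triangular sections at heights from 1 / (2 sqrt 3) to sqrt 3 / 4 *)

Section near_triangular_sections.
Variable R : realFieldType.
Implicit Types x y z w t p q r c k u : R.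

(* When the pair (x, t) is still the pair of the two largest entries of some
   direction, the bound of top_area_le is a value of the quadrilateral formula. *)
Lemma topM_le_gbound k c x t : 0 < k -> 3 * k ^+ 2 = 1 -> k <= 2 * t -> t < x ->
  3 * x ^+ 2 + 2 * x * t + 3 * t ^+ 2 <= 2 -> gbound R c (2 * t) ->
  (x - t) / topM R x t <= c.
Proof.
move=> k0 k3 kt tx ell gc.
(* The values of p and m for a direction with entries x, t, z, w; the ellipse condition says (z -
   w)^2 >= 0 for the other two entries. *)
pose p := x + t; pose m := x ^+ 2 + t ^+ 2 - 2^-1.
have t0 : 0 < t by lra.
have t12 : 1 <= 12 * t ^+ 2.
  have : k ^+ 2 <= (2 * t) ^+ 2 by rewrite ler_sqr_nneg//; lra.
  by rewrite exprMn; lra.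
have xt2 : t ^+ 2 < x ^+ 2 by rewrite ltr_sqr_nneg//; lra.
have xt : t ^+ 2 < x * t by rewrite expr2 ltr_pM2r.
have G0 : 0 < topM R t x by rewrite /topM; lra.
have M0 : 0 < topM R x t by rewrite /topM; lra.
have dE : quad_den R p m = topM R x t * topM R t x.
  by rewrite /quad_den /topM /p /m; field.
have nE : quad_num R p m (2 * t) = 2 * (x - t) * topM R t x.
  by rewrite /quad_num /topM /p /m; field.
have -> : (x - t) / topM R x t = quad_num R p m (2 * t) / (2 * quad_den R p m).
  by rewrite dE nE; field; rewrite !gt_eqF.
have sq : 0 <= (x - t) ^+ 2 by exact: sqr_ge0.
apply: (@quad_le_gbound R k c (2 * t) p m) => //.
- apply/andP; split; first by rewrite /p; lra.
  rewrite -ler_sqr_nneg ?expr1n//; last by rewrite /p; lra.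
  by rewrite /p; lra.
- by rewrite /m /p; apply/andP; split; lra.
- by rewrite dE mulr_gt0.
Qed.

(** Schur's bound against (1 - 4 t^2) / 2, in the scale of [top_area_large]; 60/13 is 8 times 15/26
    <= k. For fixed Y the difference is concave in u, so the ends of the range of u decide. *)
Lemma schur_bound_mid (Y u : R) : 2 / 3 <= Y -> Y <= 1 -> 1 / 3 <= u -> u <= 1 / 2 ->
  8 <= 9 * Y ^+ 2 + 6 * Y * u + 9 * u ^+ 2 ->
  9 * (Y - u) ^+ 2 <= 60 / 13 * (Y * (3 * Y ^+ 2 - 1)) * (1 - 3 * u ^+ 2).
Proof.
move=> Y23 Y1 u13 u12 out.
pose C := Y * (3 * Y ^+ 2 - 1).
pose a := 9 + 3 * (60 / 13) * C; pose b := 18 * Y; pose c := 60 / 13 * C - 9 * Y ^+ 2.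
have hE v : 60 / 13 * (Y * (3 * Y ^+ 2 - 1)) * (1 - 3 * v ^+ 2) - 9 * (Y - v) ^+ 2 =
  c + b * v - a * v ^+ 2 by rewrite /a /b /c /C; ring.
have C0 : 0 <= C by rewrite /C mulr_ge0//; nra.
have a0 : 0 <= a by rewrite /a; lra.
rewrite -subr_ge0 hE.
have f12 : 0 <= c + b * (1 / 2) - a * (1 / 2) ^+ 2.
  rewrite -hE.
  have h1 : 0 <= (Y - 1) ^+ 2 * (3 * Y - 2) by rewrite mulr_ge0 ?sqr_ge0//; lra.
  move: C0; rewrite /C; lra.
have [Y34|Y34] := leP (3 / 4) Y.
  apply: (@concave_quadratic_ge0 R a b c u (1 / 3) (1 / 2)) => //.
  rewrite -hE.
  pose v := Y - 3 / 4; have v0 : 0 <= v by rewrite /v; lra.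
  have YE : Y = v + 3 / 4 by rewrite /v; lra.
  rewrite YE; have v2 := exprn_ge0 2 v0; have v3 := exprn_ge0 3 v0; lra.
(* At Y = 2/3 the inequality fails for u = 1/3. Over [2/3, 3/4] this line is a chord inside the
   ellipse 9 Y^2 + 6 Y u + 9 u^2 = 8, close to the arc, and gives a better lower end. *)
pose l := 34 / 25 - 33 / 25 * Y.
have lu : l <= u.
  rewrite leNgt; apply/negP => ul.
  have e1 : 9 * Y ^+ 2 + 6 * Y * l + 9 * l ^+ 2 <= 8.
    have : 0 <= (Y - 2 / 3) * (3 / 4 - Y) by rewrite mulr_ge0//; lra.
    rewrite /l; lra.
  have l0 : 0 < l by rewrite /l; lra.
  have e2 : 0 < (l - u) * (6 * Y + 9 * (l + u)) by rewrite mulr_gt0//; lra.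
  lra.
have l12 : l <= 1 / 2 by rewrite /l; lra.
apply: (@concave_quadratic_ge0 R a b c u l (1 / 2)) => //.
rewrite -hE /l.
pose v := Y - 2 / 3; have v0 : 0 <= v by rewrite /v; lra.
have v1 : v <= 12^-1 by rewrite /v; lra.
have YE : Y = v + 2 / 3 by rewrite /v; lra.
have v2 := exprn_ge0 2 v0; have v3 := exprn_ge0 3 v0.
have v22 : v ^+ 2 <= 144^-1.
  have -> : 144^-1 = (12^-1) ^+ 2 :> R by field.
  by rewrite ler_sqr_nneg// invr_ge0.
have v4 : 0 <= v ^+ 3 * (37 - 93 * v - 73 * v ^+ 2) by rewrite mulr_ge0//; lra.
have v5 := exprn_ge0 5 v0; have v6 := exprn_ge0 4 v0.
by rewrite YE; lra.
Qed.

(** The bound of [top_area_le] against (1 - 4 t^2) / 2; 104/15 is 12 times 26/45 >= k. Outside the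
    ellipse Y < 2/3 leaves only u near 1/2, and the difference quotient in Y again reduces to Y =
    2/3. *)
Lemma edge_bound_mid (Y u : R) : 0 <= u -> u < Y -> Y < 2 / 3 -> u <= 1 / 2 ->
  8 <= 9 * Y ^+ 2 + 6 * Y * u + 9 * u ^+ 2 ->
  104 / 15 * (Y - u) <= (1 - 3 * u ^+ 2) * (9 * Y ^+ 2 + 6 * Y * u + 3 * u ^+ 2 - 2).
Proof.
move=> u0 uY Y23 u12 outY.
have u2 : u ^+ 2 <= 1 / 4.
  have -> : 1 / 4 = (1 / 2) ^+ 2 :> R by field.
  by rewrite ler_sqr_nneg//; lra.
have u48 : 12 / 25 <= u.
  rewrite leNgt; apply/negP => ul; move: outY; apply/negP; rewrite -ltNge.
  have e1 : Y ^+ 2 <= (2 / 3) ^+ 2 by rewrite ler_sqr_nneg//; lra.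
  have e2 : u ^+ 2 <= (12 / 25) ^+ 2 by rewrite ler_sqr_nneg//; lra.
  have e3 : Y * u <= 2 / 3 * (12 / 25) by rewrite ler_pM//; lra.
  lra.
pose f v := (1 - 3 * u ^+ 2) * (9 * v ^+ 2 + 6 * v * u + 3 * u ^+ 2 - 2) - 104 / 15 * (v - u).
have u48' : (12 / 25) ^+ 2 <= u ^+ 2 by rewrite ler_sqr_nneg//; lra.
have f23 : 0 <= f (2 / 3).
  pose v := 1 / 2 - u; have v0 : 0 <= v by rewrite /v; lra.
  have v1 : v <= 1 / 50 by rewrite /v; lra.
  have v2 : v ^+ 2 <= (1 / 50) ^+ 2 by rewrite ler_sqr_nneg//; lra.
  have h1 : 0 <= v * (5 - 35 * v) by rewrite mulr_ge0//; lra.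
  have h2 : 0 <= v ^+ 2 * (1 - 9 * v ^+ 2) by rewrite mulr_ge0 ?sqr_ge0//; lra.
  have h3 := exprn_ge0 3 v0.
  have uE : u = 1 / 2 - v by rewrite /v; lra.
  by rewrite /f uE; lra.
have q : (1 - 3 * u ^+ 2) * (9 * (Y + 2 / 3) + 6 * u) <= 104 / 15.
  apply: (@le_trans _ _ (1 / 3 * 15)); last by lra.
  by rewrite ler_pM//; lra.
have : 0 <= (2 / 3 - Y) * (104 / 15 - (1 - 3 * u ^+ 2) * (9 * (Y + 2 / 3) + 6 * u)).
  by apply: mulr_ge0; lra.
move: f23; rewrite /f; lra.
Qed.

Lemma top_area_mid k c x y z w t : 0 < k -> 3 * k ^+ 2 = 1 -> direction4 R x y z w ->
  y <= t -> t < x -> k <= 2 * t -> 4 * t <= 3 * k -> gbound R c (2 * t) ->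
  top_area R x y z w t <= c.
Proof.
move=> k0 k3 D yt tx kt tk gc.
have [M0 _ _ le1] := top_area_le _ _ _ _ _ _ D yt tx.
have [ell|out] := leP (3 * x ^+ 2 + 2 * x * t + 3 * t ^+ 2) 2.
  exact/(le_trans le1)/(topM_le_gbound k).
have le2 := top_area_schur _ _ _ _ _ _ D yt tx.
have [x0 x2] := direction4_max _ _ _ _ _ D.
have k2 : k ^+ 2 = 3^-1 by lra.
have kk : k * k = 3^-1 by rewrite -expr2.
have k_lo : 15 / 26 <= k by rewrite -ler_sqr_nneg ?k2; lra.
have k_hi : k <= 26 / 45 by rewrite -ler_sqr_nneg ?k2; lra.
(* This is [gbound] at p = 1. Outside the ellipse the area is already below this smaller number. *)
have cb : (1 - 4 * t ^+ 2) / 2 <= c.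
  have := gc 1; rewrite lexx andbT expr1n => /(_ _) h.
  have : 2 * t <= 1 by lra.
  by move=> /h; lra.
apply: le_trans cb.
pose Y := 2 * k * x; pose u := 2 * k * t.
have xE : x = 3 / 2 * (k * Y).
  by rewrite /Y; transitivity (3 * (k * k) * x); [rewrite kk; field|field].
have tE : t = 3 / 2 * (k * u).
  by rewrite /u; transitivity (3 * (k * k) * t); [rewrite kk; field|field].
have Y1 : Y <= 1.
  rewrite -ler_sqr_nneg ?expr1n//; last by rewrite !mulr_ge0// ltW.
  by rewrite /Y !exprMn k2; lra.
have u13 : 1 / 3 <= u by rewrite /u; nra.
have u12 : u <= 1 / 2 by rewrite /u; nra.
have uY : u < Y by rewrite /u /Y ltr_pM2l// mulr_gt0.
clearbody Y u.
have outY : 8 <= 9 * Y ^+ 2 + 6 * Y * u + 9 * u ^+ 2.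
  move: out; rewrite xE tE.
  have -> : 3 * (3 / 2 * (k * Y)) ^+ 2 + 2 * (3 / 2 * (k * Y)) * (3 / 2 * (k * u)) +
    3 * (3 / 2 * (k * u)) ^+ 2 = k ^+ 2 * (27 / 4 * Y ^+ 2 + 9 / 2 * Y * u + 27 / 4 * u ^+ 2) by field.
  by rewrite k2; lra.
have xt : x - t = 3 / 2 * k * (Y - u) by rewrite xE tE; ring.
have -> : (1 - 4 * t ^+ 2) / 2 = (1 - 3 * u ^+ 2) / 2.
  by rewrite tE !exprMn k2; field.
have u2 : u ^+ 2 <= 1 / 4.
  have -> : 1 / 4 = (1 / 2) ^+ 2 :> R by field.
  by rewrite ler_sqr_nneg//; lra.
have [Y23|Y23] := leP (2 / 3) Y.
  have x1 : 4 * x ^+ 2 = 3 * Y ^+ 2 by rewrite xE !exprMn k2; field.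
  have Y3 : 0 < 3 * Y ^+ 2 - 1.
    have : (2 / 3) ^+ 2 <= Y ^+ 2 by rewrite ler_sqr_nneg//; lra.
    lra.
  have C0 : 0 < Y * (3 * Y ^+ 2 - 1) by rewrite mulr_gt0//; lra.
  apply: (le_trans (le2 _)); first by lra.
  rewrite x1 xt ler_pdivrMr; last by rewrite mulr_gt0//; lra.
  rewrite !exprMn k2.
  have -> : (1 - 3 * u ^+ 2) / 2 * (8 * x * (3 * Y ^+ 2 - 1)) =
     6 * k * (Y * (3 * Y ^+ 2 - 1)) * (1 - 3 * u ^+ 2) by rewrite xE; field.
  have := schur_bound_mid Y u Y23 Y1 u13 u12 outY; clear -k_lo C0 u2.
  have : 0 <= (k - 15 / 26) * ((Y * (3 * Y ^+ 2 - 1)) * (1 - 3 * u ^+ 2)).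
    by apply: mulr_ge0; [lra|apply: mulr_ge0; [exact: ltW|lra]].
  lra.
apply: (le_trans le1); rewrite ler_pdivrMr// xt.
have -> : topM R x t = (9 * Y ^+ 2 + 6 * Y * u + 3 * u ^+ 2 - 2) / 4.
  rewrite /topM xE tE.
  transitivity (k * k * (27 * Y ^+ 2 + 18 * Y * u + 9 * u ^+ 2) / 4 - 2^-1); first by field.
  by rewrite kk; field.
have h := edge_bound_mid Y u (le_trans (divr_ge0 ler01 (ler0n R 3)) u13) uY Y23 u12 outY.
clear -h k_hi uY.
have : 0 <= (26 / 45 - k) * (Y - u) by apply: mulr_ge0; lra.
lra.
Qed.

End near_triangular_sections.

(** * Maximizing g; here k is sqrt (28 x^2 - 1) / (2 x) and no longer 1 / sqrt 3 *)

Section critical_points.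
Variable R : realFieldType.
Implicit Types x y z w t p q r c k u s : R.

(** Both sides agree at p = 1, which leaves a cubic J on [s, 1] with J(1) = 4 (5 s^2 - 2 s - 1), the
    source of t_1. *)
Lemma gbound_two s : 0 <= s -> 1 <= 5 * s ^+ 2 - 2 * s -> gbound R ((1 - s ^+ 2) / 2) s.
Proof.
move=> s0 s5 p /andP[sp p1]; rewrite -subr_ge0.
pose J v := - 9 * (1 - s ^+ 2) * v ^+ 3 + (8 - 9 * (1 - s ^+ 2)) * v ^+ 2 +
  (8 - 4 * s - 3 * (1 - s ^+ 2)) * v + (1 - s ^+ 2) - 4 * s.
have -> : (1 - s ^+ 2) / 2 * (3 * p ^+ 2 - 1) ^+ 2 -
  2 * (p * (2 * p ^+ 2 - 1 - s ^+ 2) + s * (1 - p ^+ 2)) = (1 - p) * J p / 2.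
  by rewrite /J; field.
rewrite divr_ge0// mulr_ge0//; first lra.
have [s1|s1] := ltP s 1; last first.
  have pE : p = 1 by lra.
  have sE : s = 1 by lra.
  by rewrite /J pE sE; lra.
have a0 : 0 <= 1 - s ^+ 2 by rewrite subr_ge0 expr_le1// ltW.
pose X := 9 * (1 - s ^+ 2) * (p + s + 2) - 8.
have d0 : 0 < 1 - s by lra.
(* Linear interpolation between s and 1 with remainder: X >= 0 for s <= 3/4, and for larger s the
   bound J(s) >= 8 (1 - s)^2 compensates X >= - 8. *)
have JE : J p * (1 - s) = J s * (1 - p) + J 1 * (p - s) + (1 - s) * (1 - p) * (p - s) * X.
  by rewrite /J /X; ring.
have J1 : J 1 = 4 * (5 * s ^+ 2 - 2 * s - 1) by rewrite /J; ring.
have Js : J s = (s + 1) * (3 * s ^+ 2 - 1) ^+ 2 by rewrite /J; ring.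
have J10 : 0 <= J 1 by rewrite J1; lra.
have Js0 : 0 <= J s by rewrite Js mulr_ge0 ?sqr_ge0//; lra.
rewrite -(pmulr_lge0 _ d0) JE.
have b1 : 0 <= J 1 * (p - s) by rewrite mulr_ge0//; lra.
have b3 : 0 <= (1 - s) * (1 - p) * (p - s) by rewrite !mulr_ge0//; lra.
have [s34|s34] := leP s (3 / 4).
  have X0 : 0 <= X.
    have s2 : s ^+ 2 <= (3 / 4) ^+ 2 by rewrite ler_sqr_nneg//; lra.
    have slo : 2 / 3 <= s by nra.
    have : 7 / 16 * (10 / 3) <= (1 - s ^+ 2) * (p + s + 2) by rewrite ler_pM//; lra.
    by rewrite /X; lra.
  have b2 : 0 <= J s * (1 - p) by rewrite mulr_ge0//; lra.
  have b4 := mulr_ge0 b3 X0; lra.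
have Jb : 8 * (1 - s) ^+ 2 <= J s.
  have s2 : (3 / 4) ^+ 2 <= s ^+ 2 by rewrite ler_sqr_nneg//; lra.
  have e1 : (1 - s) ^+ 2 <= (1 / 4) ^+ 2 by rewrite ler_sqr_nneg//; lra.
  have e2 : (11 / 16) ^+ 2 <= (3 * s ^+ 2 - 1) ^+ 2 by rewrite ler_sqr_nneg//; lra.
  have e3 : 7 / 4 * (11 / 16) ^+ 2 <= J s by rewrite Js ler_pM//; lra.
  lra.
have X8 : -8 <= X by rewrite /X; have : 0 <= (1 - s ^+ 2) * (p + s + 2); [rewrite mulr_ge0//; lra|lra].
have b4 : 0 <= (1 - s) * (1 - p) * (p - s) * (X + 8) by rewrite mulr_ge0//; lra.
have b5 : 0 <= (1 - s) * (1 - p) * (1 - p) by rewrite !mulr_ge0//; lra.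
have b6 : 0 <= (1 - p) * (J s - 8 * (1 - s) ^+ 2) by rewrite mulr_ge0//; lra.
lra.
Qed.

(* Homogeneous form of the critical point equation: with P = 2 x and
   sqrt (28 x^2 - 1) = k P one gets 1 = P^2 (7 - k^2) and
   2 phi(x) = P (8 + k - k^2) / (4 + k). *)
Definition crit_scale k : R := (8 + k - k ^+ 2) / (4 + k).
(** The value of g at its critical point p = P, by [crit_value_eq]. *)
Definition crit_value k P : R := 2 * (k + 3) / ((4 + k) ^+ 2 * P).

(** The double zero at p = P expresses criticality; it becomes a polynomial identity once constants
    are made homogeneous by 1 = P^2 (7 - k^2). *)
Lemma crit_value_identity k P p : 2 <= k -> 0 < P -> P ^+ 2 * (7 - k ^+ 2) = 1 ->
  let s := P * crit_scale k in
  crit_value k P * (3 * p ^+ 2 - 1) ^+ 2 - 2 * (p * (2 * p ^+ 2 - 1 - s ^+ 2) + s * (1 - p ^+ 2))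
  = 2 * P / (4 + k) ^+ 2 * (p / P - 1) ^+ 2 * ((9 * (k + 3) * p ^+ 2
     - (5 * k + 11)) + (22 + 2 * k - 2 * k ^+ 2) * P * p).
Proof.
move=> k2 P0 P1 s; pose z := p / P; have pE : p = z * P by rewrite /z divfK// gt_eqF.
have k4 : 4 + k != 0 by rewrite gt_eqF//; lra.
have P0' : P != 0 by rewrite gt_eqF.
clearbody z.
have one X : X = X * (P ^+ 2 * (7 - k ^+ 2)) by rewrite P1 mulr1.
rewrite /s /crit_value /crit_scale.
have -> : 3 * p ^+ 2 - 1 = P ^+ 2 * (3 * z ^+ 2 - (7 - k ^+ 2)) by rewrite pE; lra.
have -> : 1 - p ^+ 2 = P ^+ 2 * (7 - k ^+ 2 - z ^+ 2) by rewrite pE; lra.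
have -> : 2 * p ^+ 2 - 1 = P ^+ 2 * (2 * z ^+ 2 - (7 - k ^+ 2)) by rewrite pE; lra.
have -> : 9 * (k + 3) * p ^+ 2 - (5 * k + 11) =
   P ^+ 2 * (9 * (k + 3) * z ^+ 2 - (7 - k ^+ 2) * (5 * k + 11)) by have := one (5 * k + 11); rewrite pE; lra.
by rewrite pE; field; rewrite P0' k4.
Qed.

(** Amounts to k + 1 <= (11 + k - k^2) P p; the difference of the squares is a multiple of 3 p^2 - 1
    plus a square, and vanishes at k = 2, p = P. *)
Lemma crit_factor_gt0 k P p : 2 <= k -> k ^+ 2 <= 6 -> 0 < P ->
  P ^+ 2 * (7 - k ^+ 2) = 1 -> 0 < p -> 1 <= 3 * p ^+ 2 ->
  3 * (k + 3) * (3 * p ^+ 2 - 1) <=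
  9 * (k + 3) * p ^+ 2 - (5 * k + 11) + (22 + 2 * k - 2 * k ^+ 2) * P * p.
Proof.
move=> k2 k6 P0 P1 p0 p3; have k3 : k <= 3 by nra.
have b0 : 0 <= 11 + k - k ^+ 2 by lra.
have h : k + 1 <= (11 + k - k ^+ 2) * P * p.
  rewrite -ler_sqr_nneg//; [|lra|by rewrite !mulr_ge0// ltW].
  have e : 3 * ((11 + k - k ^+ 2) * P * p) ^+ 2 =
     (11 + k - k ^+ 2) ^+ 2 * P ^+ 2 * (3 * p ^+ 2 - 1) + 3 * (k + 1) ^+ 2 * (P ^+ 2 * (7 - k ^+ 2)) +
     ((k - 2) * (2 * k + 5) * P) ^+ 2 by ring.
  have e1 : 0 <= (11 + k - k ^+ 2) ^+ 2 * P ^+ 2 * (3 * p ^+ 2 - 1).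
    by apply: mulr_ge0; [apply: mulr_ge0; exact: sqr_ge0|lra].
  have e2 := sqr_ge0 ((k - 2) * (2 * k + 5) * P).
  by rewrite P1 in e; lra.
lra.
Qed.

Lemma crit_value_bound k P p s : 2 <= k -> k ^+ 2 <= 6 -> 0 < P ->
  P ^+ 2 * (7 - k ^+ 2) = 1 -> 0 < p -> 1 <= 3 * p ^+ 2 ->
  s = P * crit_scale k ->
  2 * (p * (2 * p ^+ 2 - 1 - s ^+ 2) + s * (1 - p ^+ 2)) <=
  crit_value k P * (3 * p ^+ 2 - 1) ^+ 2.
Proof.
move=> k2 k6 P0 P1 p0 p3 ->; rewrite -subr_ge0 crit_value_identity//.
have g := crit_factor_gt0 _ _ _ k2 k6 P0 P1 p0 p3.
have g0 : 0 <= 3 * (k + 3) * (3 * p ^+ 2 - 1) by rewrite !mulr_ge0//; lra.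
have c0 : 0 <= 2 * P / (4 + k) ^+ 2 by rewrite divr_ge0 ?sqr_ge0//; lra.
by apply: mulr_ge0; [apply: mulr_ge0; rewrite ?sqr_ge0|exact: le_trans g].
Qed.

Lemma crit_value_bound_lt k P p s : 2 <= k -> k ^+ 2 <= 6 -> 0 < P ->
  P ^+ 2 * (7 - k ^+ 2) = 1 -> 0 < p -> 1 < 3 * p ^+ 2 -> p != P ->
  s = P * crit_scale k ->
  2 * (p * (2 * p ^+ 2 - 1 - s ^+ 2) + s * (1 - p ^+ 2)) <
  crit_value k P * (3 * p ^+ 2 - 1) ^+ 2.
Proof.
move=> k2 k6 P0 P1 p0 p3 pP ->; rewrite -subr_gt0 crit_value_identity//.
have g := crit_factor_gt0 _ _ _ k2 k6 P0 P1 p0 (ltW p3).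
have g0 : 0 < 3 * (k + 3) * (3 * p ^+ 2 - 1) by rewrite !mulr_gt0//; lra.
have z0 : 0 < (p / P - 1) ^+ 2.
  rewrite lt0r sqr_ge0 andbT sqrf_eq0 subr_eq0; apply: contraNneq pP => E.
  by apply/eqP; transitivity (p / P * P); [rewrite divfK ?gt_eqF|rewrite E mul1r].
have c0 : 0 < 2 * P / (4 + k) ^+ 2.
  by apply: divr_gt0; [rewrite mulr_gt0|apply: exprn_gt0; lra].
by apply: mulr_gt0; [apply: mulr_gt0|exact: lt_le_trans g].
Qed.

Lemma crit_value_eq k P s : 2 <= k -> 0 < P -> P ^+ 2 * (7 - k ^+ 2) = 1 ->
  s = P * crit_scale k ->
  2 * (P * (2 * P ^+ 2 - 1 - s ^+ 2) + s * (1 - P ^+ 2)) =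
  crit_value k P * (3 * P ^+ 2 - 1) ^+ 2.
Proof.
move=> k2 P0 P1 ->; apply/eqP; rewrite eq_sym -subr_eq0 crit_value_identity//.
by rewrite (divff (lt0r_neq0 P0)) subrr expr0n mulr0 mul0r.
Qed.

Lemma crit_scale_le1 k : 2 <= k -> crit_scale k <= 1.
Proof.
move=> k2; rewrite /crit_scale ler_pdivrMr ?mul1r; last lra.
by have : 2 ^+ 2 <= k ^+ 2; [rewrite ler_sqr_nneg//; lra|lra].
Qed.

(** Clearing denominators gives (k - 2)^2 (4 k^2 + 18 k + 20) = 0. This serves the boundary value s
    = 1 / sqrt 3 in [crit_scale_inj]. *)
Lemma crit_scale_eq1 k P : 2 <= k -> P ^+ 2 * (7 - k ^+ 2) = 1 ->
  3 * (P * crit_scale k) ^+ 2 = 1 -> k = 2.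
Proof.
move=> k2 P1 E; have k4 : 4 + k != 0 by rewrite gt_eqF//; lra.
have P0 : P ^+ 2 != 0.
  by apply/eqP => P0; move: P1; rewrite P0 mul0r => /eqP; rewrite eq_sym oner_eq0.
have : P ^+ 2 * (3 * (8 + k - k ^+ 2) ^+ 2) = P ^+ 2 * ((4 + k) ^+ 2 * (7 - k ^+ 2)).
  transitivity ((4 + k) ^+ 2 * (3 * (P * crit_scale k) ^+ 2)).
    by rewrite /crit_scale; field; exact: k4.
  by rewrite E mulr1 [RHS]mulrCA P1 mulr1.
move/(mulfI P0) => F.
have {F} : (k - 2) ^+ 2 * (4 * k ^+ 2 + 18 * k + 20) = 0 by lra.
move/eqP; rewrite mulf_eq0 sqrf_eq0 subr_eq0 => /orP[/eqP //|/eqP F].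
by have := sqr_ge0 k; lra.
Qed.

(* Two critical points for the same s would each be the strict maximizer. *)
Lemma crit_scale_inj k1 k2 P1 P2 : 2 <= k1 -> k1 ^+ 2 <= 6 -> 2 <= k2 -> k2 ^+ 2 <= 6 ->
  0 < P1 -> P1 ^+ 2 * (7 - k1 ^+ 2) = 1 -> 0 < P2 -> P2 ^+ 2 * (7 - k2 ^+ 2) = 1 ->
  P1 * crit_scale k1 = P2 * crit_scale k2 -> P1 = P2.
Proof.
move=> h1 h1' h2 h2' p1 e1 p2 e2 E; apply/eqP/negPn/negP => ne.
have ge P k : 2 <= k -> k ^+ 2 <= 6 -> P ^+ 2 * (7 - k ^+ 2) = 1 -> 0 < P -> 1 <= 3 * P ^+ 2.
  move=> hk hk' eP P0; have : 2 ^+ 2 <= k ^+ 2 by rewrite ler_sqr_nneg//; lra.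
  move=> k4; have : 0 <= P ^+ 2 * (k ^+ 2 - 4) by rewrite mulr_ge0 ?sqr_ge0//; lra.
  lra.
have k_of P k : 2 <= k -> P ^+ 2 * (7 - k ^+ 2) = 1 -> 3 * P ^+ 2 = 1 -> k = 2.
  move=> hk eP P3; have P2E : P ^+ 2 = 3^-1 by lra.
  rewrite P2E in eP; have k4 : (k - 2) * (k + 2) = 0 by lra.
  move/eqP: k4; rewrite mulf_eq0 => /orP[/eqP|/eqP]; lra.
(* The strict bound needs 3 P^2 > 1. If 3 P^2 = 1, then k = 2 and s = 1 / sqrt 3, hence k' = 2 and
   P' = P. *)
have gt k k' P P' : 2 <= k -> 2 <= k' -> P ^+ 2 * (7 - k ^+ 2) = 1 ->
    P' ^+ 2 * (7 - k' ^+ 2) = 1 -> 1 <= 3 * P ^+ 2 -> 0 < P -> 0 < P' ->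
    P * crit_scale k = P' * crit_scale k' -> P != P' -> 1 < 3 * P ^+ 2.
  move=> hk hk' eP eP' P3 P0 P0' EE neP; rewrite lt_neqAle P3 andbT.
  apply: contraNneq neP => P3'.
  have kE := k_of _ _ hk eP (esym P3').
  have k'E : k' = 2.
    apply: (crit_scale_eq1 k' P') => //.
    by rewrite -EE kE /crit_scale [RHS]P3'; field.
  apply/eqP; move: eP eP'; rewrite kE k'E => eP eP'.
  apply/eqP; rewrite -(@eqrXn2 _ 2)//; [|exact: ltW|exact: ltW].
  by apply/eqP; lra.
have g1 := ge _ _ h1 h1' e1 p1; have g2 := ge _ _ h2 h2' e2 p2.
have s1 := gt _ _ _ _ h1 h2 e1 e2 g1 p1 p2 E ne.
have ne' : P2 != P1 by rewrite eq_sym.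
have s2 := gt _ _ _ _ h2 h1 e2 e1 g2 p2 p1 (esym E) ne'.
have b1 := crit_value_bound_lt _ _ _ _ h1 h1' p1 e1 p2 s2 ne' erefl.
have b2 := crit_value_bound_lt _ _ _ _ h2 h2' p2 e2 p1 s1 ne erefl.
have c1 := crit_value_eq _ _ _ h1 p1 e1 erefl; have c2 := crit_value_eq _ _ _ h2 p2 e2 erefl.
move: b1 b2; rewrite /= E c2 -E c1 !ltr_pM2r ?exprn_gt0//; [|lra|lra].
by move=> b1 b2; have := lt_trans b1 b2; rewrite ltxx.
Qed.

End critical_points.

(** * Lower bounds at small heights *)

Section lower_bounds.
Variable R : rcfType.
Implicit Types x y z w t p q r c k u s : R.

(** For the gaps below x, e_1 = 4 x and 2 e_2 = 12 x^2 - 1; the second claim is e_2 >= 0. *)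
Lemma direction4_newton x y z w : direction4 R x y z w ->
  48 * x * ((x - y) * (x - z) * (x - w)) <= (12 * x ^+ 2 - 1) ^+ 2 /\ 1 <= 12 * x ^+ 2.
Proof.
move=> [yx zy wz s n].
pose a := x - y; pose b := x - z; pose c := x - w.
have e1 : a + b + c = 4 * x by rewrite /a /b /c; lra.
have e2 : 2 * (a * b + b * c + c * a) = 12 * x ^+ 2 - 1.
  have w0 : w = - x - y - z by lra.
  transitivity (12 * x ^+ 2 - (x ^+ 2 + y ^+ 2 + z ^+ 2 + w ^+ 2)); last by rewrite n.
  by rewrite /a /b /c w0; ring.
have nwt : 3 * (a + b + c) * (a * b * c) <= (a * b + b * c + c * a) ^+ 2.
  have h1 := sqr_ge0 (a * b - b * c); have h2 := sqr_ge0 (b * c - c * a).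
  have h3 := sqr_ge0 (c * a - a * b); lra.
split.
  have -> : 48 * x * ((x - y) * (x - z) * (x - w)) = 4 * (3 * (4 * x) * (a * b * c)) by rewrite /a /b /c; ring.
  by rewrite -e1 -e2 exprMn; lra.
have : 0 <= a * b + b * c + c * a by rewrite !addr_ge0// mulr_ge0// /a /b /c; lra.
lra.
Qed.

(** [u] is separate from [t] for the sake of bottom triangles: reflected, they lie at height - t and
    are compared at u = t. *)
Lemma top_area_ge k x y z w t u : 0 < k -> 3 * k ^+ 2 = 1 -> direction4 R x y z w ->
  y <= t -> t < x -> t <= u -> 0 <= u -> 2 * u <= k ->
  9 * k / 8 * (3 * k / 2 - u) ^+ 2 <= top_area R x y z w t.
Proof.
move=> k0 k3 D yt tx tu u0 uk.
have [nwt x12] := direction4_newton _ _ _ _ D.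
have [x0 x2] := direction4_max _ _ _ _ _ D.
have [yx zy wz _ _] := D.
have K0 : 0 < (x - y) * (x - z) * (x - w).
  by apply: mulr_gt0; [apply: mulr_gt0|]; lra.
have k2 : k ^+ 2 = 3^-1 by lra.
have kk : k * k = 3^-1 by rewrite -expr2.
pose Y := 2 * k * x; pose v := 2 * k * u.
have xE : x = 3 / 2 * (k * Y).
  by rewrite /Y; transitivity (3 * (k * k) * x); [rewrite kk; field|field].
have uE : u = 3 / 2 * (k * v).
  by rewrite /v; transitivity (3 * (k * k) * u); [rewrite kk; field|field].
have Y0 : 0 < Y by rewrite /Y !mulr_gt0.
have Y1 : Y <= 1.
  rewrite -ler_sqr_nneg ?expr1n//; last exact: ltW.
  by rewrite /Y !exprMn k2; lra.
have Y13 : 1 / 3 <= Y.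
  rewrite -ler_sqr_nneg; [|lra|exact: ltW].
  by rewrite /Y !exprMn k2; lra.
have v0 : 0 <= v by rewrite /v !mulr_ge0// ltW.
have v13 : v <= 1 / 3 by rewrite /v; nra.
have Y2 : 12 * x ^+ 2 = 9 * Y ^+ 2 by rewrite xE !exprMn k2; field.
have ux : u <= x.
  have : k ^+ 2 <= (2 * x) ^+ 2 by rewrite exprMn k2; lra.
  rewrite ler_sqr_nneg//; lra.
have vY : v <= Y by rewrite /v /Y ler_pM2l// mulr_gt0.
have xu : x - u = 3 / 2 * k * (Y - v) by rewrite xE uE; ring.
have tgt : 9 * k / 8 * (3 * k / 2 - u) ^+ 2 = 27 / 32 * k * (1 - v) ^+ 2.
  have -> : 3 * k / 2 - u = 3 / 2 * k * (1 - v) by rewrite uE; field.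
  by rewrite !exprMn k2; field.
rewrite tgt /top_area ler_pdivlMr//.
move: nwt; rewrite Y2 (_ : 48 * x = 72 * (k * Y)); last by rewrite xE; field.
move: K0; set K := (x - y) * _ * _ => K0 nwt.
apply: (@le_trans _ _ ((x - u) ^+ 2)); last by rewrite ler_sqr_nneg//; lra.
rewrite xu !exprMn k2; clear -Y0 Y1 Y13 v0 v13 vY nwt K0 k0.
(* The square root of what Newton's inequality leaves to prove. In s = sqrt Y it is polynomial with
   a factor 1 - s, equality at s = 1 being the vertex direction. *)
have main : (9 * Y ^+ 2 - 1) * (1 - v) <= 8 * Num.sqrt Y * (Y - v).
  pose s := Num.sqrt Y; have s2 : s ^+ 2 = Y by rewrite sqr_sqrtr// ltW.
  have s0 : 0 <= s by exact: sqrtr_ge0.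
  have s1 : s <= 1 by rewrite -ler_sqr_nneg// s2 expr1n.
  have s13 : 1 / 3 <= s by rewrite -ler_sqr_nneg ?s2; lra.
  rewrite -/s -s2 -subr_ge0.
  have -> : 8 * s * (s ^+ 2 - v) - (9 * (s ^+ 2) ^+ 2 - 1) * (1 - v) =
     (1 - 3 * v) * ((1 - s) * (9 * s ^+ 3 + s ^+ 2 + s + 1)) +
     2 * v * ((3 * s ^+ 2 - 1) * ((1 - s) * (3 * s - 1))) by ring.
  have s3 := exprn_ge0 3 s0.
  have h1 : 0 <= (1 - s) * (9 * s ^+ 3 + s ^+ 2 + s + 1) by apply: mulr_ge0; lra.
  have h2 : 0 <= (3 * s ^+ 2 - 1) * ((1 - s) * (3 * s - 1)).
    by apply: mulr_ge0; [lra|apply: mulr_ge0; lra].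
  by apply: addr_ge0; apply: mulr_ge0 => //; lra.
have Y9 : 0 <= 9 * Y ^+ 2 - 1.
  have : (1 / 3) ^+ 2 <= Y ^+ 2 by rewrite ler_sqr_nneg//; lra.
  lra.
have sq : (9 * Y ^+ 2 - 1) ^+ 2 * (1 - v) ^+ 2 <= 64 * Y * (Y - v) ^+ 2.
  have -> : 64 * Y * (Y - v) ^+ 2 = (8 * Num.sqrt Y * (Y - v)) ^+ 2.
    by rewrite !exprMn sqr_sqrtr ?ltW//; ring.
  rewrite -exprMn ler_sqr_nneg//; first by apply: mulr_ge0; lra.
  by rewrite !mulr_ge0 ?sqrtr_ge0//; lra.
have := ler_wpM2r (sqr_ge0 (1 - v)) nwt => h.
rewrite -(ler_pM2l Y0).
lra.
Qed.

(** The end t = 0, where the area for a^(1) is 27/32 k. The first bound on |2 m| encodes z <= 0 <=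
    y, the second is the range of m; their product controls m^2. *)
Lemma quad_ge_at0 k p m : 0 < k -> 3 * k ^+ 2 = 1 -> 0 <= p -> p <= 1 ->
  `|2 * m| <= 2 * p ^+ 2 - 1 -> `|2 * m| <= 1 - p ^+ 2 ->
  27 / 16 * k * quad_den R p m <= quad_num R p m 0.
Proof.
move=> k0 k3 p0 p1 mA mB.
have k_hi : k <= 26 / 45 by rewrite -ler_sqr_nneg; lra.
have A0 : 0 <= 2 * p ^+ 2 - 1 by exact: le_trans mA.
have m2 : 4 * m ^+ 2 <= (2 * p ^+ 2 - 1) * (1 - p ^+ 2).
  have -> : 4 * m ^+ 2 = `|2 * m| * `|2 * m| by rewrite -expr2 real_normK ?num_real//; ring.
  by rewrite ler_pM.
have p7 : 7 / 10 <= p by rewrite -ler_sqr_nneg//; lra.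
have h1 : 0 <= (1 - p) * (p - 7 / 10) by apply: mulr_ge0; lra.
have h2 : 0 <= (26 / 45 - k) * (3 * p ^+ 2 + 1) by apply: mulr_ge0; lra.
have h3 : 27 / 32 * k * (3 * p ^+ 2 + 1) <= 2 * p by lra.
have h4 := ler_wpM2r A0 h3.
have h5 : 0 <= k * ((2 * p ^+ 2 - 1) * (1 - p ^+ 2) - 4 * m ^+ 2) by apply: mulr_ge0; lra.
rewrite /quad_num /quad_den; lra.
Qed.

(** The end t = k / 2, where the area for a^(1) is 3/8 k. The upper bound on 2 m encodes k <= 2 y;
    with p = k P and m = w / 3 it reads w <= W. *)
Lemma quad_ge_atk k p m : 0 < k -> 3 * k ^+ 2 = 1 -> k <= p -> p <= 1 ->
  2 * m <= 2 * p ^+ 2 - 2 * k * p + k ^+ 2 - 1 -> p ^+ 2 - 1 <= 2 * m ->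
  3 / 4 * k * quad_den R p m <= quad_num R p m k.
Proof.
move=> k0 k3 kp p1 mA mB.
have k2 : k ^+ 2 = 3^-1 by lra.
pose P := p / k; have pE : p = k * P by rewrite /P mulrCA divff ?mulr1// gt_eqF.
have P1 : 1 <= P by rewrite /P ler_pdivlMr// mul1r.
have p2 : p ^+ 2 = P ^+ 2 / 3 by rewrite pE exprMn k2 mulrC.
have P3 : P <= 7 / 3.
  have pp : p ^+ 2 <= 1 by rewrite expr_le1//; lra.
  by rewrite -ler_sqr_nneg//; lra.
clearbody P; pose w := 3 * m; have mE : m = w / 3 by rewrite /w; field.
pose W := P ^+ 2 - P - 1.
have wW : w <= W.
  have : k * p = P / 3 by rewrite pE mulrA -expr2 k2 mulrC.
  by move=> kp'; rewrite /w /W; lra.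
have P2 : 1 <= P ^+ 2 by rewrite expr_ge1//; lra.
have w1 : -1 <= w by rewrite /w; lra.
have W1 : -1 <= W by exact: le_trans wW.
rewrite -subr_ge0; have -> : quad_num R p m k - 3 / 4 * k * quad_den R p m =
  k / 12 * ((W - w) * (8 + w + W) + (P - 1) ^+ 2 * (P + 1) * (7 - 3 * P)).
  by rewrite /quad_num /quad_den p2 pE mE k2 /W; field.
apply: mulr_ge0; first lra.
apply: addr_ge0; first by apply: mulr_ge0; lra.
by apply: mulr_ge0; [apply: mulr_ge0; rewrite ?sqr_ge0//; lra|lra].
Qed.

(* For fixed x, y, z, w the difference is concave in t, so it is enough to look at
   the ends of the range: t = y or t = z, where the section is a triangle, and
   t = 0 or t = k / 2. *)
Lemma middle_area_ge k x y z w t : 0 < k -> 3 * k ^+ 2 = 1 -> direction4 R x y z w ->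
  z < t -> t < y -> 0 <= t -> 2 * t <= k ->
  9 * k / 8 * (3 * k / 2 - t) ^+ 2 <= middle_area R x y z w t.
Proof.
move=> k0 k3 D zt ty t0 tk.
have [mE d0] := middle_areaE _ _ _ _ _ _ D zt ty.
have [p0 p1 m1 m2] := direction4_quad_range _ _ _ _ _ D.
have dE := quad_denE _ _ _ _ _ D.
have nE s := quad_numE _ _ _ _ _ s D.
have [yx zy wz sm n] := D.
have [x0 x2] := direction4_max _ _ _ _ _ D.
rewrite mE ler_pdivlMr ?mulr_gt0//.
have k2 : k ^+ 2 = 3^-1 by lra.
have kk : k * k = 3^-1 by rewrite -expr2.
pose f s := quad_num R (x + y) ((x + z) * (x + w)) (2 * s) -
  9 * k / 8 * (3 * k / 2 - s) ^+ 2 * (2 * quad_den R (x + y) ((x + z) * (x + w))).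
rewrite -subr_ge0 -/(f t).
have concave lo hi : lo <= t -> t <= hi -> 0 <= f lo -> 0 <= f hi -> 0 <= f t.
  pose p := x + y; pose m := (x + z) * (x + w); pose d := quad_den R p m.
  have fE s : f s = (p * (2 * p ^+ 2 - 1) - 81 / 16 * k ^+ 3 * d) +
     (27 / 4 * k ^+ 2 * d - 4 * m) * s - (4 * p + 9 / 4 * k * d) * s ^+ 2.
    by rewrite /f /quad_num -/p -/m -/d; field.
  rewrite !fE; apply: concave_quadratic_ge0.
  have kd : 0 <= k * d by apply: mulr_ge0; exact: ltW.
  by rewrite -/p in p0; lra.
have bottom lo : w < z -> lo = z -> 0 <= lo -> 2 * lo <= k -> 0 <= f lo.
  move=> wz' -> lo0 lok.
  have D' := direction4_opp _ _ _ _ _ D.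
  have := top_area_ge k _ _ _ _ (- z) z k0 k3 D'; rewrite lexx ltrN2.
  move=> /(_ isT wz' _ lo0 lok) => H.
  have {H} : 9 * k / 8 * (3 * k / 2 - z) ^+ 2 <= top_area R (- w) (- z) (- y) (- x) (- z).
    by apply: H; lra.
  have -> : top_area R (- w) (- z) (- y) (- x) (- z) = (z - w) / ((y - w) * (x - w)).
    rewrite /top_area; field; do ?[apply/andP; split]; apply/eqP; lra.
  rewrite ler_pdivlMr; last by apply: mulr_gt0; lra.
  rewrite /f nE dE => h; rewrite subrr mulr0 mul0r addr0.
  have q0 : 0 <= (y - z) * (x - z) by apply: mulr_ge0; lra.
  have := ler_wpM2r q0 h; lra.
have top hi : y < x -> hi = y -> 0 <= hi -> 2 * hi <= k -> 0 <= f hi.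
  move=> yx' -> hi0 hik.
  have H : 9 * k / 8 * (3 * k / 2 - y) ^+ 2 <= top_area R x y z w y.
    by apply: (top_area_ge k) => //; lra.
  move: H; have -> : top_area R x y z w y = (x - y) / ((x - z) * (x - w)).
    rewrite /top_area; field; do ?[apply/andP; split]; apply/eqP; lra.
  rewrite ler_pdivlMr; last by apply: mulr_gt0; lra.
  rewrite /f nE dE => h; rewrite subrr mulr0 mul0r add0r.
  have q0 : 0 <= (y - z) * (y - w) by apply: mulr_ge0; lra.
  have := ler_wpM2r q0 h; lra.
have f0 : z <= 0 -> 0 <= y -> 0 <= f 0.
  move=> z0 y0; have [q [r [[]]]] := direction4_frame _ _ _ _ _ D.
  rewrite /f mulr0; move: z0 y0 wz yx p0 p1 m1 m2; clear -k0 k3 k2.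
  move=> z0 y0 wz yx p0 p1 m1 m2 xE yE zE wE [nn mE].
  have -> : 9 * k / 8 * (3 * k / 2 - 0) ^+ 2 = 27 / 32 * k.
    by transitivity (81 / 32 * k ^+ 2 * k); [field|rewrite k2; field].
  have a1 : (q + r) ^+ 2 <= (x + y) ^+ 2 by rewrite ler_sqr_nneg//; lra.
  have a2 : (q - r) ^+ 2 <= (x + y) ^+ 2 by rewrite ler_sqr_nneg//; lra.
  have := quad_ge_at0 k (x + y) ((x + z) * (x + w)) k0 k3 p0 p1.
  rewrite -!mE !ler_norml => H.
  suff : 27 / 16 * k * quad_den R (x + y) (q * r) <= quad_num R (x + y) (q * r) 0 by lra.
  by apply: H; apply/andP; split; rewrite -?mE in m1 m2; lra.
have fk : k <= 2 * y -> 2 * z <= k -> 0 <= f (k / 2).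
  move=> ky zk; have [q [r [[]]]] := direction4_frame _ _ _ _ _ D.
  rewrite /f; have -> : 2 * (k / 2) = k by field.
  move: ky zk wz yx zy p0 p1 m1 m2; clear -k0 k3 k2.
  move=> ky zk wz yx zy p0 p1 m1 m2 xE yE zE wE [nn mE].
  have -> : 9 * k / 8 * (3 * k / 2 - k / 2) ^+ 2 = 3 / 8 * k.
    by transitivity (9 / 8 * k ^+ 2 * k); [field|rewrite k2; field].
  have a1 : (q + r) ^+ 2 <= (x + y - k) ^+ 2 by rewrite ler_sqr_nneg//; lra.
  have kp : k <= x + y by lra.
  have := quad_ge_atk k (x + y) ((x + z) * (x + w)) k0 k3 kp p1.
  rewrite -!mE => H.
  suff : 3 / 4 * k * quad_den R (x + y) (q * r) <= quad_num R (x + y) (q * r) k by lra.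
  by apply: H; rewrite -?mE in m1 m2; lra.
have hi_ok : exists2 hi, t <= hi & 0 <= f hi.
  have [ky|yk] := leP k (2 * y).
    by exists (k / 2); [lra|apply: fk; lra].
  exists y; first exact: ltW.
  apply: top => //; try lra.
  (* y = x would give 2 x < k, against 12 x^2 >= 1. *)
  rewrite lt_neqAle yx andbT; apply/eqP => yE.
  have [_ x12] := direction4_newton _ _ _ _ D.
  suff : k <= 2 * x by lra.
  rewrite -ler_sqr_nneg; [|lra|lra].
  by rewrite exprMn k2; lra.
have lo_ok : exists2 lo, lo <= t & 0 <= f lo.
  have [z0|z0] := leP z 0; first by exists 0; [lra|apply: f0; lra].
  exists z; first exact: ltW.
  by apply: bottom => //; lra.
have [lo l1 l2] := lo_ok; have [hi h1 h2] := hi_ok.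
exact: concave l1 h1 l2 h2.
Qed.
End lower_bounds.

(** * Extremal sections *)

Section area_bounds.
Variable R : realType.
Implicit Types (a : 'rV[R]_4) (t x y z w : R).

Lemma sorted_values_exist a : exists x y z w, sorted_values R a x y z w.
Proof.
have [i0 [i1 [i2 [i3 [U [h01 h12 h23]]]]]] := sorted_uniq4 R a.
exists (a ord0 i0), (a ord0 i1), (a ord0 i2), (a ord0 i3); split=> //.
by exists i0, i1, i2, i3.
Qed.

Lemma sorted_values_direction4 a x y z w :
  directions a -> sorted_values R a x y z w -> direction4 R x y z w.
Proof.
move=> [a2 a1] [yx zy wz [i0 [i1 [i2 [i3 [U [E0 E1 E2 E3]]]]]]].
rewrite /sphere3 /= (sum_uniq4 _ _ _ _ _ _ U) E0 E1 E2 E3 in a2.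
rewrite (sum_uniq4 _ _ _ _ _ _ U) E0 E1 E2 E3 in a1.
by split.
Qed.

(** Bottom triangles are written with the reflected direction, so that the inequalities for
    [top_area] serve twice. *)
Lemma section_area_spec a t : directions a -> 0 <= t ->
  exists x y z w, direction4 R x y z w /\
  [\/ t <= z /\ section_area a t = (top_area R (- w) (- z) (- y) (- x) (- t))%:E,
      [/\ z < t, t < y & section_area a t = (middle_area R x y z w t)%:E],
      [/\ y <= t, t < x & section_area a t = (top_area R x y z w t)%:E] |
      [/\ x <= t, z < t & section_area a t = 0%E]].
Proof.
move=> da t0; have [x [y [z [w sv]]]] := sorted_values_exist a.
have D := sorted_values_direction4 _ _ _ _ _ da sv.
exists x, y, z, w; split=> //; have [yx zy wz s n] := D.
have [x0 _] := direction4_max _ _ _ _ _ D.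
have wt : w < t by lra.
have [tz|zt] := leP t z.
  apply: Or41; split=> //; rewrite (section_area_bottom _ _ _ _ _ _ _ da sv)//.
  rewrite /top_area; congr (_ / _)%:E; first ring.
  by ring.
have [xt|tx] := leP x t.
  apply: Or44; split=> //; apply: (section_area_beyond _ _ _ _ _ _ _ da sv) => //.
  by have [?|?] := ltP z x; [left|right; lra].
have [yt|ty] := leP y t.
  by apply: Or43; split=> //; rewrite (section_area_top _ _ _ _ _ _ _ da sv).
apply: Or42; split=> //; rewrite (section_area_middle _ _ _ _ _ _ _ da sv)//.
Qed.

Lemma vec4_val x y z w : exists i0 i1 i2 i3 : 'I_4, uniq [:: i0; i1; i2; i3] /\
  let a := vec4 x y z w in
  [/\ a ord0 i0 = x, a ord0 i1 = y, a ord0 i2 = z & a ord0 i3 = w].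
Proof.
exists ord0, (lift ord0 ord0), (lift ord0 (lift ord0 ord0)), ord_max.
by split=> //; split; rewrite mxE.
Qed.

Lemma sorted_values_vec4 x y z w : y <= x -> z <= y -> w <= z ->
  sorted_values R (vec4 x y z w) x y z w.
Proof. by move=> *; split=> //; exact: vec4_val. Qed.

Lemma directions_vec4 x y z w : x + y + z + w = 0 ->
  x ^+ 2 + y ^+ 2 + z ^+ 2 + w ^+ 2 = 1 -> directions (vec4 x y z w).
Proof.
move=> s n; have [i0 [i1 [i2 [i3 [U [E0 E1 E2 E3]]]]]] := vec4_val x y z w.
by split; rewrite /sphere3 /= (sum_uniq4 _ _ _ _ _ _ U) E0 E1 E2 E3.
Qed.

Lemma scale_vec4 (c x y z w : R) :
  c *: vec4 x y z w = vec4 (c * x) (c * y) (c * z) (c * w).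
Proof.
by apply/rowP => j; rewrite !mxE; case: j => -[|[|[|[|]]]].
Qed.

Definition k3 : R := (Num.sqrt 3)^-1.

Lemma k3_gt0 : 0 < k3. Proof. by rewrite invr_gt0 sqrtr_gt0. Qed.

Lemma k3_sq : 3 * k3 ^+ 2 = 1.
Proof. by rewrite /k3 exprVn sqr_sqrtr// divff. Qed.

Lemma sqrt3E : Num.sqrt 3 = 3 * k3 :> R.
Proof.
have s0 : Num.sqrt 3 != 0 :> R by rewrite gt_eqF// sqrtr_gt0.
apply: (mulfI s0); rewrite -expr2 sqr_sqrtr// mulrCA /k3 divff// mulr1.
by [].
Qed.

Lemma half_k3E : (2 * Num.sqrt 3)^-1 = k3 / 2 :> R.
Proof. by rewrite invfM mulrC. Qed.

Lemma a_oneE : a_one R = vec4 (3 * k3 / 2) (- (k3 / 2)) (- (k3 / 2)) (- (k3 / 2)).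
Proof. by rewrite /a_one half_k3E scale_vec4 mulrN1 mulrC mulrA. Qed.

Lemma directions_a_one : directions (a_one R).
Proof. by rewrite a_oneE; apply: directions_vec4; have := k3_sq; lra. Qed.

Definition area_one t : R := 9 * k3 / 8 * (3 * k3 / 2 - t) ^+ 2.

Lemma area_oneE t : 3 * Num.sqrt 3 / 8 * (Num.sqrt 3 / 2 - t) ^+ 2 = area_one t.
Proof. by rewrite sqrt3E /area_one; ring. Qed.

Lemma section_area_a_one t : 0 <= t -> t < 3 * k3 / 2 ->
  section_area (a_one R) t = (area_one t)%:E.
Proof.
move=> t0 tk; have kp := k3_gt0.
have sv : sorted_values R (a_one R) (3 * k3 / 2) (- (k3 / 2)) (- (k3 / 2)) (- (k3 / 2)).
  by rewrite a_oneE; apply: sorted_values_vec4; lra.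
rewrite (section_area_top _ _ _ _ _ _ _ directions_a_one sv); [|lra|lra|lra].
congr (_%:E); rewrite /area_one.
have -> : 3 * k3 / 2 - - (k3 / 2) = 2 * k3 by field.
have k30 : 2 * k3 * (2 * k3) * (2 * k3) != 0 by rewrite !mulf_neq0 ?gt_eqF.
apply: (canLR (mulfK k30)).
transitivity ((3 * k3 ^+ 2) ^+ 2 * (3 * k3 / 2 - t) ^+ 2); last by field.
by rewrite k3_sq expr1n mul1r.
Qed.

(** x, y >= z and - w >= 3 z give 12 z^2 <= 1. Hence no bottom triangles occur above 1 / (2 sqrt
    3). *)
Lemma direction4_third x y z w : direction4 R x y z w -> 0 <= z -> 2 * z <= k3.
Proof.
move=> [yx zy wz s n] z0; have k0 := k3_gt0.
rewrite -ler_sqr_nneg//; [|lra|exact: ltW].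
have e1 : z ^+ 2 <= y ^+ 2 by rewrite ler_sqr_nneg//; lra.
have e2 : z ^+ 2 <= x ^+ 2 by rewrite ler_sqr_nneg//; lra.
have e3 : (3 * z) ^+ 2 <= w ^+ 2 by rewrite -[w ^+ 2]sqrrN ler_sqr_nneg//; lra.
by have := k3_sq; rewrite exprMn in e3; rewrite exprMn; lra.
Qed.

Lemma section_area_le_bracket a t Z : directions a -> 0 <= t -> 2 * t <= k3 ->
  0 < Z -> Z ^+ 2 = 2 - 8 * t ^+ 2 -> (section_area a t <= (Z^-1)%:E)%E.
Proof.
move=> da t0 tk Z0 Z2; have [x [y [z [w [D H]]]]] := section_area_spec a t da t0.
have k0 := k3_gt0.
have t12 : 12 * t ^+ 2 <= 1.
  have : (2 * t) ^+ 2 <= k3 ^+ 2 by rewrite ler_sqr_nneg//; lra.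
  by have := k3_sq; rewrite exprMn; lra.
have [yx zy wz s n] := D.
case: H => [[tz ->]|[zt ty ->]|[yt tx ->]|[xt zt ->]]; rewrite lee_fin.
- apply: top_area_le_bracket (direction4_opp _ _ _ _ _ D) _ _ _ Z0 _.
  + by rewrite lerN2.
  + have [x0 _] := direction4_max _ _ _ _ _ D; lra.
  + by rewrite sqrrN.
  + by rewrite sqrrN.
- exact: middle_area_le_bracket D zt ty Z0 Z2.
- exact: top_area_le_bracket D yt tx t12 Z0 Z2.
- by rewrite invr_ge0 ltW.
Qed.

Lemma section_area_ge_one a t : directions a -> 0 <= t -> 2 * t <= k3 ->
  ((area_one t)%:E <= section_area a t)%E.
Proof.
move=> da t0 tk; have [x [y [z [w [D H]]]]] := section_area_spec a t da t0.
have k0 := k3_gt0; have k2 := k3_sq.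
have [yx zy wz s n] := D.
have [x0 _] := direction4_max _ _ _ _ _ D.
case: H => [[tz ->]|[zt ty ->]|[yt tx ->]|[xt zt ->]]; rewrite lee_fin /area_one.
- by apply: (top_area_ge _ _ _ _ _ _ _ _ k0 k2 (direction4_opp _ _ _ _ _ D)) => //; lra.
- exact: middle_area_ge k0 k2 D zt ty t0 tk.
- by apply: (top_area_ge _ _ _ _ _ _ _ _ k0 k2 D) => //; lra.
(* Here x = k3 / 2, so the second symmetric function of the gaps vanishes, although x - z and x - w
   are positive. *)
- exfalso; have [_ x12] := direction4_newton _ _ _ _ _ D.
  have xk : k3 <= 2 * x by rewrite -ler_sqr_nneg ?exprMn; lra.
  have xE : x = k3 / 2 by lra.
  have zx : 0 < x - z by lra.
  have : 0 < (x - y) * (x - z) + (x - z) * (x - w).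
    by apply: ltr_wpDl; [apply: mulr_ge0; lra|apply: mulr_gt0; lra].
  have : 0 <= (x - w) * (x - y) by apply: mulr_ge0; lra.
  have w0 : w = - x - y - z by lra.
  have e2 : 2 * ((x - y) * (x - z) + (x - z) * (x - w) + (x - w) * (x - y)) = 12 * x ^+ 2 - 1.
    transitivity (12 * x ^+ 2 - (x ^+ 2 + y ^+ 2 + z ^+ 2 + w ^+ 2)); last by rewrite n.
    by rewrite w0; ring.
  have : 12 * x ^+ 2 = 1 by rewrite xE; transitivity (3 * k3 ^+ 2); [field|].
  lra.
Qed.

Lemma section_area_le_gbound a t c : directions a -> k3 < 2 * t -> 4 * t <= 3 * k3 ->
  gbound R c (2 * t) -> (section_area a t <= c%:E)%E.
Proof.
move=> da kt tk gc; have k0 := k3_gt0; have k2 := k3_sq.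
have t0 : 0 <= t by lra.
have [x [y [z [w [D H]]]]] := section_area_spec a t da t0.
have [yx zy wz s n] := D.
case: H => [[tz ->]|[zt ty ->]|[yt tx ->]|[xt zt ->]]; rewrite lee_fin.
- by exfalso; have := direction4_third _ _ _ _ D; lra.
- have [-> d0] := middle_areaE _ _ _ _ _ _ D zt ty.
  have [p0 p1 m1 m2] := direction4_quad_range _ _ _ _ _ D.
  apply: (@quad_le_gbound R k3 c) => //; first exact: ltW.
  + by rewrite p1 andbT; lra.
  + by rewrite m1 m2.
- exact: top_area_mid k0 k2 D yt tx (ltW kt) tk gc.
- have t1 : 2 * t <= 1.
    have : k3 <= 3 / 5 by rewrite -ler_sqr_nneg; lra.
    lra.
  have := gc 1; rewrite lexx t1 expr1n => /(_ isT) h.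
  have : 0 <= 1 - (2 * t) ^+ 2 by rewrite subr_ge0 expr_le1//; lra.
  lra.
Qed.

(** c dominates both candidates: it is taken as the value at a^(2) up to t_0 and as the value at
    a^(1) from there on. *)
Lemma section_area_le_far a t c : directions a -> 3 * k3 <= 4 * t ->
  area_one t <= c -> (1 - (2 * t) ^+ 2) / 2 <= c -> (section_area a t <= c%:E)%E.
Proof.
move=> da kt one_le le; have k0 := k3_gt0; have k2 := k3_sq.
have t0 : 0 <= t by lra.
have one0 : 0 <= c by apply: le_trans one_le; rewrite /area_one mulr_ge0 ?sqr_ge0//; lra.
have [x [y [z [w [D H]]]]] := section_area_spec a t da t0.
have [yx zy wz s n] := D.
case: H => [[tz ->]|[zt ty ->]|[yt tx ->]|[xt zt ->]]; rewrite lee_fin//.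
- by exfalso; have := direction4_third _ _ _ _ D; lra.
- have [-> d0] := middle_areaE _ _ _ _ _ _ D zt ty.
  have [p0 p1 m1 m2] := direction4_quad_range _ _ _ _ _ D.
  apply: (le_trans _ le); apply: (@quad_le_gbound R k3) => //; first lra.
  + by rewrite p1 andbT; lra.
  + by rewrite m1 m2.
  + apply: gbound_two; first lra.
    have : 6 / 7 <= 2 * t.
      have : 4 / 7 <= k3 by rewrite -ler_sqr_nneg; lra.
      lra.
    move: (2 * t) => u hu; nra.
- exact: le_trans (top_area_large _ _ _ _ _ _ _ k0 k2 D yt tx kt) one_le.
Qed.

End area_bounds.

(** * The extremal directions and the function phi *)

Section extremal_directions.
Variable R : realType.
Implicit Types (a : 'rV[R]_4) (t x y z w : R).
Local Notation k3 := (k3 R).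

Import numFieldNormedType.Exports.

Lemma phi_continuous : continuous (@phi R).
Proof.
move=> x; rewrite /phi; apply: cvgM; last first.
  apply: cvgV; first by rewrite gt_eqF// ltr_pwDl// mulr_ge0// sqr_ge0.
  by apply: cvgD; [exact: cvg_cst|apply: cvgM; [exact: cvg_cst|exact: exprn_continuous]].
have sq c : (fun y : R => c * y ^+ 2) @ x --> c * x ^+ 2.
  by apply: cvgM; [exact: cvg_cst|exact: exprn_continuous].
apply: cvgD; apply: cvgM.
- exact: cvg_id.
- by apply: cvgB; [exact: cvg_cst|exact: sq].
- by apply: cvgB; [exact: sq|exact: cvg_cst].
apply: (@continuous_comp _ _ _ (fun y : R => 28 * y ^+ 2 - 1) Num.sqrt).
  by apply: cvgB; [exact: sq|exact: cvg_cst].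
exact: sqrt_continuous.
Qed.

Lemma phi_crit x : k3 / 2 <= x -> x <= 2^-1 ->
  exists k, [/\ 2 <= k, k ^+ 2 <= 6, (2 * x) ^+ 2 * (7 - k ^+ 2) = 1 &
    2 * phi x = 2 * x * crit_scale R k].
Proof.
move=> kx x1; have k0 := k3_gt0 R; have k2 := k3_sq R.
have x0 : 0 < x by lra.
have x12 : 1 <= 12 * x ^+ 2.
  have : k3 ^+ 2 <= (2 * x) ^+ 2 by rewrite ler_sqr_nneg//; lra.
  by rewrite exprMn; lra.
have x4 : 4 * x ^+ 2 <= 1.
  have : (2 * x) ^+ 2 <= 1 ^+ 2 by rewrite ler_sqr_nneg//; lra.
  by rewrite exprMn expr1n; lra.
pose S := Num.sqrt (28 * x ^+ 2 - 1).
have S2 : S ^+ 2 = 28 * x ^+ 2 - 1 by rewrite sqr_sqrtr//; lra.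
(* In this variable numerator and denominator of phi share the factor P^2 (4 - k), P = 2 x. The ends
   of the interval for x correspond to k = 2 and k^2 = 6. *)
pose k := S / (2 * x); have Sk : S = 2 * x * k by rewrite /k; field; rewrite gt_eqF.
have kk0 : 0 <= k by rewrite /k divr_ge0 ?sqrtr_ge0//; lra.
have P1 : (2 * x) ^+ 2 * (7 - k ^+ 2) = 1.
  by rewrite mulrBr -exprMn -Sk S2; ring.
have P0 : 0 < (2 * x) ^+ 2 by rewrite exprn_gt0//; lra.
have k_lo : 0 <= k ^+ 2 - 4.
  by rewrite -(pmulr_rge0 _ P0); rewrite exprMn in P1 *; lra.
have k_hi : 0 <= 6 - k ^+ 2.
  by rewrite -(pmulr_rge0 _ P0); rewrite exprMn in P1 *; lra.
have k5 : k <= 5 / 2 by rewrite -ler_sqr_nneg//; lra.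
exists k; split=> //.
- by rewrite -(@ler_sqr_nneg _ 2 k)//; lra.
- lra.
rewrite /phi -/S Sk /crit_scale.
pose P := 2 * x; have xE : x = P / 2 by rewrite /P; field.
rewrite -/P in P1; rewrite -/P; clearbody k P.
have D1 : 1 + 36 * x ^+ 2 = P ^+ 2 * ((4 + k) * (4 - k)) by rewrite xE; lra.
have N1 : x * (5 - 12 * x ^+ 2) + (6 * x ^+ 2 - 2^-1) * (P * k) =
   P ^+ 2 * ((4 - k) * (P / 2 * (8 + k - k ^+ 2))).
  have e1 : P ^+ 2 * (7 - k ^+ 2) * P = P by rewrite P1 mul1r.
  have e2 : P ^+ 2 * (7 - k ^+ 2) * P * k = P * k by rewrite P1 mul1r.
  by rewrite xE; lra.
rewrite N1 D1; field.
have P0' : P != 0 by apply/eqP => PE; move: P1; rewrite PE expr0n mul0r; lra.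
by rewrite P0' /=; apply/andP; split; rewrite gt_eqF//; lra.
Qed.

Lemma phi_at_left : phi (k3 / 2) = k3 / 2.
Proof.
have k0 := k3_gt0 R; have k2 := k3_sq R.
have kE : k3 ^+ 2 = 3^-1 by lra.
have -> : phi (k3 / 2) = (k3 / 2 * (5 - 3 * k3 ^+ 2) +
   (3 / 2 * k3 ^+ 2 - 2^-1) * Num.sqrt (28 * (k3 / 2) ^+ 2 - 1)) / (1 + 9 * k3 ^+ 2).
  by rewrite /phi; congr ((_ * _ + _ * _) / _); field.
by rewrite kE (_ : 3 / 2 * 3^-1 - 2^-1 = 0) ?mul0r; field.
Qed.

Lemma phi_at_right : phi 2^-1 = t_one R.
Proof.
rewrite /phi /t_one (_ : 28 * 2^-1 ^+ 2 - 1 = 6); last by field.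
by field.
Qed.

Lemma phi_solution_exists t : k3 / 2 <= t -> t <= t_one R ->
  exists x, phi_solution t x.
Proof.
move=> kt t1; have k0 := k3_gt0 R; have k2 := k3_sq R.
have ab : k3 / 2 <= 2^-1 :> R.
  have : k3 <= 1 by rewrite -ler_sqr_nneg// ?expr1n; [lra|exact: ltW].
  lra.
have [||x] := @IVT R (@phi R) (k3 / 2) 2^-1 t ab.
- by apply: continuous_subspaceT => y; exact: phi_continuous.
- by rewrite phi_at_left phi_at_right ge_min le_max kt t1 orbT.
by rewrite in_itv /= => xi <-; exists x; split=> //; rewrite half_k3E.
Qed.

Lemma phi_solution_unique t x x' : phi_solution t x -> phi_solution t x' -> x = x'.
Proof.
rewrite /phi_solution half_k3E => -[/andP[x1 x2] xE] [/andP[y1 y2] yE].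
have k0 := k3_gt0 R.
have [k [h1 h2 h3 h4]] := phi_crit _ x1 x2.
have [k' [h1' h2' h3' h4']] := phi_crit _ y1 y2.
have E : 2 * x * crit_scale R k = 2 * x' * crit_scale R k' by rewrite -h4 -h4' xE yE.
have x0 : 0 < 2 * x by lra.
have x0' : 0 < 2 * x' by lra.
have := crit_scale_inj _ _ _ _ _ h1 h2 h1' h2' x0 h3 x0' h3' E.
lra.
Qed.

Lemma directions_bracket t : 0 <= t -> 2 * t <= k3 -> directions (a_bracket t).
Proof.
move=> t0 tk; apply: directions_vec4; first by ring.
have t12 : 12 * t ^+ 2 <= 1.
  have : (2 * t) ^+ 2 <= k3 ^+ 2 by rewrite ler_sqr_nneg//; lra.
  by have := k3_sq R; rewrite exprMn; lra.
have : Num.sqrt (2 - 8 * t ^+ 2) ^+ 2 = 2 - 8 * t ^+ 2 by rewrite sqr_sqrtr//; lra.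
move: (Num.sqrt _) => Z Z2.
transitivity (Z ^+ 2 / 2 + 4 * t ^+ 2); first by field.
by rewrite Z2; field.
Qed.

(** Both middle entries equal t, so the bottom formula applies in its limit case t = a2, and (t -
    a3)^2 cancels. *)
Lemma section_area_bracket t : 0 <= t -> 2 * t <= k3 ->
  section_area (a_bracket t) t = ((Num.sqrt (2 - 8 * t ^+ 2))^-1)%:E.
Proof.
move=> t0 tk; have da := directions_bracket _ t0 tk.
have t12 : 12 * t ^+ 2 <= 1.
  have : (2 * t) ^+ 2 <= k3 ^+ 2 by rewrite ler_sqr_nneg//; lra.
  by have := k3_sq R; rewrite exprMn; lra.
have : Num.sqrt (2 - 8 * t ^+ 2) ^+ 2 = 2 - 8 * t ^+ 2 by rewrite sqr_sqrtr//; lra.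
have : 0 < Num.sqrt (2 - 8 * t ^+ 2) by rewrite sqrtr_gt0; lra.
move: da; rewrite /a_bracket; move: (Num.sqrt _) => Z da Z0 Z2.
have Zt : 4 * t <= Z by rewrite -ler_sqr_nneg//; [rewrite exprMn; lra|lra|exact: ltW].
have sv : sorted_values R (vec4 (2^-1 * Z - t) t t (- (2^-1 * Z + t)))
    (2^-1 * Z - t) t t (- (2^-1 * Z + t)) by apply: sorted_values_vec4; lra.
rewrite (section_area_bottom _ _ _ _ _ _ _ da sv); [|lra|lra].
congr (_%:E); have -> : 2^-1 * Z - t - - (2^-1 * Z + t) = Z by field.
have n0 : t - - (2^-1 * Z + t) != 0 by rewrite gt_eqF//; lra.
move: n0; move: (t - - _) => n n0; field.
by rewrite n0 gt_eqF.
Qed.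

Lemma directions_brace x : x <= 2^-1 -> 0 <= x -> directions (a_brace x).
Proof.
move=> x1 x0; apply: directions_vec4; first by ring.
have x4 : 4 * x ^+ 2 <= 1.
  have : (2 * x) ^+ 2 <= 1 ^+ 2 by rewrite ler_sqr_nneg//; lra.
  by rewrite exprMn expr1n; lra.
have : Num.sqrt (2 - 8 * x ^+ 2) ^+ 2 = 2 - 8 * x ^+ 2 by rewrite sqr_sqrtr//; lra.
move: (Num.sqrt _) => W W2.
transitivity (W ^+ 2 / 2 + 4 * x ^+ 2); first by field.
by rewrite W2; field.
Qed.

(** Two equal largest entries realize the extreme m of [quad_le_gbound], and p = 2 x is the critical
    point, so c is [crit_value]. *)
Lemma section_area_brace t x : k3 < 2 * t -> phi_solution t x ->
  exists c, section_area (a_brace x) t = c%:E /\ gbound R c (2 * t).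
Proof.
rewrite /phi_solution half_k3E => kt [/andP[kx x1] xt].
have k0 := k3_gt0 R; have k2 := k3_sq R.
have [k [h1 h2 h3 h4]] := phi_crit _ kx x1; rewrite xt in h4.
have x0 : 0 < x by lra.
have P0 : 0 < 2 * x by lra.
have s1 := crit_scale_le1 R k h1.
have tx : 2 * t <= 2 * x by rewrite h4 ger_pMr.
have kx' : k3 ^+ 2 < (2 * x) ^+ 2 by rewrite ltr_sqr_nneg//; lra.
have x4 : (2 * x) ^+ 2 <= 1.
  have : (2 * x) ^+ 2 <= 1 ^+ 2 by rewrite ler_sqr_nneg//; lra.
  by rewrite expr1n.
pose c := crit_value R k (2 * x).
have da := directions_brace _ x1 (ltW x0).
exists c; split.
(* t = x would give [crit_scale] 1, so k^2 = 4 and 3 (2 x)^2 = 1, against 2 x > k3. *)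
- have tltx : t < x.
    rewrite lt_neqAle; apply/andP; split; last lra.
    apply/eqP => E; have s1E : crit_scale R k = 1.
      by apply: (mulfI (lt0r_neq0 P0)); rewrite -h4 E mulr1.
    have k4 : 4 + k != 0 by rewrite gt_eqF//; lra.
    have : 8 + k - k ^+ 2 = 4 + k.
      transitivity (crit_scale R k * (4 + k)); last by rewrite s1E mul1r.
      by rewrite /crit_scale divfK.
    move=> kE; have k24 : k ^+ 2 = 4 by lra.
    by rewrite k24 in h3; lra.
  pose W := Num.sqrt (2 - 8 * x ^+ 2).
  have x4' : 4 * x ^+ 2 <= 1 by rewrite exprMn in x4; lra.
  have x12 : 1 <= 12 * x ^+ 2 by rewrite exprMn in kx'; lra.
  have W2 : W ^+ 2 = 2 - 8 * x ^+ 2 by rewrite sqr_sqrtr//; lra.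
  have W0 : 0 <= W by exact: sqrtr_ge0.
  have W4 : W <= 4 * x by rewrite -ler_sqr_nneg//; [rewrite exprMn; lra|lra].
  (* That is, the third entry lies below t. *)
  have Wt : W < 2 * (x + t).
    rewrite ltNge -ler_sqr_nneg//; [|lra].
    apply/negP => h; have : (2 * k3) ^+ 2 < (2 * (x + t)) ^+ 2.
      by rewrite ltr_sqr_nneg//; lra.
    by rewrite exprMn; lra.
  have sv : sorted_values R (a_brace x) x x (- x + 2^-1 * W) (- x - 2^-1 * W).
    by apply: sorted_values_vec4; rewrite -/W; lra.
  have D := sorted_values_direction4 _ _ _ _ _ _ da sv.
  rewrite (section_area_middle _ _ _ _ _ _ _ da sv); [|lra|lra].
  have zt : - x + 2^-1 * W < t by lra.
  have [mE d0] := middle_areaE _ _ _ _ _ _ D zt tltx.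
  rewrite -/(middle_area R x x (- x + 2^-1 * W) (- x - 2^-1 * W) t) mE; congr (_%:E).
  have e := crit_value_eq R _ _ _ h1 P0 h3 h4.
  have xx : x + x = 2 * x by ring.
  have mm : (x + (- x + 2^-1 * W)) * (x + (- x - 2^-1 * W)) = ((2 * x) ^+ 2 - 1) / 2.
    by transitivity (- (W ^+ 2) / 4); [field|rewrite W2; field].
  rewrite xx mm in d0 *.
  have dE : quad_den R (2 * x) (((2 * x) ^+ 2 - 1) / 2) = ((3 * (2 * x) ^+ 2 - 1) / 2) ^+ 2.
    by rewrite /quad_den; field.
  apply: (canLR (mulfK _)); first by rewrite mulf_neq0// gt_eqF.
  rewrite dE; have -> : c * (2 * ((3 * (2 * x) ^+ 2 - 1) / 2) ^+ 2) =
    c * (3 * (2 * x) ^+ 2 - 1) ^+ 2 / 2 by field.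
  by rewrite -/c in e; rewrite -e /quad_num; field.
- move=> p /andP[sp p1]; apply: crit_value_bound => //; first lra.
  have : k3 ^+ 2 <= p ^+ 2 by rewrite ler_sqr_nneg//; lra.
  lra.
Qed.

Lemma directions_a_two : directions (a_two R).
Proof. by rewrite /a_two scale_vec4; apply: directions_vec4; lra. Qed.

Lemma section_area_a_two t : 0 <= t -> t < 2^-1 ->
  section_area (a_two R) t = (2^-1 - 2 * t ^+ 2)%:E.
Proof.
move=> t0 t1.
have sv : sorted_values R (a_two R) 2^-1 2^-1 (- 2^-1) (- 2^-1).
  by rewrite /a_two scale_vec4 !mulrN1 mulr1; apply: sorted_values_vec4; lra.
rewrite (section_area_middle _ _ _ _ _ _ _ directions_a_two sv); [|lra|lra].
by congr (_%:E); field; rewrite ?pnatr_eq0.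
Qed.

(** * The threshold t_0 *)

Section thresholds.
Local Notation q := (Num.sqrt 3 : R).
Local Notation r := (Num.sqrt (16 - 6 * Num.sqrt 3) : R).

Let q2 : q ^+ 2 = 3. Proof. by rewrite sqr_sqrtr. Qed.
Let q0 : 0 <= q. Proof. exact: sqrtr_ge0. Qed.
Let qlo : 17 / 10 <= q. Proof. by have := q2; rewrite -ler_sqr_nneg//; lra. Qed.
Let qhi : q <= 18 / 10. Proof. by have := q2; rewrite -ler_sqr_nneg//; lra. Qed.
Let r0 : 0 <= r. Proof. exact: sqrtr_ge0. Qed.
Let r2 : r ^+ 2 = 16 - 6 * q. Proof. by rewrite sqr_sqrtr//; have := qhi; lra. Qed.
Let t0E : 2 * (3 * q + 16) * t_zero R = 9 + 4 * r.
Proof. by rewrite /t_zero mulrC divfK// gt_eqF//; have := q0; lra. Qed.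

Lemma t_zero_lt : t_zero R < 2^-1.
Proof.
have [h1 h2 h3 h4] := And4 qlo q0 r0 r2; have e := t0E.
have d0 : 0 < 2 * (3 * q + 16) by lra.
rewrite -(ltr_pM2l d0) e; have : (4 * r) ^+ 2 < (7 + 3 * q) ^+ 2.
  by have := q2; rewrite exprMn h4; lra.
by rewrite ltr_sqr_nneg//; lra.
Qed.

Lemma t_zero_ge : q <= 4 * t_zero R.
Proof.
have [h1 h2 h3 h4] := And4 qlo q0 r0 r2; have h5 := qhi; have e := t0E; have qq := q2.
have d0 : 0 < 2 * (3 * q + 16) by lra.
rewrite -(ler_pM2l d0) mulrCA e; have : (16 * q - 9) ^+ 2 <= (8 * r) ^+ 2.
  by rewrite exprMn h4; lra.
by rewrite ler_sqr_nneg//; lra.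
Qed.

(** Completing the square in the difference of the areas puts its zeros at v = 4 r, which is t_0,
    and at v = - 4 r, where t <= 0 because 4 r >= 9. *)
Lemma t_zero_compare t : 0 <= t ->
  (t <= t_zero R -> area_one R t <= 2^-1 - 2 * t ^+ 2) /\
  (t_zero R <= t -> 2^-1 - 2 * t ^+ 2 <= area_one R t).
Proof.
move=> t0; have [h1 h2 h3 h4] := And4 qlo q0 r0 r2; have h5 := qhi; have e := t0E; have qq := q2.
have d0 : 0 < 2 * (3 * q + 16) by lra.
pose v := 2 * (3 * q + 16) * t - 9.
have key : area_one R t - (2^-1 - 2 * t ^+ 2) = (v ^+ 2 - (4 * r) ^+ 2) / (32 * (3 * q + 16)).
  rewrite -area_oneE /v exprMn h4.
  have n0 : 32 * (3 * q + 16) != 0 by rewrite gt_eqF//; lra.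
  apply/esym; apply: (canLR (mulfK n0)).
  have q3 : q ^+ 3 = 3 * q by rewrite exprS qq mulrC.
  have q4 : q ^+ 4 = 9 by rewrite (exprM q 2 2) qq; ring.
  have q2t : q ^+ 2 * t = 3 * t by rewrite qq.
  have q3t : q ^+ 3 * t = 3 * q * t by rewrite q3.
  clear -qq q3 q4 q2t q3t; lra.
have n0 : 0 < 32 * (3 * q + 16) by lra.
split=> h.
  rewrite -subr_le0 key pmulr_lle0 ?invr_gt0// subr_le0.
  have vr : v <= 4 * r by rewrite /v; have := ler_wpM2l (ltW d0) h; lra.
  have rv : - (4 * r) <= v.
    have : 9 <= 4 * r by rewrite -ler_sqr_nneg// ?exprMn ?h4; lra.
    have : 0 <= 2 * (3 * q + 16) * t by rewrite mulr_ge0// ltW.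
    by rewrite /v; lra.
  by rewrite -subr_ge0 subr_sqr mulr_ge0//; lra.
rewrite -subr_le0 -oppr_ge0 opprB key pmulr_lge0 ?invr_gt0// subr_ge0.
have vr : 4 * r <= v by rewrite /v; have := ler_wpM2l (ltW d0) h; lra.
by rewrite ler_sqr_nneg//; lra.
Qed.
End thresholds.

End extremal_directions.

Lemma k3_bounds (R : realType) : 1 / 2 <= k3 R /\ k3 R <= 3 / 5.
Proof.
have k0 := ltW (k3_gt0 R); have k2 := k3_sq R.
by split; rewrite -ler_sqr_nneg; lra.
Qed.

Lemma t_one_bounds (R : realType) : [/\ k3 R < 2 * t_one R, 4 * t_one R <= 3 * k3 R &
  forall t, t_one R <= t -> 1 <= 5 * (2 * t) ^+ 2 - 2 * (2 * t)].
Proof.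
have [k1 k2] := k3_bounds R.
have g0 : 0 <= Num.sqrt 6 :> R by exact: sqrtr_ge0.
have g2 : Num.sqrt 6 ^+ 2 = 6 :> R by rewrite sqr_sqrtr.
have g_lo : 24 / 10 <= Num.sqrt 6 :> R by rewrite -ler_sqr_nneg; lra.
have g_hi : Num.sqrt 6 <= 25 / 10 :> R by rewrite -ler_sqr_nneg; lra.
rewrite /t_one; split; [lra|lra|move=> t tt].
(* The claim 5 s^2 - 2 s >= 1 with s = 2 t is (10 t - 1)^2 >= 6. *)
have : (Num.sqrt 6) ^+ 2 <= (10 * t - 1) ^+ 2 by rewrite ler_sqr_nneg//; lra.
rewrite g2; lra.
Qed.

Theorem proposition1p3 (R : realType) :
  (* the vectors a^{[t]} and a^{\{t\}} are well defined elements of S^3 *)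
  (forall t : R, 0 <= t <= (2 * Num.sqrt 3)^-1 -> sphere3 (a_bracket t)) /\
  (forall t : R, (2 * Num.sqrt 3)^-1 <= t <= t_one R ->
     (exists! x : R, phi_solution t x) /\
     (forall x : R, phi_solution t x -> sphere3 (a_brace x))) /\
  (* maximum *)
  (forall t : R, 0 <= t <= (2 * Num.sqrt 3)^-1 ->
     max_attained_at (@directions R) (fun a => section_area a t) (a_bracket t) /\
     section_area (a_bracket t) t = ((Num.sqrt (2 - 8 * t ^+ 2))^-1)%:E) /\
  (forall t x : R, (2 * Num.sqrt 3)^-1 < t <= t_one R -> phi_solution t x ->
     max_attained_at (@directions R) (fun a => section_area a t) (a_brace x)) /\
  (forall t : R, t_one R <= t <= t_zero R ->
     max_attained_at (@directions R) (fun a => section_area a t) (a_two R) /\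
     section_area (a_two R) t = (2^-1 - 2 * t ^+ 2)%:E) /\
  (forall t : R, t_zero R <= t < Num.sqrt 3 / 2 ->
     max_attained_at (@directions R) (fun a => section_area a t) (a_one R) /\
     section_area (a_one R) t =
       (3 * Num.sqrt 3 / 8 * (Num.sqrt 3 / 2 - t) ^+ 2)%:E) /\
  (* minimum *)
  (forall t : R, 0 <= t <= (2 * Num.sqrt 3)^-1 ->
     min_attained_at (@directions R) (fun a => section_area a t) (a_one R) /\
     section_area (a_one R) t =
       (3 * Num.sqrt 3 / 8 * (Num.sqrt 3 / 2 - t) ^+ 2)%:E).
Proof.
rewrite half_k3E; have k0 := k3_gt0 R.
have [t1_lo t1_hi t1_root] := t_one_bounds R.
have t0_lt := t_zero_lt R; have t0_ge := t_zero_ge R.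
have kE := sqrt3E R; have k2 := k3_sq R.
have brace_dir (t x : R) : phi_solution t x -> directions (a_brace x).
  by rewrite /phi_solution half_k3E => -[/andP[x1 x2] _]; apply: directions_brace; lra.
have halfE (t : R) : (1 - (2 * t) ^+ 2) / 2 = 2^-1 - 2 * t ^+ 2 by field.
split; [|split; [|split; [|split; [|split; [|split]]]]].
- move=> t /andP[h1 h2]; have tk : 2 * t <= k3 R by lra.
  exact: (directions_bracket R t h1 tk).1.
- move=> t /andP[h1 h2]; split; last by move=> x /brace_dir[].
  have [x xt] := phi_solution_exists R t h1 h2.
  by exists x; split=> // x' xt'; exact: phi_solution_unique xt xt'.
- move=> t /andP[h1 h2]; have tk : 2 * t <= k3 R by lra.
  have aE := section_area_bracket R t h1 tk.
  have t12 : 12 * t ^+ 2 <= 1.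
    have : (2 * t) ^+ 2 <= k3 R ^+ 2 by rewrite ler_sqr_nneg//; lra.
    by rewrite exprMn; lra.
  split; last exact: aE.
  split; first exact: directions_bracket.
  move=> b db; rewrite aE; apply: section_area_le_bracket => //.
    by rewrite sqrtr_gt0; lra.
  by rewrite sqr_sqrtr//; lra.
- move=> t x /andP[h1 h2] xt; have kt : k3 R < 2 * t by lra.
  have [c [cE gc]] := section_area_brace R t x kt xt.
  split; first exact: brace_dir xt.
  by move=> b db; rewrite cE; apply: section_area_le_gbound => //; lra.
- move=> t /andP[h1 h2]; have tpos : 0 <= t by lra.
  have tlt : t < 2^-1 by lra.
  have aE := section_area_a_two R t tpos tlt.
  split; last exact: aE.
  split; first exact: directions_a_two.
  move=> b db; rewrite aE -halfE.
  (* The range up to t_0 reaches beyond sqrt 3 / 4, so both methods are needed. *)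
  have [far|near] := leP (3 * k3 R) (4 * t).
    apply: section_area_le_far => //; rewrite halfE.
    by apply: (t_zero_compare R t tpos).1.
  apply: section_area_le_gbound => //; [lra|exact: ltW|].
  by apply: gbound_two; [lra|exact: t1_root].
- move=> t /andP[h1 h2]; rewrite kE in t0_ge h2.
  have tpos : 0 <= t by lra.
  have aE : section_area (a_one R) t = (area_one R t)%:E by apply: section_area_a_one; lra.
  rewrite area_oneE; split; last exact: aE.
  split; first exact: directions_a_one.
  move=> b db; rewrite aE; apply: section_area_le_far => //; first lra.
  by rewrite halfE; apply: (t_zero_compare R t tpos).2.
- move=> t /andP[h1 h2].
  have aE : section_area (a_one R) t = (area_one R t)%:E by apply: section_area_a_one; lra.
  rewrite area_oneE; split; last exact: aE.
  split; first exact: directions_a_one.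
  by move=> b db; rewrite aE; apply: section_area_ge_one => //; lra.
Qed.
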